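(* Let $d\in\mathbb{N}$, $\frac{2 d}{d+1} < p, r_0 < \infty$, $0 < \alpha < d/p$, $\alpha -d/p = -d/r$, $0 < q \leq \infty$ and $b > 1/q$. Then $$\mathrm{Lip}^{(\alpha,-b)}_{p,q}(\mathbb{R}^d) \hookrightarrow L_{r_0}(\mathbb{R}^d) \iff p \leq r_0 < r.$$ The corresponding result for periodic spaces also holds true, that is, the same equivalence with $\mathbb{R}^d$ replaced by $\mathbb{T}^d$: $\mathrm{Lip}^{(\alpha,-b)}_{p,q}(\mathbb{T}^d) \hookrightarrow L_{r_0}(\mathbb{T}^d) \iff p \leq r_0 < r$.
   Context: $A\hookrightarrow B$ means $A\subset B$ with continuous inclusion; $1/\infty=0$. Modulus of smoothness: for $\alpha>0$, $h\in\mathbb{R}^d$, $\Delta^\alpha_h f(x)=\sum_{j=0}^\infty(-1)^j\binom{\alpha}{j}f(x+(\alpha-j)h)$, where $\binom{\alpha}{j}=\frac{\alpha(\alpha-1)\cdots(\alpha-j+1)}{j!}$, $\binom{\alpha}{0}=1$, and for $f\in L_p(\mathbb{R}^d)$, $\omega_\alpha(f,t)_p=\sup_{|h|\le t}\|\Delta_h^\alpha f\|_{L_p(\mathbb{R}^d)}$, $t>0$. Logarithmic Lipschitz space: $\mathrm{Lip}^{(\alpha,-b)}_{p,q}(\mathbb{R}^d)$ is the set of $f\in L_p(\mathbb{R}^d)$ with $$\|f\|_{\mathrm{Lip}^{(\alpha,-b)}_{p,q}(\mathbb{R}^d)}=\|f\|_{L_p(\mathbb{R}^d)}+\Big(\int_0^1\big(t^{-\alpha}(1-\log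 t)^{-b}\omega_\alpha(f,t)_p\big)^q\frac{dt}{t}\Big)^{1/q}<\infty$$ (supremum over $0<t<1$ if $q=\infty$). The periodic space $\mathrm{Lip}^{(\alpha,-b)}_{p,q}(\mathbb{T}^d)$ on the $d$-dimensional torus $\mathbb{T}^d$ is defined by the same formulas with $L_p(\mathbb{R}^d)$ replaced by $L_p(\mathbb{T}^d)$.
   Formalization: On T^d the equivalence is stated only for r_0 ≥ p; for r_0 < p it fails as printed, since T^d has finite measure and Lip ⊂ L_p ⊂ L_{r_0} (e.g. d=1, p=2, r_0=3/2, α=1/4, q=∞, b=1), and the embedding is proved there instead. *)

(* Defs.v *)
From HB Require Import structures.
From mathcomp Require Import all_boot all_order all_algebra.
From mathcomp Require Import all_classical all_reals all_analysis.
Set Implicit Arguments.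
Unset Strict Implicit.
Unset Printing Implicit Defensive.
Import Order.TTheory GRing.Theory Num.Theory.
Import numFieldNormedType.Exports.
Local Open Scope classical_set_scope.
Local Open Scope ring_scope.

(* Points of R^d, with the product of the Borel sigma-algebras. *)
Notation Rd R d := (d.-tuple (measurableTypeR R)).

Section lebesgue_Rd.
Context {R : realType}.

Definition cons_pair d (x : measurableTypeR R * Rd R d) : Rd R d.+1 :=
  [the d.+1.-tuple (measurableTypeR R) of x.1 :: x.2].

Lemma measurable_cons_pair d : measurable_fun [set: _] (@cons_pair d).
Proof. exact: measurable_cons. Qed.

Definition uncons d (x : Rd R d.+1) : measurableTypeR R * Rd R d :=
  (thead x, [tuple of behead x]).

Lemma measurable_uncons d : measurable_fun [set: _] (@uncons d).
Proof.
apply/measurable_fun_pairP; split => /=.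
  exact: measurable_tnth.
exact: measurable_behead.
Qed.

Lemma cons_pairK d : cancel (@cons_pair d) (@uncons d).
Proof.
case=> x y; rewrite /uncons /cons_pair /=; congr pair.
exact/val_inj.
Qed.

Section step.
Variables (d : nat) (mu : {sigma_finite_measure set (Rd R d) -> \bar R}).

Definition lebesgue_cons : set (Rd R d.+1) -> \bar R :=
  pushforward (@lebesgue_measure R \x mu)%E (@cons_pair d).

Let lebesgue_cons0 : lebesgue_cons set0 = 0%E.
Proof. by rewrite /lebesgue_cons /pushforward preimage_set0 measure0. Qed.

Let lebesgue_cons_ge0 A : (0 <= lebesgue_cons A)%E.
Proof. by rewrite /lebesgue_cons /pushforward; exact: measure_ge0. Qed.

Let lebesgue_cons_sigma_additive : semi_sigma_additive lebesgue_cons.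
Proof.
exact: (measure_semi_sigma_additive (s := 
  measure_function_pushforward__canonical__measure_function_Measure
    (@lebesgue_measure R \x mu)%E (@measurable_cons_pair d))).
Qed.

HB.instance Definition _ := isMeasure.Build _ _ _ lebesgue_cons
  lebesgue_cons0 lebesgue_cons_ge0 lebesgue_cons_sigma_additive.

Let lebesgue_cons_sigma_finite : sigma_finite setT lebesgue_cons.
Proof.
have /sigma_finiteP[F [TF ndF Foo]] := sigma_finiteT (@lebesgue_measure R).
have /sigma_finiteP[G [TG ndG Goo]] := sigma_finiteT mu.
exists (fun n => @uncons d @^-1` (F n `*` G n)).
  rewrite predeqE => z; split=> // _.
  have [k _ Fk] : (\bigcup_n F n) (uncons z).1 by rewrite -TF.
  have [l _ Gl] : (\bigcup_n G n) (uncons z).2 by rewrite -TG.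
  exists (maxn k l) => //; split.
    by move: Fk; exact/subsetPset/ndF/leq_maxl.
  by move: Gl; exact/subsetPset/ndG/leq_maxr.
move=> n; have [mF Fn] := Foo n; have [mG Gn] := Goo n; split.
  rewrite -[X in measurable X]setTI.
  by apply: measurable_uncons => //; exact: measurableX.
rewrite /lebesgue_cons /pushforward -comp_preimage.
rewrite (_ : _ \o _ = id) ?preimage_id; last first.
  by apply/funext => x; exact: cons_pairK.
by rewrite product_measure1E// lte_mul_pinfty// ge0_fin_numE.
Qed.

HB.instance Definition _ := Measure_isSigmaFinite.Build _ _ _ lebesgue_cons
  lebesgue_cons_sigma_finite.

End step.

(* The iterated product of the one-dimensional Lebesgue measure; on the one-point
   space R^0 it is the Dirac mass. *)
Fixpoint lebesgue_Rd d : {sigma_finite_measure set (Rd R d) -> \bar R} :=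
  if d is d'.+1 then lebesgue_cons (lebesgue_Rd d')
  else \d_([tuple] : Rd R 0).

End lebesgue_Rd.

(* Functions on the torus T^d = R^d / Z^d are represented by the functions on
   R^d that are 1-periodic in each variable, integrated over [0, 1[^d. *)
Inductive domain := Euclidean | Torus.

Section spaces.
Context {R : realType} {d : nat}.
Implicit Types (X : domain) (f g : Rd R d -> R) (x h : Rd R d).

Definition translate x (c : R) h : Rd R d :=
  [tuple (tnth x i + c * tnth h i : R) | i < d].

Definition euclidean_norm h : R := Num.sqrt (\sum_(i < d) (tnth h i : R) ^+ 2).

Definition periodic_Zd f := forall (k : 'I_d -> int) x,
  f [tuple (tnth x i + (k i)%:~R : R) | i < d] = f x.

Definition fun_on X f : Prop := if X is Torus then periodic_Zd f else True.

Definition integration_domain X : set (Rd R d) :=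
  if X is Torus then [set x | forall i, 0 <= (tnth x i : R) < 1] else setT.

Definition Lp_norm X (p : R) f : \bar R :=
  'N[lebesgue_Rd d]_p%:E[(EFin \o f) \_ (integration_domain X)].

Definition Lp X (p : R) : set (Rd R d -> R) :=
  [set f | [/\ fun_on X f, measurable_fun setT f & (Lp_norm X p f < +oo)%E]].

Definition gen_binomial (alpha : R) (j : nat) : R :=
  (\prod_(i < j) (alpha - i%:R)) / (j`!)%:R.

(* The series converges absolutely at almost every x when f is in L_p, p >= 1;
   [limn] takes a default value at the remaining points. *)
Definition fdiff (alpha : R) h f x : R :=
  \big[+%R/0]_(0 <= j <oo)
    ((-1) ^+ j * gen_binomial alpha j * f (translate x (alpha - j%:R) h)).

Definition modulus X (alpha : R) f (t p : R) : \bar R :=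
  ereal_sup [set Lp_norm X p (fdiff alpha h f) |
             h in [set h | euclidean_norm h <= t]].

Definition Lip_weighted X (alpha b p : R) f (t : R) : \bar R :=
  ((t `^ (- alpha) * (1 - ln t) `^ (- b))%:E * modulus X alpha f t p)%E.

Definition Lip_norm X (alpha b p : R) (q : \bar R) f : \bar R :=
  (Lp_norm X p f +
   if q is r%:E then
     (\int[lebesgue_measure]_(t in `]0%R, 1%R[)
        (Lip_weighted X alpha b p f t `^ r * t^-1%:E)) `^ r^-1
   else ereal_sup [set Lip_weighted X alpha b p f t | t in `]0%R, 1%R[])%E.

Definition Lip X (alpha b p : R) (q : \bar R) : set (Rd R d -> R) :=
  [set f | Lp X p f /\ (Lip_norm X alpha b p q f < +oo)%E].

(* [A] and [B] are spaces of functions with the (quasi-)norms [NA] and [NB]. *)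
Definition continuously_embedded (A : set (Rd R d -> R))
    (NA : (Rd R d -> R) -> \bar R) (B : set (Rd R d -> R))
    (NB : (Rd R d -> R) -> \bar R) : Prop :=
  A `<=` B /\
  forall f, A f -> forall e : R, 0 < e -> exists2 delta : R, 0 < delta &
    forall g, A g -> (NA (g \- f)%R < delta%:E)%E -> (NB (g \- f)%R < e%:E)%E.

Definition Lip_embeds X (alpha b p : R) (q : \bar R) (r0 : R) : Prop :=
  continuously_embedded (Lip X alpha b p q) (Lip_norm X alpha b p q)
                        (Lp X r0) (Lp_norm X r0).

End spaces.

(* Main.v *)
Require Import Defs.
From HB Require Import structures.
From mathcomp Require Import all_boot all_order all_algebra.
From mathcomp Require Import all_classical all_reals all_analysis.
From mathcomp Require Import measurable_realfun.
From mathcomp Require Import ring lra.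
Set Implicit Arguments.
Unset Strict Implicit.
Unset Printing Implicit Defensive.
Import Order.TTheory GRing.Theory Num.Theory.
Import numFieldNormedType.Exports.
Local Open Scope classical_set_scope.
Local Open Scope ring_scope.

(** The exponent [r] is the Sobolev exponent of smoothness [alpha]: [d/r = d/p - alpha].

    Below it the embedding holds because smoothness bounds the size of the sets where [f] is
    large.  The fractional difference is [f] at one node plus a combination, with
    summable coefficients, of the values at the other nodes [y + j k], [j >= 1].  If
    [|f(y)| > 2 l], then either the difference or the combination is large.  Average over all
    steps [k] in a cube of side comparable to [t].  The map [k |-> y + j k] expands (on the
    torus it wraps around), so the mean of [|f|^s] at each of the other nodes is at most
    [t^-d] times its full integral, up to a constant; as soon as this is small against [l^s] the
    combination cannot account for the height [2 l], and the difference must.  This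
    gives the weak-type estimate [weak_type]: the measure of the set [|f| > 2 l] is at most a
    multiple of the [p]-th power of [omega(f, t)_p / l], where the scale [t] may be as small as
    [l^(-s/d)] when [f] is in [L_s].  The logarithmic Lipschitz condition implies
    [omega(f, t)_p <= C t^beta] for every [beta < alpha] ([Lip_modulus_bound]), so the measure
    decays faster than Chebyshev's [l^-p], and [f] is in [L_s'] for every
    [s' < p + s beta p / d] ([gains_step]).  Starting from [s = p] and iterating, the
    exponents approach [p / (1 - beta p / d)], which tends to [r] as [beta] tends to [alpha]
    ([gains_subcritical]).  On the torus the exponents [r0 < p] are covered by finiteness of
    the measure.

    The other embeddings fail on bumps of width [eps], whose [L_s] norms are comparable to
    [eps^(d/s)]. Their moduli are at most a multiple of [eps^(d/p) min(1, t/eps)^alpha]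
    ([bump_modulus]): with [delta] comparable to [t/eps], the coefficients beyond the index
    [1/delta] have sum at most [C delta^alpha], and below this index repeated summation by
    parts trades the order of the coefficients for differences of the bump, each worth a
    factor [delta]. Hence the Lipschitz norm is at most a multiple of
    [eps^(d/p) + eps^(d/p - alpha) G], where [G] is the norm, in the sense of the seminorm, of
    [(1 - log t)^-b min(1, eps/t)^alpha]. Because [b > 1/q], the norm of the weight
    [(1 - log t)^-b] over
    [(0, s)] tends to 0 with [s], and therefore [G] tends to 0 with [eps]. So for [r0 >= r]
    narrow bumps have arbitrarily small Lipschitz norm compared with their [L_r0] norm. For
    [r0 < p] on the Euclidean space wide bumps have the same property. Instead of smooth
    cutoffs the bumps are truncated polynomials [max(0, 1 - |x/eps|^2)^m], with
    [sin (pi x_l)] in place of [x_l] on the torus: all the regularity that is used can then be read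
    off finite differences of polynomials and sines. *)

(** * Integrals of possibly non-measurable functions *)

Section lower_integral.
Context d (T : measurableType d) (R : realType) (mu : {measure set T -> \bar R}).
Local Open Scope ereal_scope.
Implicit Types (f g : T -> \bar R) (D : set T).

(** The integral of a nonnegative function is a supremum over the simple functions below
    it, so monotonicity survives without measurability.  Fractional differences are
    limits with a default value at points of divergence, and this lemma spares
    every measurability question about them. *)
Lemma ge0_le_integral_nonmeasurable D f g :
  (forall x, D x -> 0 <= f x) -> (forall x, D x -> f x <= g x) ->
  \int[mu]_(x in D) f x <= \int[mu]_(x in D) g x.
Proof.
move=> f0 fg.
have g0 x : D x -> 0 <= g x by move=> Dx; exact: le_trans (f0 _ Dx) (fg _ Dx).
rewrite !ge0_integralE//; apply: ge_ereal_sup => _ [h hf <-].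
apply: ereal_sup_ubound; exists h => // x.
apply: le_trans (hf x) _; rewrite /patch; case: ifPn => // /[!inE] Dx.
exact: fg.
Qed.

End lower_integral.

(** * Affine changes of variable on the line and the circle *)

Section affine_line.
Context {R : realType}.
Local Open Scope ereal_scope.
Local Notation leb := (@lebesgue_measure R).
Implicit Types (g : measurableTypeR R -> \bar R) (a m s : R).

Definition affine a m (s : measurableTypeR R) : measurableTypeR R := (a + m * s)%R.

Lemma measurable_affine a m : measurable_fun setT (affine a m).
Proof. by apply: measurable_funD => //; exact: measurable_funM. Qed.

Lemma lebesgue_measure_affine a m (m0 : (0 < m)%R) (A : set (measurableTypeR R)) :
  measurable A ->
  leb A = m%:E * pushforward leb (affine a m) A.
Proof.
move=> mA.
pose nu : {measure set _ -> \bar R} :=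
  measure_function_pushforward__canonical__measure_function_Measure
    leb (@measurable_affine a m).
rewrite (lebesgue_measure_unique (mu := mscale (NngNum (ltW m0)) nu)) //.
move=> _ [[x y] _ <-] /=.
rewrite /mscale /= /pushforward /= (_ : _ @^-1` _ = `](x - a) / m, (y - a) / m]%classic)%R; last first.
  apply/seteqP; split => s /=; rewrite !in_itv/= /affine ltr_pdivrMr// ler_pdivlMr//.
    by move=> /andP[? ?]; apply/andP; split; lra.
  by move=> /andP[? ?]; apply/andP; split; lra.
rewrite !lebesgue_measure_itv /= !lte_fin ltr_pM2r ?invr_gt0// ltrD2r.
case: ifPn => [xy|]; last by rewrite mule0.
rewrite -EFinM; congr EFin; field; lra.
Qed.

Lemma ge0_integral_affine a m (m0 : (0 < m)%R) g : measurable_fun setT g ->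
  (forall s, 0 <= g s) ->
  \int[leb]_s g s = m%:E * \int[leb]_s g (affine a m s).
Proof.
move=> mg g0.
pose nu : {measure set _ -> \bar R} :=
  measure_function_pushforward__canonical__measure_function_Measure
    leb (@measurable_affine a m).
rewrite (eq_measure_integral (mscale (NngNum (ltW m0)) nu)); last first.
  by move=> A mA _; exact: lebesgue_measure_affine.
rewrite ge0_integral_mscale//= ge0_integral_pushforward//=; exact: measurable_affine.
Qed.

(** One factor of the product set [integration_domain X]. *)
Definition domain1 X : set (measurableTypeR R) := if X is Torus then `[0%R, 1%R[ else setT.

Lemma measurable_domain1 X : measurable (domain1 X).
Proof. by case: X => /=; [exact: measurableT|exact: measurable_itv]. Qed.

Definition periodic_on1 X g : Prop :=
  if X is Torus then forall (k : int) s, g (s + k%:~R)%R = g s else True.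

Lemma integral_translate_interval g a b c : measurable_fun setT g -> (forall s, 0 <= g s) ->
  \int[leb]_(s in `[(a + c)%R, (b + c)%R[) g s = \int[leb]_(s in `[a, b[) g (s + c)%R.
Proof.
move=> mg g0; rewrite [LHS]integral_mkcond (@ge0_integral_affine c 1)//; last 2 first.
- by apply/(measurable_restrictT _ _).1 => //; exact: measurable_funTS.
- by move=> s; exact: erestrict_ge0.
rewrite mul1e [RHS]integral_mkcond; apply: eq_integral => s _.
rewrite /patch /affine mul1r addrC; congr (if _ then _ else _).
by apply/idP/idP; rewrite !inE /= !in_itv/= lerD2r ltrD2r.
Qed.

(** Reducing [a] modulo 1 leaves an interval that straddles the integer 1; its part beyond 1
    is moved back by periodicity. *)
Lemma integral_period g a : measurable_fun setT g -> (forall s, 0 <= g s) ->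
  (forall (k : int) s, g (s + k%:~R)%R = g s) ->
  \int[leb]_(s in `[a, (a + 1)%R[) g s = \int[leb]_(s in `[0%R, 1%R[) g s.
Proof.
move=> mg g0 pg.
wlog /andP[a0 a1] : a / ((0 <= a) && (a < 1))%R.
  move=> H; pose c : R := (Num.floor a)%:~R%R.
  rewrite (_ : `[a, _[ = `[(a - c + c)%R, (a - c + 1 + c)%R[); last first.
    by rewrite subrK addrAC subrK.
  rewrite integral_translate_interval//.
  under eq_integral do rewrite pg.
  apply: H; have /andP[] := floor_itv a.
  by rewrite intrD1 => ? ?; apply/andP; split; lra.
have split_at (x y z : R) : (x <= y <= z)%R ->
    \int[leb]_(s in `[x, z[) g s =
    \int[leb]_(s in `[x, y[) g s + \int[leb]_(s in `[y, z[) g s.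
  move=> /andP[xy yz]; rewrite -ge0_integral_setU//=.
  - by congr (integral _ _ _); rewrite -itv_bndbnd_setU//= bnd_simp.
  - exact: measurable_funTS.
  - rewrite disj_set_sym; apply/disj_setPLR => s /=; rewrite !in_itv/= => /andP[ys _].
    by rewrite ltNge ys andbF.
rewrite (split_at a 1%R (a + 1)%R); last by apply/andP; split; lra.
rewrite (split_at 0%R a 1%R); last by apply/andP; split; lra.
rewrite -[X in `[X, (a + 1)%R[](add0r 1%R) integral_translate_interval// addeC.
by congr (_ + _); apply: eq_integral => s _; rewrite -[1%R]/(1%:~R)%R pg.
Qed.

Lemma integral_periods g a (m : nat) : measurable_fun setT g -> (forall s, 0 <= g s) ->
  (forall (k : int) s, g (s + k%:~R)%R = g s) ->
  \int[leb]_(s in `[a, (a + m%:R)%R[) g s = m%:R%:E * \int[leb]_(s in `[0%R, 1%R[) g s.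
Proof.
move=> mg g0 pg; elim: m => [|m IH].
  by rewrite addr0 set_itvco0 integral_set0 mul0e.
rewrite (_ : [set` `[a, _[] = `[a, (a + m%:R)%R[ `|` `[(a + m%:R)%R, (a + m%:R + 1)%R[); last first.
  by rewrite -natr1 addrA -itv_bndbnd_setU//= bnd_simp ?lerDl ?ler0n.
rewrite ge0_integral_setU//=.
- rewrite IH integral_period// -natr1 EFinD ge0_muleDl ?lee_fin ?ler0n//.
  by rewrite mul1e.
- exact: measurable_funTS.
- rewrite disj_set_sym; apply/disj_setPLR => s /=; rewrite !in_itv/= => /andP[ys _].
  by rewrite ltNge ys andbF.
Qed.

(** On the line the dilation by [m] contributes the factor [1/m <= 1]; on the circle
    it wraps the circle [m] times around itself and preserves the integral. *)
Lemma integral_dilation1 X g a (m : nat) : (0 < m)%N -> measurable_fun setT g ->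
  (forall s, 0 <= g s) -> periodic_on1 X g ->
  \int[leb]_(s in domain1 X) g (affine a m%:R s) <= \int[leb]_(s in domain1 X) g s.
Proof.
move=> m0 mg g0 pg; have mR0 : (0 < m%:R :> R)%R by rewrite ltr0n.
case: X pg => /= pg.
  rewrite (ge0_integral_affine a mR0 mg g0); apply: lee_pemull.
    by apply: integral_ge0.
  by rewrite lee_fin ler1n.
have := integral_periods a m mg g0 pg.
rewrite integral_mkcond (@ge0_integral_affine a m%:R)//; last 2 first.
- by apply/(measurable_restrictT _ _).1 => //; exact: measurable_funTS.
- by move=> s; exact: erestrict_ge0.
rewrite (_ : \int[leb]_s _ = \int[leb]_(s in `[0%R, 1%R[) g (affine a m%:R s)); last first.
  rewrite [RHS]integral_mkcond; apply: eq_integral => s _.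
  rewrite /patch; congr (if _ then _ else _).
  apply/idP/idP; rewrite !inE /= !in_itv/= /affine lerDl ltrD2l pmulr_rge0// gtr_pMr//.
move=> /eqP; rewrite eq_le => /andP[+ _]; rewrite lee_pmul2l?lte_fin//.
Qed.

End affine_line.

(** * Slicing and dilating integrals over R^d and the torus *)

Section integral_Rd.
Context {R : realType}.
Local Open Scope ereal_scope.
Local Notation leb := (@lebesgue_measure R).
Implicit Types (X : domain) (d m : nat).

Lemma tnth_cons_pair0 d (a : R) (y : Rd R d) : tnth (cons_pair (a, y)) ord0 = a.
Proof. by []. Qed.

Lemma tnth_cons_pairS d (a : R) (y : Rd R d) i :
  tnth (cons_pair (a, y)) (lift ord0 i) = tnth y i.
Proof. by rewrite /cons_pair (tnth_nth a)/= (tnth_nth a) /=. Qed.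

Lemma forall_cons_pair d (P : R -> Prop) (a : R) (y : Rd R d) :
  (forall i, P (tnth (cons_pair (a, y)) i)) <-> P a /\ forall i, P (tnth y i).
Proof.
split=> [H|[H0 HS] i]; first by split=> [|i]; [exact: (H ord0)|rewrite -(tnth_cons_pairS a)].
by case: (unliftP ord0 i) => [j ->|->//]; rewrite tnth_cons_pairS.
Qed.

(** The product of [d] copies of [B]: the torus, the whole space and small cubes are all of
    this form. *)
Definition box d (B : set (measurableTypeR R)) : set (Rd R d) :=
  [set x | forall i, B (tnth x i)].
Arguments box : clear implicits.

Lemma measurable_box d B : measurable B -> measurable (box d B).
Proof.
move=> mB; rewrite (_ : box d B = \big[setI/setT]_(i < d) ((@tnth _ _ ^~ i) @^-1` B)).
  apply: bigsetI_measurable => i _; rewrite -[X in measurable X]setTI.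
  exact: measurable_tnth.
by apply/seteqP; split=> x; rewrite -bigcap_seq_cond /= => Bx i; [move=> _; exact: Bx|apply: Bx; rewrite /= mem_index_enum].
Qed.

Lemma integration_domainE X d : integration_domain X = box d (domain1 X).
Proof.
by apply/seteqP; split=> x; case: X => //= H i; have := H i; rewrite in_itv/=.
Qed.

Lemma measurable_integration_domain X d :
  measurable (integration_domain X : set (Rd R d)).
Proof. by rewrite integration_domainE; apply: measurable_box; exact: measurable_domain1. Qed.

(** Tonelli along the first coordinate: the engine of the inductions on the dimension. *)
Lemma integral_box d B (g : Rd R d.+1 -> \bar R) : measurable B ->
  measurable_fun setT g -> (forall x, 0 <= g x) ->
  \int[lebesgue_Rd d.+1]_(x in box d.+1 B) g x =
  \int[leb]_(a in B) \int[lebesgue_Rd d]_(y in box d B) g (cons_pair (a, y)).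
Proof.
move=> mB mg g0; rewrite integral_mkcond.
have mg' : measurable_fun setT (g \_ (box d.+1 B)).
  by apply/(measurable_restrictT _ _).1; [exact: measurable_box|exact: measurable_funTS].
have g0' x : 0 <= (g \_ (box d.+1 B)) x by exact: erestrict_ge0.
pose nu : {measure set _ -> \bar R} :=
  measure_function_pushforward__canonical__measure_function_Measure
    (leb \x lebesgue_Rd d) (@measurable_cons_pair R d).
rewrite (eq_measure_integral nu)//.
rewrite ge0_integral_pushforward//=; last exact: measurable_cons_pair.
rewrite preimage_setT.
transitivity (\int[leb]_a fubini_F (lebesgue_Rd d) ((g \_ (box d.+1 B)) \o @cons_pair R d) a).
  apply: fubini_tonelli1 => [|z]; last exact: g0'.
  by apply: (measurableT_comp mg'); exact: measurable_cons_pair.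
rewrite [RHS]integral_mkcond; apply: eq_integral => a _.
rewrite /fubini_F /= [RHS]/patch; case: ifPn => [/[!inE] Ba|/negP/[!inE] nBa].
  rewrite [RHS]integral_mkcond; apply: eq_integral => y _ /=.
  rewrite /patch; congr (if _ then _ else _); apply/idP/idP; rewrite !inE /box/=.
    by case/forall_cons_pair.
  by move=> By; apply/forall_cons_pair.
apply: integral0_eq => y _ /=; rewrite /patch; case: ifPn => // /[!inE].
by case/forall_cons_pair.
Qed.

Lemma measurable_section d B (g : Rd R d.+1 -> \bar R) : measurable B ->
  measurable_fun setT g -> (forall x, 0 <= g x) ->
  measurable_fun setT
    (fun a : measurableTypeR R => \int[lebesgue_Rd d]_(y in box d B) g (cons_pair (a, y))).
Proof.
move=> mB mg g0.
pose h (z : measurableTypeR R * Rd R d) := (g \o @cons_pair R d) z * (\1_(box d B) z.2)%:E.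
rewrite (_ : (fun a => _) = fubini_F (lebesgue_Rd d) h); last first.
  apply/funext => a; rewrite /fubini_F [LHS]integral_mkcond; apply: eq_integral => y _ /=.
  by rewrite /h /= /patch indicE; case: (y \in _); rewrite ?mule1 ?mule0.
apply: measurable_fun_fubini_tonelli_F => [|z].
  apply: emeasurable_funM; first by apply: measurableT_comp => //; exact: measurable_cons_pair.
  apply/measurable_EFinP; apply: measurableT_comp => //.
  by apply: measurable_indic; exact: measurable_box.
by apply: mule_ge0; [exact: g0|rewrite lee_fin indicE ler0n].
Qed.

(** [fun_on] for functions with values in any type, so that it also applies to
    extended-real integrands and to indicators. *)
Definition periodic_on X d T (g : Rd R d -> T) : Prop :=
  if X is Torus then
    forall (k : 'I_d -> int) x, g [tuple (tnth x i + (k i)%:~R : R)%R | i < d] = g x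
  else True.

Lemma measurable_translate d (a : Rd R d) c :
  measurable_fun setT (fun h => translate a c h).
Proof.
apply/measurable_fun_tnthP => i; rewrite /translate.
rewrite (_ : _ \o _ = (fun h : Rd R d => tnth a i + c * tnth h i)%R); last first.
  by apply/funext => h /=; rewrite tnth_mktuple.
apply: measurable_funD => //; apply: measurable_funM => //.
exact: measurable_tnth.
Qed.

Lemma translate_cons d (a : Rd R d.+1) c (h : R) (y : Rd R d) :
  translate a c (cons_pair (h, y)) =
  cons_pair (affine (thead a) c h, translate [tuple of behead a] c y).
Proof.
apply: eq_from_tnth => i; rewrite tnth_mktuple.
case: (unliftP ord0 i) => [j ->|->//]; rewrite !tnth_cons_pairS tnth_mktuple.
by congr (_ + _)%R; rewrite [in LHS](tuple_eta a) tnthS.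
Qed.

(** For each node [j >= 1] the values [f (a + j h)] are averaged over the step [h]; that
    this costs no constant, uniformly in [j] and [a], is what makes the tail of the
    fractional difference summable. *)
Lemma integral_dilation X d (a : Rd R d) m (g : Rd R d -> \bar R) : (0 < m)%N ->
  measurable_fun setT g -> (forall x, 0 <= g x) -> periodic_on X g ->
  \int[lebesgue_Rd d]_(h in integration_domain X) g (translate a m%:R h) <=
  \int[lebesgue_Rd d]_(h in integration_domain X) g h.
Proof.
move=> m0; rewrite integration_domainE; elim: d a g => [|d IH] a g mg g0 pg.
  rewrite (eq_integral g)// => h _.
  by congr g; rewrite [LHS]tuple0 [RHS]tuple0.
have mD := measurable_domain1 (R := R) X.
rewrite !integral_box//; last first.
  by apply: measurableT_comp => //; exact: measurable_translate.
pose G s := \int[lebesgue_Rd d]_(y in box d (domain1 X)) g (cons_pair (s, y)).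
have G0 s : 0 <= G s by exact: integral_ge0.
have mG : measurable_fun setT G by exact: measurable_section.
apply: (@le_trans _ _ (\int[leb]_(s in domain1 X) G (affine (thead a) m%:R s))).
  apply: ge0_le_integral_nonmeasurable => s _; first exact: integral_ge0.
  under eq_integral do rewrite translate_cons.
  apply: (IH _ (fun y => g (cons_pair (_, y)))) => //.
    apply: measurableT_comp => //.
    by apply: measurable_cons; [exact: measurable_cst|exact: measurable_id].
  case: (X) pg => //= pg k y.
  rewrite -[RHS](pg (fun i => if unlift ord0 i is Some j then k j else 0%R)).
  congr g; apply: eq_from_tnth => i; rewrite tnth_mktuple.
  case: (unliftP ord0 i) => [j ->|->].
    by rewrite !tnth_cons_pairS tnth_mktuple.
  by rewrite !tnth_cons_pair0 addr0.
apply: integral_dilation1 => //.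
rewrite /G; case: (X) pg => //= pg k s; apply: eq_integral => y _.
rewrite -[RHS](pg (fun i => if unlift ord0 i is Some j then 0%R else k)).
congr g; apply: eq_from_tnth => i; rewrite tnth_mktuple.
case: (unliftP ord0 i) => [j ->|->].
  by rewrite !tnth_cons_pairS addr0.
by rewrite !tnth_cons_pair0.
Qed.

End integral_Rd.

Arguments box {R} d B.

(** * Coefficients of the fractional difference *)

Section binomial_coefficients.
Context {R : realType}.
Implicit Types (g a : R) (j N M k : nat).

Definition diff_coef a j : R := (-1) ^+ j * gen_binomial a j.

Lemma diff_coef0 a : diff_coef a 0 = 1.
Proof. by rewrite /diff_coef /gen_binomial expr0 big_ord0 fact0 divr1 mulr1. Qed.

Lemma diff_coefS a j :
  diff_coef a j.+1 = diff_coef a j * ((j%:R - a) / j.+1%:R).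
Proof.
rewrite /diff_coef /gen_binomial big_ord_recr/= factS natrM exprS.
have j0 : (j`!)%:R != 0 :> R by rewrite pnatr_eq0 -lt0n fact_gt0.
have j1 : j.+1%:R != 0 :> R by rewrite pnatr_eq0.
by move: (j.+1%:R) (j`!%:R) j0 j1 => y x x0 y0; field; rewrite x0 y0.
Qed.

Lemma diff_coefS_pred a j :
  diff_coef a j.+1 = diff_coef (a - 1) j * (- a / j.+1%:R).
Proof.
elim: j => [|j IH]; first by rewrite diff_coefS !diff_coef0 sub0r.
rewrite diff_coefS IH [diff_coef (a - 1) j.+1]diff_coefS -!mulrA; congr (_ * _).
have j1 : j.+1%:R != 0 :> R by rewrite pnatr_eq0.
have j2 : j.+2%:R != 0 :> R by rewrite pnatr_eq0.
rewrite [RHS]mulrA [RHS]mulrAC [LHS]mulrA [LHS]mulrAC; congr (_ / _).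
by rewrite -[j.+1%:R]natr1; ring.
Qed.

(** Coefficients of order [a] are the first differences of those of order [a - 1]: the
    generating function is [(1 - z)^a = (1 - z) (1 - z)^(a-1)]. *)
Lemma diff_coef_pascal a j :
  diff_coef a j.+1 = diff_coef (a - 1) j.+1 - diff_coef (a - 1) j.
Proof.
rewrite diff_coefS_pred diff_coefS -{3}[diff_coef (a - 1) j]mulr1 -mulrBr.
congr (_ * _); have j1 : j.+1%:R != 0 :> R by rewrite pnatr_eq0.
by rewrite -[j.+1%:R]natr1 in j1 *; field.
Qed.

Lemma sum_diff_coef a N :
  \sum_(0 <= j < N.+1) diff_coef a j = diff_coef (a - 1) N.
Proof.
elim: N => [|N IH]; first by rewrite big_nat1 !diff_coef0.
by rewrite big_nat_recr//= IH diff_coef_pascal addrC subrK.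
Qed.

(** Summation by parts: one unit of the order is traded for one difference of [u]. *)
Lemma diff_coef_abel a N (u : nat -> R) :
  \sum_(0 <= j < N.+1) diff_coef a j * u j =
  diff_coef (a - 1) N * u N.+1 -
  \sum_(0 <= j < N.+1) diff_coef (a - 1) j * (u j.+1 - u j).
Proof.
elim: N => [|N IH]; first by rewrite !big_nat1 !diff_coef0; ring.
rewrite big_nat_recr//= IH [in RHS]big_nat_recr//= diff_coef_pascal; ring.
Qed.

(** The quotient of consecutive coefficients is [1 - (a+1)/(j+1)], to be compared with
    the quotient of consecutive powers [(j+1)^-(a+1)] through [1 + x <= exp x]. *)
Lemma diff_coef_factor_le a j : `|a + 1| <= j.+1%:R ->
  `|diff_coef a j.+1| <= `|diff_coef a j| * expR (- (a + 1) / j.+1%:R).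
Proof.
have j0 : 0 < j.+1%:R :> R by rewrite ltr0n.
rewrite ler_norml => /andP[a1 a2]; rewrite diff_coefS normrM ler_wpM2l//.
have -> : (j%:R - a) / j.+1%:R = 1 + - (a + 1) / j.+1%:R.
  by rewrite -natr1 in j0 *; field; lra.
rewrite ger0_norm ?expR_ge1Dx//.
by rewrite mulNr subr_ge0 ler_pdivrMr// mul1r.
Qed.

Lemma power_step_ge0 g j : 0 <= g ->
  expR (- g / j.+1%:R) * j.+1%:R `^ (- g) <= j.+2%:R `^ (- g).
Proof.
move=> g0; rewrite /powR !pnatr_eq0 /= -expRD ler_expR.
have -> : - g / j.+1%:R + - g * ln j.+1%:R = - g * (j.+1%:R^-1 + ln j.+1%:R) by ring.
rewrite ler_wnM2l ?oppr_le0//.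
rewrite -lerBlDr -ln_div ?posrE ?ltr0n//.
have j0 : 0 < j.+1%:R :> R by rewrite ltr0n.
have -> : j.+2%:R / j.+1%:R = 1 + j.+1%:R^-1 :> R.
  by rewrite -[j.+2%:R]natr1 mulrDl divff ?gt_eqF// mul1r.
by apply: le_ln1Dx; rewrite (@lt_trans _ _ 0)// ?invr_gt0.
Qed.

Lemma power_step_le0 g j : g <= 0 -> (0 < j)%N ->
  expR (- g / j.+1%:R) * j%:R `^ (- g) <= j.+1%:R `^ (- g).
Proof.
move=> g0 jp; rewrite /powR !pnatr_eq0 (gtn_eqF jp) /= -expRD ler_expR.
have -> : - g / j.+1%:R + - g * ln j%:R = - g * (j.+1%:R^-1 + ln j%:R) by ring.
rewrite ler_wpM2l ?oppr_ge0// -lerBrDr -[X in _ <= X]opprB -ln_div ?posrE ?ltr0n//.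
have j0 : 0 < j.+1%:R :> R by rewrite ltr0n.
rewrite lerNr; have -> : j%:R / j.+1%:R = 1 + - j.+1%:R^-1 :> R.
  by rewrite -natr1 in j0 *; field; lra.
by apply: le_ln1Dx; rewrite ltrN2 invf_lt1// ltr1n; case: (j) jp.
Qed.

(** The first [i0] terms fix the constant, the hypothesis on steps propagates it. *)
Lemma eventually_bounded (v w : nat -> R) i0 : (forall j, 0 < w j) ->
  (forall (c : R) j, 0 < c -> (i0 <= j)%N -> `|v j| <= c * w j -> `|v j.+1| <= c * w j.+1) ->
  exists2 C : R, 0 < C & forall j, `|v j| <= C * w j.
Proof.
move=> w0 step.
pose C := 1 + \sum_(0 <= j < i0.+1) `|v j| / w j.
have C0 : 0 < C by rewrite ltr_pwDl// sumr_ge0// => j _; rewrite divr_ge0// ltW.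
have base j : (j <= i0)%N -> `|v j| <= C * w j.
  move=> ji; rewrite -ler_pdivrMr// /C (@le_trans _ _ (\sum_(0 <= j < i0.+1) `|v j| / w j))//.
    rewrite big_mkord (bigD1 (Ordinal (ji : (j < i0.+1)%N)))//= lerDl sumr_ge0// => i _.
    by rewrite divr_ge0// ltW.
  by rewrite lerDr.
exists C => // j; have [/base//|] := leqP j i0.
elim: j => // j IH; rewrite ltnS leq_eqVlt => /predU1P[<-|ij].
  by apply: step => //; exact: base.
by apply: step => //; [exact: ltnW|exact: IH].
Qed.

Lemma diff_coef_bound a : exists2 C : R, 0 < C &
  forall j, `|diff_coef a j| <= C * j.+1%:R `^ (- (a + 1)).
Proof.
pose i0 := (Num.truncn `|a + 1|).+1.
have i0j j : (i0 <= j)%N -> `|a + 1| <= j.+1%:R.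
  move=> ij; apply/ltW/(lt_le_trans (truncnS_gt _)).
  by rewrite ler_nat; exact: leq_trans ij (leqnSn _).
have [a0|a0] := leP 0 (a + 1).
  apply: (@eventually_bounded _ (fun j => j.+1%:R `^ (- (a + 1))) i0) => //.
  move=> c j c0 ij /= vj; apply: le_trans (diff_coef_factor_le (i0j _ ij)) _.
    apply: (@le_trans _ _ (c * (expR (- (a + 1) / j.+1%:R) * j.+1%:R `^ (- (a + 1))))).
      by rewrite mulrC [X in _ <= X]mulrCA ler_wpM2l// expR_ge0.
    by apply: ler_wpM2l; [exact: ltW|exact: power_step_ge0].
(* For a negative exponent the powers of [j], not of [j + 1], dominate step by step; the
   value at [j = 0] is replaced by 1. *)
pose w j : R := (maxn j 1)%:R `^ (- (a + 1)).
have [||C C0 HC] := @eventually_bounded (diff_coef a) w i0.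
- by move=> j; rewrite powR_gt0// ltr0n leq_max orbT.
- move=> c j c0 ij vj; apply: le_trans (diff_coef_factor_le (i0j _ ij)) _.
  have j0 : (0 < j)%N by exact: leq_trans ij.
  rewrite /w (maxn_idPl _)//.
  apply: (@le_trans _ _ (c * (expR (- (a + 1) / j.+1%:R) * j%:R `^ (- (a + 1))))).
    rewrite mulrC [X in _ <= X]mulrCA ler_wpM2l ?expR_ge0//.
    by rewrite /w (maxn_idPl _)// in vj.
  by apply: ler_wpM2l; [exact: ltW|apply: power_step_le0 => //; exact: ltW].
exists C => // j; apply: le_trans (HC j) _; rewrite ler_wpM2l ?(ltW C0)// /w.
apply: ge0_ler_powR; rewrite ?nnegrE ?ler0n//; first by rewrite oppr_ge0 ltW.
by rewrite ler_nat geq_max leqnSn.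
Qed.

Lemma diff_coef_ge0 a j : a <= 0 -> 0 <= diff_coef a j.
Proof.
move=> a0; elim: j => [|j IH]; first by rewrite diff_coef0.
by rewrite diff_coefS mulr_ge0// divr_ge0// subr_ge0 (le_trans a0).
Qed.

(** Beyond the index [a] all coefficients have the same sign, so that absolute values can be
    summed by the closed formula for partial sums. *)
Lemma diff_coef_sign a i0 (n : nat) : a <= i0%:R ->
  `|\sum_(i0 <= j < n) diff_coef a j| = \sum_(i0 <= j < n) `|diff_coef a j|.
Proof.
move=> ai; pose sg := diff_coef a i0.
have same j : (i0 <= j)%N -> 0 <= sg * diff_coef a j.
  elim: j => [|j IH]; first by rewrite leqn0 => /eqP i00; rewrite /sg i00 -expr2 sqr_ge0.
  rewrite leq_eqVlt => /predU1P[<-|ij]; first by rewrite /sg -expr2 sqr_ge0.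
  rewrite diff_coefS mulrA mulr_ge0 ?IH// divr_ge0// subr_ge0.
  by rewrite (le_trans ai)// ler_nat.
have zero j : sg = 0 -> (i0 <= j)%N -> diff_coef a j = 0.
  move=> sg0; elim: j => [|j IH]; first by rewrite leqn0 => /eqP i00; rewrite -i00.
  rewrite leq_eqVlt => /predU1P[<-//|ij].
  by rewrite diff_coefS IH ?mul0r.
have [sg0|sg0] := eqVneq sg 0.
  by rewrite !big_nat !big1 ?normr0// => j /andP[ij _]; rewrite zero// normr0.
apply: (mulfI (_ : `|sg| != 0)); first by rewrite normr_eq0.
rewrite -normrM !mulr_sumr ger0_norm; last first.
  by rewrite big_nat_cond sumr_ge0// => j /andP[/andP[ij _] _]; exact: same.
apply: eq_big_nat => j /andP[ij _].
by rewrite -normrM ger0_norm// same.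
Qed.

(** A tail of constant sign telescopes to a difference of two coefficients of order [a - 1],
    which decay like [j^-a]; the finitely many indices before the sign settles only
    change the constant. *)
Lemma sum_abs_diff_coef_tail a : 0 < a -> exists2 C : R, 0 < C &
  forall N n, \sum_(N.+1 <= j < n) `|diff_coef a j| <= C * N.+1%:R `^ (- a).
Proof.
move=> a0; have [C C0 HC] := diff_coef_bound (a - 1).
have {}HC j : `|diff_coef (a - 1) j| <= C * j.+1%:R `^ (- a).
  by have := HC j; rewrite subrK.
pose i0 := (Num.truncn a).+1.
have large N n : (i0 <= N)%N ->
    \sum_(N.+1 <= j < n) `|diff_coef a j| <= (2 * C) * N.+1%:R `^ (- a).
  move=> iN; have [nN|Nn] := leqP n N.+1.
    by rewrite big_geq// mulr_ge0 ?powR_ge0// mulr_ge0// ltW.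
  rewrite -diff_coef_sign; last first.
    by apply/ltW/(lt_le_trans (truncnS_gt _)); rewrite ler_nat; exact: leq_trans iN (leqnSn _).
  case: n Nn => // n Nn.
  have -> : \sum_(N.+1 <= j < n.+1) diff_coef a j =
      diff_coef (a - 1) n - diff_coef (a - 1) N.
    rewrite -!sum_diff_coef [X in _ = X - _](big_cat_nat (n := N.+1))//=; last exact: ltnW.
    by rewrite addrAC subrr add0r.
  apply: le_trans (ler_normB _ _) _; rewrite -mulrA mulr_natl mulr2n lerD//.
  apply: le_trans (HC n) _; rewrite ler_wpM2l ?(ltW C0)// !powRN lef_pV2 ?posrE ?powR_gt0 ?ltr0n//.
  by apply: ge0_ler_powR; rewrite ?nnegrE ?ler0n ?(ltW a0)// ler_nat ltnW.
have sub_sum (F : nat -> R) m n p : (forall j, 0 <= F j) -> (m <= n)%N -> (n <= p)%N ->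
    \sum_(n <= j < p) F j <= \sum_(m <= j < p) F j.
  by move=> F0 mn np; rewrite [leRHS](big_cat_nat mn np)/= lerDr sumr_ge0.
pose D := \sum_(1 <= j < i0.+1) `|diff_coef a j| + 2 * C.
have D0 : 0 <= D by rewrite addr_ge0 ?sumr_ge0// mulr_ge0// ltW.
have all n : (i0 < n)%N -> \sum_(1 <= j < n) `|diff_coef a j| <= D.
  move=> ni; rewrite (big_cat_nat (n := i0.+1))//= lerD2l.
  apply: le_trans (large _ _ (leqnn _)) _.
  rewrite ler_piMr ?mulr_ge0 ?(ltW C0)//.
  by rewrite -[leRHS](powRr0 i0.+1%:R) ler_powR ?ler1n// oppr_le0 ltW.
exists (2 * C + D * i0%:R `^ a).
  by rewrite ltr_pwDl ?mulr_gt0// mulr_ge0// powR_ge0.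
move=> N n; have [iN|Ni] := leqP i0 N.
  apply: le_trans (large _ _ iN) _; rewrite ler_wpM2r ?powR_ge0//.
  by rewrite lerDl mulr_ge0// powR_ge0.
pose n' := maxn n i0.+1.
apply: (@le_trans _ _ (\sum_(N.+1 <= j < n') `|diff_coef a j|)).
  have [nN|/ltnW Nn] := leqP n N.+1; first by rewrite big_geq ?sumr_ge0.
  by rewrite [leRHS](big_cat_nat Nn)/= ?lerDl ?sumr_ge0// leq_maxl.
apply: le_trans (sub_sum _ 1%N _ _ _ _ _) _ => //.
  by rewrite (leq_trans _ (leq_maxr _ _))// ltnS ltnW.
apply: le_trans (all _ _) _; first by rewrite /n' leq_max ltnSn orbT.
rewrite powRN mulrDl -mulrA -[X in X <= _]add0r lerD// ?mulr_ge0 ?invr_ge0 ?powR_ge0 ?(ltW C0)//.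
rewrite -mulrA ler_peMr// ler_pdivlMr ?powR_gt0 ?ltr0n// mul1r.
by apply: ge0_ler_powR; rewrite ?nnegrE ?ler0n ?(ltW a0)// ler_nat.
Qed.

Lemma sum_abs_diff_coef a : 0 < a -> exists2 C : R, 0 < C &
  forall n, \sum_(0 <= j < n) `|diff_coef a j| <= C.
Proof.
move=> a0; have [C C0 HC] := sum_abs_diff_coef_tail a0.
exists (1 + C); first by rewrite addr_gt0.
case=> [|n]; first by rewrite big_geq// addr_ge0// ltW.
rewrite big_nat_recl//= diff_coef0 normr1 lerD2l.
have := HC 0%N n.+1; rewrite powR1 mulr1; apply: le_trans.
by rewrite big_add1.
Qed.

End binomial_coefficients.

(** * Translation invariance and L_p norms *)

Section lebesgue_spaces.
Context {R : realType}.
Local Open Scope ereal_scope.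
Local Notation leb := (@lebesgue_measure R).
Implicit Types (X : domain) (d m : nat).

Lemma exchange_integral (d1 d2 : measure_display) (T1 : measurableType d1) (T2 : measurableType d2)
    (m1 : {sigma_finite_measure set T1 -> \bar R})
    (m2 : {sigma_finite_measure set T2 -> \bar R}) (A : set T1) (B : set T2)
    (F : T1 * T2 -> \bar R) : measurable A -> measurable B ->
  measurable_fun setT F -> (forall z, 0 <= F z) ->
  \int[m1]_(x in A) \int[m2]_(y in B) F (x, y) =
  \int[m2]_(y in B) \int[m1]_(x in A) F (x, y).
Proof.
move=> mA mB mF F0; pose H := F \_ (A `*` B).
have mH : measurable_fun setT H.
  by apply/(measurable_restrictT _ _).1; [exact: measurableX|exact: measurable_funTS].
have H0 z : 0 <= H z by exact: erestrict_ge0.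
have HE x y : H (x, y) = if (x \in A) && (y \in B) then F (x, y) else 0.
  by rewrite /H /patch in_setX.
transitivity (\int[m1]_x \int[m2]_y H (x, y)).
  rewrite integral_mkcond; apply: eq_integral => x _; rewrite /patch.
  under [RHS]eq_integral do rewrite HE.
  by case: (x \in A) => /=; [rewrite integral_mkcond|rewrite integral0].
transitivity (\int[m2]_y \int[m1]_x H (x, y)).
  exact: (fubini_tonelli H mH H0).
rewrite [RHS]integral_mkcond; apply: eq_integral => y _; rewrite [RHS]/patch.
under eq_integral do rewrite HE andbC.
by case: (y \in B) => /=; [rewrite [RHS]integral_mkcond|rewrite integral0].
Qed.

Lemma lebesgue_Rd_box d (B : set (measurableTypeR R)) : measurable B ->
  lebesgue_Rd d (box d B) = leb B ^+ d.
Proof.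
move=> mB; rewrite -[LHS]mul1e -integral_cst; last exact: measurable_box.
elim: d => [|d IH].
  rewrite (_ : box 0 B = setT); last by apply/seteqP; split => // x _ [].
  by rewrite integral_dirac// diracT mule1.
rewrite (integral_box mB)//; under eq_integral do rewrite IH.
by rewrite integral_cst// muleC -expeS.
Qed.

(** Only [g] may fail to be measurable: [max (f - h) 0] is a measurable function below it. *)
Lemma le_integralD_nonmeasurable (d : measure_display) (T : measurableType d)
    (mu : {measure set T -> \bar R}) (D : set T) (f g h : T -> \bar R) :
  measurable D -> measurable_fun D f -> measurable_fun D h ->
  (forall x, D x -> 0 <= f x) -> (forall x, D x -> 0 <= h x) ->
  (forall x, D x -> f x \is a fin_num) ->
  (forall x, D x -> 0 <= g x) ->
  (forall x, D x -> f x <= g x + h x) ->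
  \int[mu]_(x in D) f x <= \int[mu]_(x in D) g x + \int[mu]_(x in D) h x.
Proof.
move=> mD mf mh f0 h0 ffin g0 fgh.
pose k x := maxe (f x - h x) 0.
have mk : measurable_fun D k.
  by apply: measurable_maxe => //; exact: emeasurable_funB.
have k0 x : D x -> 0 <= k x by move=> _; rewrite le_max lexx orbT.
apply: (@le_trans _ _ (\int[mu]_(x in D) (k x + h x))).
  apply: ge0_le_integral_nonmeasurable => // x Dx.
  have [hy|hy] := eqVneq (h x) +oo; first by rewrite hy addey ?leey// gt_eqF// (lt_le_trans _ (k0 _ Dx)).
  have hf : h x \is a fin_num by rewrite ge0_fin_numE ?h0// ltey.
  by rewrite -leeBlDr// /k le_max lexx.
rewrite ge0_integralD//; apply: leeD => //.
apply: ge0_le_integral_nonmeasurable => // x Dx.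
rewrite /k ge_max g0// andbT.
have [hy|hy] := eqVneq (h x) +oo; first by rewrite hy addeNy leNye.
have hf : h x \is a fin_num by rewrite ge0_fin_numE ?h0// ltey.
by rewrite leeBlDr// fgh.
Qed.

Definition origin d : Rd R d := [tuple 0%R | i < d].

Lemma measurable_translate2 d c :
  measurable_fun setT (fun z : Rd R d * Rd R d => translate z.1 c z.2).
Proof.
apply/measurable_fun_tnthP => i; rewrite /translate.
rewrite (_ : _ \o _ = (fun z : Rd R d * Rd R d => tnth z.1 i + c * tnth z.2 i)%R); last first.
  by apply/funext => h /=; rewrite tnth_mktuple.
apply: measurable_funD.
  by apply: (measurableT_comp (measurable_tnth i)); exact: measurable_fst.
apply: measurable_funM => //.
by apply: (measurableT_comp (measurable_tnth i)); exact: measurable_snd.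
Qed.

Lemma measurable_translate1 d c (h : Rd R d) :
  measurable_fun setT (fun x => translate x c h).
Proof.
apply/measurable_fun_tnthP => i; rewrite /translate.
rewrite (_ : _ \o _ = (fun x : Rd R d => tnth x i + c * tnth h i)%R); last first.
  by apply/funext => x /=; rewrite tnth_mktuple.
by apply: measurable_funD => //; exact: measurable_tnth.
Qed.

Lemma translateA d (x h : Rd R d) c c' :
  translate (translate x c h) c' h = translate x (c + c')%R h.
Proof. by apply: eq_from_tnth => i; rewrite !tnth_mktuple mulrDl addrA. Qed.

Lemma translate0 d (x h : Rd R d) : translate x 0%R h = x.
Proof. by apply: eq_from_tnth => i; rewrite tnth_mktuple mul0r addr0. Qed.

Lemma periodic_on_translate X d T (g : Rd R d -> T) c h :
  periodic_on X g -> periodic_on X (fun x => g (translate x c h)).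
Proof.
case: X => //= pg k x; rewrite -[RHS](pg k); congr g.
by apply: eq_from_tnth => i; rewrite !tnth_mktuple addrAC.
Qed.

Lemma periodic_on_comp X d T U (f : T -> U) (g : Rd R d -> T) :
  periodic_on X g -> periodic_on X (f \o g).
Proof. by case: X => //= pg k x; rewrite pg. Qed.

(** One inequality is the dilation lemma with [m = 1]; applied to the opposite
    translation it gives the other. *)
Lemma integral_translate X d c (h : Rd R d) (g : Rd R d -> \bar R) :
  measurable_fun setT g -> (forall x, 0 <= g x) -> periodic_on X g ->
  \int[lebesgue_Rd d]_(x in integration_domain X) g (translate x c h) =
  \int[lebesgue_Rd d]_(x in integration_domain X) g x.
Proof.
have ineq c' (f : Rd R d -> \bar R) : measurable_fun setT f -> (forall x, 0 <= f x) ->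
    periodic_on X f ->
    \int[lebesgue_Rd d]_(x in integration_domain X) f (translate x c' h) <=
    \int[lebesgue_Rd d]_(x in integration_domain X) f x.
  move=> mf f0 pf.
  have := @integral_dilation R X d (translate (origin d) c' h) 1 f isT mf f0 pf.
  apply: le_trans; rewrite le_eqVlt; apply/orP; left; apply/eqP.
  apply: eq_integral => x _; congr f; apply: eq_from_tnth => i.
  by rewrite !tnth_mktuple add0r mul1r addrC.
move=> mg g0 pg; apply/eqP; rewrite eq_le ineq//=.
have := ineq (- c)%R (fun x => g (translate x c h)).
under eq_integral do rewrite translateA addNr translate0.
apply => //; last exact: periodic_on_translate.
by apply: measurableT_comp => //; exact: measurable_translate1.
Qed.

Lemma fun_on_periodic X d (f : Rd R d -> R) : fun_on X f = periodic_on X f.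
Proof. by case: X. Qed.

(** The [p]-th power of the [L_p] norm; estimates of level sets are additive in it. *)
Definition power_integral X d (p : R) (f : Rd R d -> R) : \bar R :=
  \int[lebesgue_Rd d]_(x in integration_domain X) (`|f x| `^ p)%:E.

Lemma power_integral_ge0 X d p (f : Rd R d -> R) : 0 <= power_integral X p f.
Proof. by apply: integral_ge0 => x _; rewrite lee_fin powR_ge0. Qed.

Lemma Lp_normE X d p (f : Rd R d -> R) : p != 0%R ->
  Lp_norm X p f = power_integral X p f `^ p^-1.
Proof.
move=> p0; rewrite /Lp_norm unlock /power_integral [in RHS]integral_mkcond.
congr (_ `^ _); apply: eq_integral => x _; rewrite /patch; case: ifPn => _ /=.
  by [].
by rewrite normr0 powR0.
Qed.

Lemma Lp_norm_leP X d p (f : Rd R d -> R) (K : R) : (0 < p)%R -> (0 <= K)%R ->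
  (Lp_norm X p f <= K%:E) = (power_integral X p f <= (K `^ p)%:E).
Proof.
move=> p0 K0; have pn0 : p != 0%R by rewrite gt_eqF.
rewrite Lp_normE//; apply/idP/idP => H.
  rewrite -[X in X <= _]poweRe1 ?power_integral_ge0// -(mulVf pn0) poweRrM -poweR_EFin.
  by apply: gt0_ler_poweR; rewrite ?(ltW p0)// in_itv/= ?leey ?andbT ?poweR_ge0 ?lee_fin.
have -> : K%:E = (K `^ p)%:E `^ p^-1 by rewrite poweR_EFin -powRrM divff// powRr1.
apply: gt0_ler_poweR => //; first by rewrite invr_ge0 ltW.
  by rewrite in_itv/= leey andbT power_integral_ge0.
by rewrite in_itv/= leey andbT lee_fin powR_ge0.
Qed.

Lemma measurable_power d p (f : Rd R d -> R) : measurable_fun setT f ->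
  measurable_fun setT (fun x => (`|f x| `^ p)%:E).
Proof.
move=> mf; apply/measurable_EFinP.
by apply: (measurableT_comp (measurable_powR p)); exact: measurableT_comp.
Qed.

End lebesgue_spaces.

(** * A lower bound for the fractional difference on level sets *)

Section level_sets.
Context {R : realType}.
Local Open Scope ereal_scope.
Implicit Types (X : domain) (d : nat).

(** Splits a large value into a constant, to be absorbed, and a multiple of its
    [p]-th power, to be integrated. *)
Lemma le_add_powR (a c p : R) : (0 <= a)%R -> (0 < c)%R -> (1 <= p)%R ->
  (a <= c + c `^ (1 - p) * a `^ p)%R.
Proof.
move=> a0 c0 p1; have [ac|ca] := leP a c.
  by rewrite (le_trans ac)// lerDl mulr_ge0// powR_ge0.
have a0' : (0 < a)%R by exact: lt_trans ca.
apply: (@le_trans _ _ (c `^ (1 - p) * a `^ p)%R); last by rewrite lerDr ltW.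
have -> : (1 - p = - (p - 1))%R by ring.
rewrite powRN mulrC ler_pdivlMr ?powR_gt0//.
rewrite -(mulr_powRB1 a0 (lt_le_trans ltr01 p1)) ler_wpM2l// ge0_ler_powR ?nnegrE ?subr_ge0 ?(ltW c0)//.
exact: ltW.
Qed.

(** The first term is controlled by the sum of the series and by the other terms. *)
Lemma series_head_le (a : nat -> R) (B : R) :
  (forall n, (\sum_(0 <= j < n) `|a j.+1| <= B)%R) ->
  (`|a 0%N| <= `|\big[+%R/0]_(0 <= j <oo) a j| + B)%R.
Proof.
move=> HB.
have ca : cvgn (series a).
  apply: normed_cvg; apply: nondecreasing_is_cvgn.
    by apply/nondecreasing_seqP => n /=; rewrite [leRHS]big_nat_recr//= lerDl.
  exists (`|a 0%N| + B)%R => _ [n _ <-]; change (\sum_(0 <= j < n) `|a j| <= `|a 0%N| + B)%R.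
  case: n => [|n]; first by rewrite big_geq// addr_ge0// (le_trans _ (HB 0%N))// big_geq.
  by rewrite big_nat_recl//= lerD2l.
rewrite -lerBlDr.
have : (`|series a n| @[n --> \oo] --> `|limn (series a)|)%R by exact: cvg_norm.
move=> /[dup] /cvg_lim <- //; move=> cn; apply: limr_ge; first by apply: cvgP cn.
exists 1%N => // -[//|n] _; rewrite /series /= big_nat_recl//=.
rewrite lerBlDr -[X in (`|X| <= _)%R](addrK (\sum_(0 <= j < n) a j.+1)%R).
apply: le_trans (ler_normB _ _) _; rewrite lerD2l.
exact: le_trans (ler_norm_sum _ _ _) (HB n).
Qed.

Definition oppv d (k : Rd R d) : Rd R d := translate (origin d) (-1)%R k.

(** The terms of index [j >= 1] of a fractional difference, in absolute value and indexed
    from its node [y] of index 0. *)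
Definition diff_tail (alpha : R) d (f : Rd R d -> R) (y k : Rd R d) : \bar R :=
  \sum_(0 <= j <oo) (`|diff_coef alpha j.+1| * `|f (translate y j.+1%:R k)|)%:E.

Lemma diff_tail_ge0 alpha d (f : Rd R d -> R) y k : 0 <= diff_tail alpha f y k.
Proof. by apply: nneseries_ge0 => j _ _; rewrite lee_fin mulr_ge0. Qed.

(** The coefficient of index 0 is 1, so the value of [f] at the node of index 0 can be large
    only if the difference is large or the other nodes carry large values.  When the tail
    diverges the right-hand side is infinite and the default value of the series is
    harmless. *)
Lemma fdiff_lower_bound (alpha : R) d (f : Rd R d -> R) x k :
  `|f (translate x (- alpha)%R k)|%:E <=
  `|fdiff alpha (oppv k) f x|%:E + diff_tail alpha f (translate x (- alpha)%R k) k.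
Proof.
set y := translate _ _ _.
have nodes j : translate x (alpha - j%:R)%R (oppv k) = translate y j%:R k.
  by apply: eq_from_tnth => i; rewrite !tnth_mktuple; ring.
have [->|Gfin] := eqVneq (diff_tail alpha f y k) +oo; first by rewrite addey ?leey.
rewrite -(@fineK _ (diff_tail alpha f y k)); last first.
  by rewrite ge0_fin_numE ?diff_tail_ge0// ltey.
rewrite -EFinD lee_fin.
have := @series_head_le (fun j => diff_coef alpha j * f (translate y j%:R k))%R
  (fine (diff_tail alpha f y k)).
rewrite diff_coef0 mul1r translate0 => H.
apply: le_trans (H _) _.
  move=> n; rewrite -lee_fin fineK; last by rewrite ge0_fin_numE ?diff_tail_ge0// ltey.
  rewrite -sumEFin; under eq_bigr do rewrite normrM.
  by apply: nneseries_lim_ge => j _; rewrite lee_fin mulr_ge0.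
rewrite lerD2r /fdiff le_eqVlt; apply/orP; left; apply/eqP; congr `|_|%R.
congr (limn _); apply/funext => n; apply: eq_bigr => j _.
by rewrite nodes.
Qed.

Lemma measurable_diff_tail alpha d (f : Rd R d -> R) : measurable_fun setT f ->
  measurable_fun setT (fun z : Rd R d * Rd R d => diff_tail alpha f z.1 z.2).
Proof.
move=> mf; apply: ge0_emeasurable_sum => [j z _ _|j _].
  by rewrite lee_fin mulr_ge0.
apply/measurable_EFinP; apply: measurable_funM => //.
apply: measurableT_comp => //; apply: measurableT_comp => //.
exact: measurable_translate2.
Qed.

Lemma measurable_diff_tailx alpha d (f : Rd R d -> R) k : measurable_fun setT f ->
  measurable_fun setT (fun x => diff_tail alpha f x k).
Proof.
by move=> mf; exact: (measurableT_comp (measurable_diff_tail alpha mf) (pair2_measurable k)).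
Qed.

Lemma measurable_diff_tailk alpha d (f : Rd R d -> R) x : measurable_fun setT f ->
  measurable_fun setT (diff_tail alpha f x).
Proof.
by move=> mf; exact: (measurableT_comp (measurable_diff_tail alpha mf) (pair1_measurable x)).
Qed.

Definition super_level d (f : Rd R d -> R) (l : R) : set (Rd R d) :=
  [set x | l < `|f x|]%R.

Lemma measurable_super_level d (f : Rd R d -> R) l : measurable_fun setT f ->
  measurable (super_level f l).
Proof.
move=> mf; have mn : measurable_fun setT (fun x => `|f x|)%R by exact: measurableT_comp.
rewrite -[super_level _ _]setTI.
by apply: (measurable_fun_ltr (measurable_cst l) mn measurableT (Y := [set true])).
Qed.

(** The measure of a level set, as an integral so that the lemmas on integrals apply
    to it without conversion. *)
Definition level_mass X d (f : Rd R d -> R) (l : R) : \bar R :=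
  \int[lebesgue_Rd d]_(x in integration_domain X) (\1_(super_level f l) x)%:E.

(** Integrates the pointwise lower bound over the level set where [|f| > 2 l].  The difference
    is split at the height [l / 2], which leaves [3/2 l] of the height [2 l] on the
    left-hand side and turns the rest into the [p]-th power bounded by the modulus. *)
Lemma level_mass_fixed_step X d (alpha p l W t : R) (f : Rd R d -> R) (k : Rd R d) :
  measurable_fun setT f -> periodic_on X f -> (1 <= p)%R -> (0 < l)%R -> (0 <= W)%R ->
  (euclidean_norm (oppv k) <= t)%R -> modulus X alpha f t p <= W%:E ->
  ((l / 2) `^ (p - 1) * (3 / 2 * l))%:E * level_mass X f (2 * l) <=
  (W `^ p)%:E + ((l / 2) `^ (p - 1))%:E *
  \int[lebesgue_Rd d]_(x in integration_domain X)
    ((\1_(super_level f (2 * l)) x)%:E * diff_tail alpha f x k).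
Proof.
move=> mf pf p1 l0 W0 kt HW.
have p0 : (0 < p)%R by rewrite (lt_le_trans _ p1).
pose E := super_level f (2 * l)%R.
have mE : measurable E by exact: measurable_super_level.
have mD := @measurable_integration_domain R X d.
have mG : measurable_fun setT (fun y => diff_tail alpha f y k).
  exact: measurable_diff_tailx.
have m1 : measurable_fun setT (fun x => (\1_E x : R)%:E).
  by apply/measurable_EFinP; exact: measurable_indic.
have pE : periodic_on X (fun x => (\1_E x : R)%:E).
  case: (X) pf => //= pf c x; congr (_%:E); rewrite !indicE.
  by congr (_%:R); congr nat_of_bool; apply/idP/idP; rewrite !inE /E /super_level /= pf.
have pG : periodic_on X (fun y => diff_tail alpha f y k).
  case: (X) pf => //= pf c x; apply: eq_eseriesr => j _; congr ((_ * `|_|)%:E)%R.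
  rewrite -[RHS](pf c); congr f; apply: eq_from_tnth => i.
  by rewrite !tnth_mktuple addrAC.
pose c := ((l / 2) `^ (p - 1))%R.
have c0 : (0 < c)%R by rewrite powR_gt0// divr_gt0.
pose L y := (c * (3 / 2 * l) * \1_E y)%:E.
pose B y := c%:E * ((\1_E y)%:E * diff_tail alpha f y k).
have mB' : measurable_fun setT (fun y => (\1_E y)%:E * diff_tail alpha f y k).
  exact: emeasurable_funM.
have mL : measurable_fun setT L.
  by apply/measurable_EFinP; apply: measurable_funM => //; exact: measurable_indic.
have mB : measurable_fun setT B by exact: emeasurable_funM.
have cl0 : (0 <= c * (3 / 2 * l))%R by rewrite mulr_ge0 ?(ltW c0)// mulr_ge0// ltW.
have L0 y : 0 <= L y by rewrite lee_fin mulr_ge0.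
have B0' y : 0 <= (\1_E y)%:E * diff_tail alpha f y k.
  by rewrite mule_ge0 ?diff_tail_ge0// lee_fin.
have B0 y : 0 <= B y by rewrite mule_ge0// lee_fin ltW.
have -> : (c * (3 / 2 * l))%:E * level_mass X f (2 * l) =
    \int[lebesgue_Rd d]_(x in integration_domain X) L (translate x (- alpha)%R k).
  rewrite integral_translate//; last first.
    by rewrite /L; case: (X) pE => //= pE v x; rewrite EFinM pE -EFinM.
  rewrite /level_mass -ge0_integralZl_EFin//; exact: measurable_funTS.
have -> : c%:E * \int[lebesgue_Rd d]_(x in integration_domain X)
      ((\1_(super_level f (2 * l)) x)%:E * diff_tail alpha f x k) =
    \int[lebesgue_Rd d]_(x in integration_domain X) B (translate x (- alpha)%R k).
  rewrite (integral_translate _ _ mB B0)//; last first.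
    by rewrite /B; case: (X) pE pG => //= pE pG v x; rewrite pG pE.
  by rewrite /B -ge0_integralZl_EFin// ?(ltW c0)//; exact: measurable_funTS.
apply: (@le_trans _ _ (power_integral X p (fdiff alpha (oppv k) f) +
   \int[lebesgue_Rd d]_(x in integration_domain X) B (translate x (- alpha)%R k))); last first.
  rewrite leeD2r// -Lp_norm_leP//.
  by apply: le_trans HW; apply: ereal_sup_ubound; exists (oppv k).
apply: le_integralD_nonmeasurable => //.
- by apply: measurable_funTS; apply: measurableT_comp => //; exact: measurable_translate1.
- by apply: measurable_funTS; apply: measurableT_comp => //; exact: measurable_translate1.
move=> x _; set y := translate _ _ _.
have [Ey|nEy] := boolP (y \in E); last first.
  rewrite /L /B indicE (negbTE nEy) mulr0 mul0e mule0 adde0 lee_fin; exact: powR_ge0.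
rewrite /L /B indicE Ey mulr1 mul1e.
have := fdiff_lower_bound alpha f x k; rewrite -/y => H.
have [Gy|Gfin] := eqVneq (diff_tail alpha f y k) +oo.
  by rewrite Gy gt0_muley ?lte_fin// addey ?leey.
move: H; rewrite -(@fineK _ (diff_tail alpha f y k)); last first.
  by rewrite ge0_fin_numE ?diff_tail_ge0// ltey.
rewrite -EFinM -!EFinD !lee_fin => H.
have fy : (2 * l < `|f y|)%R by move: Ey; rewrite inE.
have := @le_add_powR `|fdiff alpha (oppv k) f x| (l / 2) p (normr_ge0 _) _ p1.
move=> /(_ (divr_gt0 l0 _)) => /(_ (ltr0n _ _)).
have -> : (1 - p = - (p - 1))%R by ring.
rewrite powRN -/c => Y.
rewrite -lerBlDr -mulrBr -ler_pdivlMl//.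
move: Y H fy; set u := (c^-1 * _)%R; set v := fine _; lra.
Qed.

End level_sets.

(** * The weak-type estimate *)

Section weak_type.
Context {R : realType}.
Local Open Scope ereal_scope.
Implicit Types (X : domain) (d : nat).

Lemma measurable_integral_section (d1 d2 : measure_display) (T1 : measurableType d1)
    (T2 : measurableType d2) (m1 : {sigma_finite_measure set T1 -> \bar R})
    (A : set T1) (F : T1 * T2 -> \bar R) : measurable A ->
  measurable_fun setT F -> (forall z, 0 <= F z) ->
  measurable_fun setT (fun y => \int[m1]_(x in A) F (x, y)).
Proof.
move=> mA mF F0; pose H := F \_ (A `*` setT).
have mH : measurable_fun setT H.
  by apply/(measurable_restrictT _ _).1; [exact: measurableX|exact: measurable_funTS].
have H0 z : 0 <= H z by exact: erestrict_ge0.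
have := measurable_fun_fubini_tonelli_G (m1 := m1) H mH H0.
congr (measurable_fun _ _); apply/funext => y.
rewrite /fubini_G [RHS]integral_mkcond; apply: eq_integral => x _.
by rewrite /H /patch in_setX in_setT andbT.
Qed.

Lemma nneseries_le (u : nat -> R) (B : R) : (forall j, (0 <= u j)%R) ->
  (forall n, (\sum_(0 <= j < n) u j <= B)%R) -> \sum_(0 <= j <oo) (u j)%:E <= B%:E.
Proof.
move=> u0 uB; apply: lime_le; first by apply: is_cvg_nneseries => j _ _; rewrite lee_fin.
by apply: nearW => n; rewrite sumEFin lee_fin.
Qed.

Lemma integral_cst_box d (tau r : R) : (0 < tau)%R ->
  \int[lebesgue_Rd d]_(k in box d `[0%R, tau[) r%:E = (r * tau ^+ d)%:E.
Proof.
move=> tau0; rewrite integral_cst; last by apply: measurable_box; exact: measurable_itv.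
rewrite EFinM; congr (_ * _); apply: etrans (lebesgue_Rd_box d (measurable_itv `[0%R, tau[)) _.
by rewrite lebesgue_measure_itv/= lte_fin tau0 oppr0 addr0 -EFin_expe.
Qed.

Lemma euclidean_norm_box d (t : R) (k : Rd R d) : (0 < d)%N -> (0 <= t)%R ->
  box d `[0%R, (t / d%:R)%R[ k -> (euclidean_norm (oppv k) <= t)%R.
Proof.
move=> d0 t0 Qk; have dR : (1 <= d%:R :> R)%R by rewrite ler1n.
rewrite /euclidean_norm -(ler_pXn2r (ltn0Sn 1)) ?nnegrE ?sqrtr_ge0// sqr_sqrtr; last first.
  by apply: sumr_ge0 => i _; exact: sqr_ge0.
apply: (@le_trans _ _ (\sum_(i < d) (t / d%:R) ^+ 2)%R).
  apply: ler_sum => i _; rewrite !tnth_mktuple add0r mulN1r sqrrN.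
  have := Qk i; rewrite /= in_itv/= => /andP[? /ltW ?].
  by rewrite ler_pXn2r// nnegrE divr_ge0// ltW// (lt_le_trans ltr01).
rewrite sumr_const card_ord -[X in (X <= _)%R]mulr_natr exprMn -mulrA ler_piMr ?sqr_ge0//.
rewrite expr2 -mulrA mulVf ?mulr1 ?invf_le1 ?(lt_le_trans ltr01)//.
by rewrite gt_eqF// (lt_le_trans ltr01).
Qed.

(** Averaged over steps [k] in a cube of side [t/d], the tail at any point [x] is at most [l],
    as soon as the [L_s] norm of [f] is small against [l] at the scale [t]: each node is
    split at the height [l/(2A)], and the dilation lemma bounds the power part by the
    full integral of [|f|^s], whatever [x] and [j].  Here [A] bounds the sum of the absolute
    values of the coefficients. *)
Lemma integral_diff_tail X d (alpha s l t A S : R) (f : Rd R d -> R) x :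
  measurable_fun setT f -> periodic_on X f -> (0 < d)%N -> (1 <= s)%R ->
  (0 < l)%R -> (0 < t <= 1)%R -> (0 < A)%R ->
  (forall n, \sum_(0 <= j < n) `|diff_coef alpha j| <= A)%R ->
  power_integral X s f <= S%:E ->
  (S <= (t / d%:R) ^+ d * (l / (2 * A)) `^ s)%R ->
  \int[lebesgue_Rd d]_(k in box d `[0%R, (t / d%:R)%R[) diff_tail alpha f x k <=
  (l * (t / d%:R) ^+ d)%:E.
Proof.
move=> mf pf d0 s1 l0 /andP[t0 t1] A0 HA HS SB.
have dR : (1 <= d%:R :> R)%R by rewrite ler1n.
have dR0 : (0 < d%:R :> R)%R by rewrite ltr0n.
set tau := (t / d%:R)%R in SB *.
have tau0 : (0 < tau)%R by rewrite divr_gt0.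
have tau1 : (tau <= 1)%R by rewrite ler_pdivrMr// mul1r (le_trans t1).
have mQ : measurable (box d `[0%R, tau[ : set (Rd R d)).
  by apply: measurable_box; exact: measurable_itv.
set mu := (l / (2 * A))%R in SB.
have mu0 : (0 < mu)%R by rewrite divr_gt0// mulr_gt0.
have mfj j : measurable_fun setT (fun k => `|f (translate x j%:R k)|%R).
  by apply: measurableT_comp => //; apply: measurableT_comp => //; exact: measurable_translate.
have one j : (0 < j)%N ->
    \int[lebesgue_Rd d]_(k in box d `[0%R, tau[) `|f (translate x j%:R k)|%:E <=
    (l / A * tau ^+ d)%:E.
  move=> j0.
  apply: (@le_trans _ _ (\int[lebesgue_Rd d]_(k in box d `[0%R, tau[)
     (mu%:E + (mu `^ (1 - s))%:E * (`|f (translate x j%:R k)| `^ s)%:E))).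
    apply: ge0_le_integral_nonmeasurable => k _; first by rewrite lee_fin.
    by rewrite -EFinM -EFinD lee_fin; exact: le_add_powR.
  have mfs : measurable_fun setT (fun k => (`|f (translate x j%:R k)| `^ s)%:E).
    by apply/measurable_EFinP; apply: (measurableT_comp (measurable_powR s)).
  rewrite ge0_integralD//; last 3 first.
  - by move=> k _; rewrite lee_fin ltW.
  - by move=> k _; rewrite -EFinM lee_fin mulr_ge0// powR_ge0.
  - by apply: measurable_funTS; exact: emeasurable_funM.
  rewrite integral_cst_box// ge0_integralZl_EFin ?powR_ge0//; last exact: measurable_funTS.
  have jS : \int[lebesgue_Rd d]_(k in box d `[0%R, tau[) (`|f (translate x j%:R k)| `^ s)%:E <= S%:E.
    apply: le_trans HS.
    apply: (@le_trans _ _ (\int[lebesgue_Rd d]_(k in integration_domain X)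
        (`|f (translate x j%:R k)| `^ s)%:E)).
      apply: ge0_subset_integral => //.
      - exact: measurable_integration_domain.
      - exact: measurable_funTS.
      case: (X) => //= k Qk i; have := Qk i; rewrite /= in_itv/= => /andP[-> kt] /=.
      exact: lt_le_trans kt tau1.
    apply: (@integral_dilation R X d x j (fun y => (`|f y| `^ s)%:E)) => //.
    - exact: measurable_power.
    - exact: (@periodic_on_comp R X d _ _ (fun v => (`|v| `^ s)%:E) f).
  apply: (@le_trans _ _ ((mu * tau ^+ d)%:E + (mu `^ (1 - s))%:E * S%:E)).
    by rewrite leeD2l// lee_wpmul2l// lee_fin powR_ge0.
  rewrite -EFinM -EFinD lee_fin.
  have muE : (mu `^ (1 - s) * mu `^ s = mu)%R.
    by rewrite -powRD ?subrK ?powRr1 ?(ltW mu0)// (gt_eqF mu0) implybT.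
  have -> : (l / A * tau ^+ d = mu * tau ^+ d + mu `^ (1 - s) * (tau ^+ d * mu `^ s))%R.
    rewrite mulrCA muE /mu; field; lra.
  by rewrite lerD2l ler_wpM2l// powR_ge0.
rewrite /diff_tail integral_nneseries//; last first.
  by move=> j; apply/measurable_EFinP; apply: measurable_funM => //; exact: measurable_funTS.
apply: (@le_trans _ _ (\sum_(0 <= j <oo) (`|diff_coef alpha j.+1| * (l / A * tau ^+ d))%:E)).
  apply: lee_nneseries => j _.
    by move=> _; apply: integral_ge0 => k _; rewrite lee_fin mulr_ge0.
  under eq_integral do rewrite EFinM.
  rewrite ge0_integralZl_EFin//; last first.
    by apply/measurable_EFinP; exact: measurable_funTS.
  by rewrite EFinM lee_wpmul2l// one.
apply: nneseries_le => [j|n].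
  by rewrite mulr_ge0// mulr_ge0 ?exprn_ge0 ?(ltW tau0)// divr_ge0// ltW.
rewrite -mulr_suml.
have -> : (l * tau ^+ d = A * (l / A * tau ^+ d))%R by field; lra.
rewrite ler_wpM2r//.
  by rewrite mulr_ge0 ?exprn_ge0 ?(ltW tau0)// divr_ge0// ltW.
apply: le_trans (HA n.+1); rewrite big_nat_recl//= lerDr//.
Qed.

(** Averages the estimate with fixed step over the small steps.  By the previous lemma the
    tail takes away at most [l] of the height [3/2 l], so a height [l/2] is left: the measure
    of a high level set is governed by the modulus of smoothness at the scale [t] alone.
    Finiteness of this measure is needed to subtract. *)
Lemma weak_type X d (alpha p s l t A S W : R) (f : Rd R d -> R) :
  measurable_fun setT f -> periodic_on X f -> (0 < d)%N -> (1 <= p)%R -> (1 <= s)%R ->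
  (0 < l)%R -> (0 < t <= 1)%R -> (0 < A)%R -> (0 <= W)%R ->
  (forall n, \sum_(0 <= j < n) `|diff_coef alpha j| <= A)%R ->
  power_integral X s f <= S%:E ->
  (S <= (t / d%:R) ^+ d * (l / (2 * A)) `^ s)%R ->
  modulus X alpha f t p <= W%:E ->
  level_mass X f (2 * l) < +oo ->
  ((l / 2) `^ p)%:E * level_mass X f (2 * l) <= (W `^ p)%:E.
Proof.
move=> mf pf d0 p1 s1 l0 t01 A0 W0 HA HS SB HW efin.
have /andP[t0 t1] := t01.
have dR0 : (0 < d%:R :> R)%R by rewrite ltr0n.
set tau := (t / d%:R)%R in SB *.
have tau0 : (0 < tau)%R by rewrite divr_gt0.
have taud : (0 < tau ^+ d)%R by rewrite exprn_gt0.
have mQ : measurable (box d `[0%R, tau[ : set (Rd R d)).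
  by apply: measurable_box; exact: measurable_itv.
have mD := @measurable_integration_domain R X d.
have e0 : 0 <= level_mass X f (2 * l) by apply: integral_ge0 => x _; rewrite lee_fin.
pose e := fine (level_mass X f (2 * l)).
have eE : level_mass X f (2 * l) = e%:E by rewrite fineK// ge0_fin_numE.
set E := super_level f (2 * l).
have mE : measurable E by exact: measurable_super_level.
pose F (z : Rd R d * Rd R d) := (\1_E z.1)%:E * diff_tail alpha f z.1 z.2.
have mF : measurable_fun setT F.
  apply: emeasurable_funM; last exact: measurable_diff_tail.
  apply/measurable_EFinP; apply: measurableT_comp => //; exact: measurable_indic.
have F0 z : 0 <= F z by rewrite mule_ge0 ?diff_tail_ge0// lee_fin.
pose Phi k := \int[lebesgue_Rd d]_(x in integration_domain X) F (x, k).
have Phi0 k : 0 <= Phi k by exact: integral_ge0.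
have PhiQ : \int[lebesgue_Rd d]_(k in box d `[0%R, tau[) Phi k <= (l * tau ^+ d * e)%:E.
  rewrite /Phi -exchange_integral//.
  apply: (@le_trans _ _ (\int[lebesgue_Rd d]_(x in integration_domain X)
      ((l * tau ^+ d)%:E * (\1_E x)%:E))).
    apply: ge0_le_integral_nonmeasurable => x _; first exact: integral_ge0.
    rewrite /F /= ge0_integralZl_EFin//; last 2 first.
    - by move=> k _; exact: diff_tail_ge0.
    - by apply: measurable_funTS; exact: measurable_diff_tailk.
    rewrite muleC lee_wpmul2r// ?lee_fin//.
    exact: (@integral_diff_tail X d alpha s l t A S f x).
  rewrite ge0_integralZl_EFin//; last 2 first.
  - by apply: measurable_funTS; apply/measurable_EFinP; exact: measurable_indic.
  - by apply: mulr_ge0; exact: ltW.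
  by rewrite -/(level_mass X f (2 * l)) eE -EFinM.
pose c := ((l / 2) `^ (p - 1))%R.
have c0 : (0 < c)%R by rewrite powR_gt0// divr_gt0.
have mPhi : measurable_fun setT Phi by exact: measurable_integral_section.
have : \int[lebesgue_Rd d]_(k in box d `[0%R, tau[) (c * (3 / 2 * l) * e)%:E <=
    \int[lebesgue_Rd d]_(k in box d `[0%R, tau[) ((W `^ p)%:E + c%:E * Phi k).
  apply: ge0_le_integral_nonmeasurable => k Qk.
    rewrite lee_fin !mulr_ge0 ?fine_ge0 ?(ltW c0) ?(ltW l0)//.
  rewrite EFinM -eE; apply: level_mass_fixed_step HW => //.
  by apply: euclidean_norm_box => //; exact: ltW.
rewrite ge0_integralD//; last 3 first.
- by move=> k _; rewrite lee_fin powR_ge0.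
- by move=> k _; rewrite mule_ge0// lee_fin ltW.
- by apply: measurable_funTS; exact: emeasurable_funM.
rewrite !integral_cst_box// ge0_integralZl_EFin// ?(ltW c0)//; last exact: measurable_funTS.
move=> H; have {H} := le_trans H (leeD2l _ (lee_wpmul2l _ PhiQ)).
rewrite -!EFinM -EFinD => H.
rewrite eE -EFinM lee_fin.
have <- : (l / 2 * c = (l / 2) `^ p)%R by rewrite mulr_powRB1// ?divr_ge0 ?ltW// (lt_le_trans ltr01).
rewrite -(ler_pM2r taud).
have aux (a b y T w : R) :
    (a * (3 / 2 * b) * y * T <= w * T + a * (b * T * y))%R ->
    (b / 2 * a * y * T <= w * T)%R by lra.
apply: aux; rewrite -lee_fin; apply: H; exact: ltW.
Qed.

End weak_type.

(** * Bootstrapping integrability *)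

Ltac positivity :=
  rewrite ?posrE;
  repeat first [ done | rewrite invr_gt0 | apply: mulr_gt0 | apply: powR_gt0
               | apply: exprn_gt0 | by rewrite ltr0n ].

(** An identity between products of real powers of positive numbers becomes a linear
    identity between logarithms. *)
Ltac take_ln :=
  apply: ln_inj; [try solve [positivity] | try solve [positivity] |
    rewrite !(lnM, lnV, ln_powR, lnXn); try solve [positivity]].

Section integrability_gain.
Context {R : realType}.
Local Open Scope ereal_scope.
Implicit Types (X : domain) (d : nat).

Lemma dyadic_level (v a : R) : (0 < v)%R -> (v < a)%R ->
  exists k : nat, (2 ^+ k * v < a <= 2 ^+ k.+1 * v)%R.
Proof.
move=> v0 va.
have ex : exists n, (a <= 2 ^+ n * v)%R.
  exists (Num.truncn (a / v)).+1; rewrite -ler_pdivrMr//.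
  apply/ltW/(lt_le_trans (truncnS_gt _)); rewrite -natrX ler_nat.
  exact/ltnW/ltn_expl.
have := ex_minnP ex; case=> -[|k] ak kmin.
  by move: ak; rewrite expr0 mul1r leNgt va.
exists k; rewrite ak andbT ltNge; apply/negP => /kmin.
by rewrite ltnn.
Qed.

(** Below the height [v] the power [s] is exchanged for [p]; above it the value is
    attributed to its dyadic level. *)
Lemma dyadic_power_le (v a p s : R) : (0 < v)%R -> (0 <= a)%R -> (0 < p)%R -> (p <= s)%R ->
  (a `^ s)%:E <= (v `^ (s - p) * a `^ p)%:E +
    \sum_(0 <= k <oo) ((2 ^+ k.+1 * v) `^ s * (2 ^+ k * v < a)%R%:R)%:E.
Proof.
move=> v0 a0 p0 ps; have s0 : (0 < s)%R by exact: lt_le_trans ps.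
have t0 k : (0 <= (2 ^+ k.+1 * v) `^ s * (2 ^+ k * v < a)%R%:R)%R.
  by rewrite mulr_ge0 ?powR_ge0.
have ser0 : 0 <= \sum_(0 <= k <oo) ((2 ^+ k.+1 * v) `^ s * (2 ^+ k * v < a)%R%:R)%:E.
  by apply: nneseries_ge0 => k _ _; rewrite lee_fin.
have [az|an0] := eqVneq a 0%R.
  by rewrite {1}az powR0 ?gt_eqF// adde_ge0// lee_fin mulr_ge0// powR_ge0.
have a1 : (0 < a)%R by rewrite lt_neqAle eq_sym an0.
have [av|va] := leP a v.
  rewrite -[X in X <= _]adde0 leeD// lee_fin.
  have -> : (a `^ s = a `^ (s - p) * a `^ p)%R.
    by rewrite -powRD ?subrK// an0 implybT.
  by rewrite ler_wpM2r ?powR_ge0// ge0_ler_powR ?nnegrE ?subr_ge0// ltW.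
have [k /andP[ka ak]] := dyadic_level v0 va.
apply: (@le_trans _ _ (\sum_(0 <= k <oo) ((2 ^+ k.+1 * v) `^ s * (2 ^+ k * v < a)%R%:R)%:E)); last first.
  by rewrite -[X in X <= _]add0e leeD// lee_fin mulr_ge0// powR_ge0.
apply: (@le_trans _ _ (\sum_(0 <= j < k.+1) ((2 ^+ j.+1 * v) `^ s * (2 ^+ j * v < a)%R%:R)%:E)); last first.
  by apply: nneseries_lim_ge => j _; rewrite lee_fin.
rewrite big_nat_recr//= ka mulr1 -[X in X <= _]add0e leeD//.
  by apply: sume_ge0 => j _; rewrite lee_fin.
by rewrite lee_fin ge0_ler_powR ?nnegrE ?(ltW s0)// mulr_ge0 ?exprn_ge0// ltW.
Qed.

Lemma geometric_sum_le (z : R) n : (0 <= z < 1)%R ->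
  (\sum_(0 <= k < n) z ^+ k <= (1 - z)^-1)%R.
Proof.
move=> /andP[z0 z1]; have z1' : (0 < 1 - z)%R by rewrite subr_gt0.
rewrite -[X in (_ <= X)%R]div1r ler_pdivlMr// mulrC.
have -> : ((1 - z) * \sum_(0 <= k < n) z ^+ k = 1 - z ^+ n)%R.
  by rewrite -{2}(expr1n _ n) subrXX big_mkord; congr (_ * _)%R;
     apply: eq_bigr => i _; rewrite expr1n mul1r.
by rewrite gerBl exprn_ge0.
Qed.

Lemma level_mass_le X d (f : Rd R d -> R) (l p S : R) : measurable_fun setT f ->
  (0 < l)%R -> (0 < p)%R -> power_integral X p f <= S%:E ->
  level_mass X f l <= ((l `^ p)^-1 * S)%:E.
Proof.
move=> mf l0 p0 HS.
apply: (@le_trans _ _ (((l `^ p)^-1)%:E * power_integral X p f)); last first.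
  by rewrite EFinM lee_wpmul2l// lee_fin invr_ge0 powR_ge0.
rewrite -ge0_integralZl_EFin//; last 3 first.
- exact: measurable_integration_domain.
- by apply: measurable_funTS; exact: measurable_power.
- by rewrite invr_ge0 powR_ge0.
apply: ge0_le_integral_nonmeasurable => x _; first by rewrite lee_fin.
rewrite -EFinM lee_fin indicE; case: (boolP (x \in _)) => [|_]; last first.
  by rewrite mulr_ge0 ?invr_ge0 ?powR_ge0.
rewrite inE /super_level /= => lf; rewrite ler_pdivlMl ?powR_gt0// mulr1.
by rewrite ge0_ler_powR ?nnegrE ?(ltW p0) ?(ltW l0)// ltW.
Qed.

(** Normalised smoothness of order [beta]: [K] plays the role of the norm of [f], and only
    scales [t <= 1/2] enter because the modulus at [t] is controlled through the values
    of the seminorm's integrand between [t] and [2 t], which must stay below 1. *)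
Definition smooth_at X d (alpha beta p M : R) (f : Rd R d -> R) (K : R) : Prop :=
  [/\ measurable_fun setT f, periodic_on X f, (0 < K)%R,
      power_integral X p f <= (K `^ p)%:E &
      forall t, (0 < t <= 1 / 2)%R ->
        modulus X alpha f t p <= (M * K * t `^ beta)%:E].

(** The functions that are smooth in the above sense are in [L_s], with a homogeneous bound;
    [p] itself is such an exponent, and the aim is to enlarge [s]. *)
Definition gains X d (alpha beta p M s : R) : Prop := exists2 C : R, (0 < C)%R &
  forall (f : Rd R d -> R) K, smooth_at X alpha beta p M f K ->
    power_integral X s f <= (C * K `^ s)%:E.

Lemma gains_refl X d (alpha beta p M : R) : gains X d alpha beta p M p.
Proof. by exists 1%R => // f K [_ _ _ ? _]; rewrite mul1r. Qed.

(** The weak-type estimate at the smallest admissible scale [t], which is proportional to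
    [mu^(-s/d)] for the level [K mu].  The factor [t^(beta p)] improves the decay
    [mu^-p] of Chebyshev by the exponent [s beta p / d]. *)
Lemma level_mass_decay X d (alpha beta p M s : R) : (0 < d)%N -> (0 < alpha)%R ->
  (0 <= beta)%R -> (1 <= p)%R -> (1 <= s)%R -> (0 < M)%R ->
  gains X d alpha beta p M s ->
  exists mu0 B : R, [/\ (0 < mu0)%R, (0 < B)%R &
    forall (f : Rd R d -> R) K mu, smooth_at X alpha beta p M f K -> (mu0 <= mu)%R ->
      level_mass X f (2 * (K * mu)) <= (B * mu `^ (- (p + s * beta * p / d%:R)))%:E].
Proof.
move=> d0 al0 be0 p1 s1 M0 [C C0 HC].
have dR0 : (0 < d%:R :> R)%R by rewrite ltr0n.
have p0 : (0 < p)%R by exact: lt_le_trans p1.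
have s0 : (0 < s)%R by exact: lt_le_trans s1.
have [A A0 HA] := sum_abs_diff_coef al0.
pose D := (d%:R * (C `^ (d%:R^-1) * (2 * A) `^ (s / d%:R)))%R.
have A20 : (0 < 2 * A)%R by rewrite mulr_gt0.
have D0 : (0 < D)%R by rewrite !mulr_gt0 ?powR_gt0.
pose mu0 := ((2 * D) `^ (d%:R / s))%R.
have mu00 : (0 < mu0)%R by apply: powR_gt0; rewrite mulr_gt0.
pose B := ((2 * M) `^ p * D `^ (beta * p))%R.
have B0 : (0 < B)%R by apply: mulr_gt0; apply: powR_gt0; [rewrite mulr_gt0|].
exists mu0, B; split=> // f K mu smf mu0mu.
have [mf pf K0 fK fmod] := smf.
have muP : (0 < mu)%R by exact: lt_le_trans mu0mu.
have l0 : (0 < K * mu)%R by rewrite mulr_gt0.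
pose t := (D * mu `^ (- (s / d%:R)))%R.
have t0 : (0 < t)%R by apply: mulr_gt0 => //; exact: powR_gt0.
have t12 : (t <= 1 / 2)%R.
  have D2 : (2 * D <= mu `^ (s / d%:R))%R.
    have -> : (2 * D = mu0 `^ (s / d%:R))%R.
      rewrite /mu0 -powRrM (_ : d%:R / s * (s / d%:R) = 1)%R; last by field; rewrite !gt_eqF.
      by rewrite powRr1// mulr_ge0// ltW.
    by apply: ge0_ler_powR; rewrite ?nnegrE ?divr_ge0 ?(ltW s0) ?(ltW dR0) ?(ltW mu00) ?(ltW muP).
  rewrite /t powRN ler_pdivrMr ?powR_gt0//; lra.
have t1 : (t <= 1)%R by rewrite (le_trans t12)// ler_pdivrMr// mul1r ler1n.
have := @weak_type R X d alpha p s (K * mu) t A (C * K `^ s) (M * K * t `^ beta) f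
  mf pf d0 p1 s1 l0 _ A0 _ HA (HC _ _ smf) _ (fmod t _) _.
rewrite t0 t1 t12 => /(_ isT).
have W0 : (0 <= M * K * t `^ beta)%R by rewrite !mulr_ge0 ?powR_ge0 ?ltW.
move=> /(_ W0).
have cond : (C * K `^ s <= (t / d%:R) ^+ d * (K * mu / (2 * A)) `^ s)%R.
  rewrite le_eqVlt; apply/orP; left; apply/eqP.
  take_ln; rewrite -[X in (_ = X + _)%R]mulr_natr; field; rewrite gt_eqF//.
move=> /(_ cond isT).
have fin : level_mass X f (2 * (K * mu)) < +oo.
  apply: le_lt_trans (level_mass_le mf _ p0 fK) _; first by rewrite mulr_gt0.
  by rewrite ltey.
move=> /(_ fin) H.
have lp0 : (0 < (K * mu / 2) `^ p)%R by rewrite powR_gt0 ?divr_gt0.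
rewrite -(@lee_pmul2l _ ((K * mu / 2) `^ p)%:E)//.
apply: le_trans H _; rewrite -EFinM lee_fin le_eqVlt; apply/orP; left; apply/eqP.
have tE : t = (D * mu `^ (- (s / d%:R)))%R by [].
have BE : B = ((2 * M) `^ p * D `^ (beta * p))%R by [].
rewrite BE {}tE; clearbody D B t.
by take_ln; field; rewrite gt_eqF.
Qed.

(** Sums the improved decay over dyadic levels. *)
Lemma gains_step X d (alpha beta p M s s' : R) : (0 < d)%N -> (0 < alpha)%R ->
  (0 <= beta)%R -> (1 <= p)%R -> (1 <= s)%R -> (0 < M)%R -> (p <= s')%R ->
  (s' < p + s * beta * p / d%:R)%R ->
  gains X d alpha beta p M s -> gains X d alpha beta p M s'.
Proof.
move=> d0 al0 be0 p1 s1 M0 ps' s'lt gs.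
have p0 : (0 < p)%R by exact: lt_le_trans p1.
have [mu0 [B [mu00 B0 decay]]] := level_mass_decay d0 al0 be0 p1 s1 M0 gs.
set kappa := (p + _)%R in s'lt decay.
pose rho := (2 `^ (s' - kappa) : R)%R.
have rho1 : (0 <= rho < 1)%R.
  rewrite powR_ge0 /= /rho /powR pnatr_eq0 /= expR_lt1.
  by rewrite nmulr_rlt0 ?subr_lt0// ln_gt0// ltr1n.
pose C := ((2 * mu0) `^ (s' - p) + (4 * mu0) `^ s' * B * mu0 `^ (- kappa) / (1 - rho))%R.
have rho1' : (0 < 1 - rho)%R by case/andP: rho1 => _; rewrite subr_gt0.
exists C.
  rewrite addr_gt0 ?powR_gt0 ?mulr_gt0// ?invr_gt0// ?powR_gt0// mulr_gt0//.
move=> f K smf; have [mf pf K0 fK fmod] := smf.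
pose v := (2 * (K * mu0))%R.
have v0 : (0 < v)%R by rewrite !mulr_gt0.
have mD := @measurable_integration_domain R X d.
have msup k : measurable_fun (integration_domain X)
   (fun x : Rd R d => ((2 ^+ k.+1 * v) `^ s' * (2 ^+ k * v < `|f x|)%R%:R)%:E).
  apply: measurable_funTS; apply/measurable_EFinP; apply: measurable_funM => //.
  rewrite (_ : (fun x => _) = \1_(super_level f (2 ^+ k * v))%R).
    by apply: measurable_indic; exact: measurable_super_level.
  apply/funext => x; rewrite indicE; congr (_%:R)%R; congr nat_of_bool.
  by apply/idP/idP; rewrite inE.
have t0 k x : (0 <= (2 ^+ k.+1 * v) `^ s' * (2 ^+ k * v < `|f x|)%R%:R)%R.
  by rewrite mulr_ge0 ?powR_ge0.
apply: (@le_trans _ _ (\int[lebesgue_Rd d]_(x in integration_domain X)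
   ((v `^ (s' - p))%:E * (`|f x| `^ p)%:E +
    \sum_(0 <= k <oo) ((2 ^+ k.+1 * v) `^ s' * (2 ^+ k * v < `|f x|)%R%:R)%:E))).
  apply: ge0_le_integral_nonmeasurable => x _; first by rewrite lee_fin powR_ge0.
  by rewrite -EFinM; exact: dyadic_power_le.
rewrite ge0_integralD//; last 4 first.
- by move=> x _; rewrite -EFinM lee_fin mulr_ge0 ?powR_ge0.
- apply: emeasurable_funM => //; apply: measurable_funTS; exact: measurable_power.
- by move=> x _; apply: nneseries_ge0 => k _ _; rewrite lee_fin.
- by apply: ge0_emeasurable_sum => [k x _ _|k _]; rewrite ?lee_fin.
rewrite ge0_integralZl_EFin ?powR_ge0//; last first.
  by apply: measurable_funTS; exact: measurable_power.
rewrite integral_nneseries//; last by move=> k x _; rewrite lee_fin.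
rewrite mulrDl EFinD; apply: leeD.
  apply: (@le_trans _ _ ((v `^ (s' - p))%:E * (K `^ p)%:E)).
    by rewrite lee_wpmul2l// lee_fin powR_ge0.
  rewrite -EFinM lee_fin le_eqVlt; apply/orP; left; apply/eqP.
  by take_ln; ring.
apply: (@le_trans _ _ (\sum_(0 <= k <oo)
   ((4 * mu0) `^ s' * B * mu0 `^ (- kappa) * K `^ s' * rho ^+ k)%:E)).
  apply: lee_nneseries => k _.
    by move=> _; apply: integral_ge0 => x _; rewrite lee_fin.
  rewrite (_ : \int[_]_(x in _) _ =
      ((2 ^+ k.+1 * v) `^ s')%:E * level_mass X f (2 ^+ k * v)); last first.
    rewrite /level_mass -ge0_integralZl_EFin ?powR_ge0//; last first.
      apply: measurable_funTS; apply/measurable_EFinP; apply: measurable_indic.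
      exact: measurable_super_level.
    apply: eq_integral => x _; rewrite indicE -EFinM; congr ((_ * _%:R)%:E)%R.
    by congr nat_of_bool; apply/idP/idP; rewrite inE.
  rewrite (_ : 2 ^+ k * v = 2 * (K * (2 ^+ k * mu0)))%R; last by rewrite /v; ring.
  apply: (@le_trans _ _ (((2 ^+ k.+1 * v) `^ s')%:E *
      (B * (2 ^+ k * mu0) `^ (- kappa))%:E)).
    rewrite lee_wpmul2l ?lee_fin ?powR_ge0//; apply: decay => //.
    by rewrite ler_peMl ?(ltW mu00)// exprn_ege1// ler1n.
  rewrite -EFinM lee_fin le_eqVlt; apply/orP; left; apply/eqP.
  rewrite (_ : 4 = 2 * 2 :> R)%R; last by ring.
  by take_ln; rewrite -![(ln _ *+ _)%R]mulr_natr -natr1; ring.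
apply: nneseries_le => [k|n].
  by case/andP: rho1 => r0 _; rewrite !mulr_ge0 ?powR_ge0 ?exprn_ge0 ?(ltW B0).
rewrite -mulr_sumr [X in (_ <= X)%R]mulrAC ler_wpM2l ?geometric_sum_le//.
by rewrite !mulr_ge0 ?powR_ge0 ?(ltW B0).
Qed.

End integrability_gain.

(** * Reaching every subcritical exponent *)

Section embedding.
Context {R : realType}.
Local Open Scope ereal_scope.
Implicit Types (X : domain) (d : nat).

(** Put [theta = beta p / d].  The map [s |-> p + theta s] has the fixed point
    [p / (1 - theta)], which is the Sobolev exponent for smoothness [beta]; below it every
    step can advance by a fixed amount [eta], so finitely many steps reach [r0]. *)
Lemma gains_subcritical X d (alpha beta p M r0 : R) : (0 < d)%N -> (0 < alpha)%R ->
  (0 < beta)%R -> (1 <= p)%R -> (0 < M)%R -> (p <= r0)%R ->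
  (0 < p - (1 - beta * p / d%:R) * r0)%R -> (beta * p / d%:R < 1)%R ->
  gains X d alpha beta p M r0.
Proof.
move=> d0 al0 be0 p1 M0 pr0 crit th1.
have p0 : (0 < p)%R by exact: lt_le_trans p1.
have dR0 : (0 < d%:R :> R)%R by rewrite ltr0n.
set th := (beta * p / d%:R)%R in crit th1.
have th0 : (0 < th)%R by rewrite divr_gt0// mulr_gt0.
pose eta := ((p - (1 - th) * r0) / 2)%R.
have eta0 : (0 < eta)%R by rewrite divr_gt0.
have iter n s : (p <= s)%R -> (s <= r0)%R -> (s <= p + n%:R * eta)%R ->
    gains X d alpha beta p M s.
  elim: n s => [|n IH] s ps sr sn.
    have -> : s = p by apply/eqP; rewrite eq_le ps andbT; move: sn; rewrite mul0r addr0.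
    exact: gains_refl.
  have etaE : (eta * 2 = p - (1 - th) * r0)%R by rewrite /eta divfK.
  have sth : (s + 2 * eta <= p + th * s)%R.
    by move: sr etaE; clearbody th eta => ? ?; nra.
  (* Going down by [eta] must not leave the range of exponents [s >= p]. *)
  pose s1 := Num.max p (s - eta)%R.
  have ps1 : (p <= s1)%R by rewrite le_max lexx.
  apply: (@gains_step R X d alpha beta p M s1 s) => //.
  - exact: ltW.
  - exact: le_trans ps1.
  - have -> : (s1 * beta * p / d%:R = th * s1)%R by rewrite /th; ring.
    have ss1 : (s - eta <= s1)%R by rewrite le_max lexx orbT.
    by move: ss1 sth th0 th1 eta0; clearbody th eta s1 => *; nra.
  apply: IH => //.
  - by rewrite ge_max pr0 /=; lra.
  - rewrite ge_max; apply/andP; split.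
      by rewrite lerDl mulr_ge0// ltW.
    by move: sn; rewrite -natr1 mulrDl mul1r; lra.
apply: (iter (Num.truncn ((r0 - p) / eta)).+1) => //.
rewrite -lerBlDl -ler_pdivrMr//; exact/ltW/truncnS_gt.
Qed.

Lemma poweR_inv_leP (r K : R) (x : \bar R) : (0 < r)%R -> 0 <= x -> (0 <= K)%R ->
  (x `^ r^-1 <= K%:E) = (x <= (K `^ r)%:E).
Proof.
move=> r0 x0 K0; have rn0 : r != 0%R by rewrite gt_eqF.
apply/idP/idP => H.
  rewrite -[X in X <= _]poweRe1// -(mulVf rn0) poweRrM -poweR_EFin.
  by apply: gt0_ler_poweR; rewrite ?(ltW r0)// in_itv/= ?leey ?andbT ?poweR_ge0 ?lee_fin.
have -> : K%:E = (K `^ r)%:E `^ r^-1 by rewrite poweR_EFin -powRrM divff// powRr1.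
apply: gt0_ler_poweR => //; first by rewrite invr_ge0 ltW.
  by rewrite in_itv/= leey andbT.
by rewrite in_itv/= leey andbT lee_fin powR_ge0.
Qed.

Lemma modulus_mono X d (alpha p t t' : R) (f : Rd R d -> R) : (t <= t')%R ->
  modulus X alpha f t p <= modulus X alpha f t' p.
Proof.
move=> tt'; apply: ge_ereal_sup => _ [h ht <-]; apply: ereal_sup_ubound.
by exists h => //; exact: le_trans tt'.
Qed.

Lemma Lp_norm_ge0 X d p (f : Rd R d -> R) : 0 <= Lp_norm X p f.
Proof. exact: Lnorm_ge0. Qed.

Lemma modulus_ge0 X d (alpha p t : R) (f : Rd R d -> R) : (0 <= t)%R ->
  0 <= modulus X alpha f t p.
Proof.
move=> t0; apply: (@le_trans _ _ (Lp_norm X p (fdiff alpha (origin d) f))).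
  exact: Lp_norm_ge0.
apply: ereal_sup_ubound; exists (origin d) => //.
rewrite /= /euclidean_norm big1 ?sqrtr0// => i _.
by rewrite tnth_mktuple expr0n.
Qed.

Lemma Lip_weighted_ge0 X d (alpha b p t : R) (f : Rd R d -> R) : (0 <= t)%R ->
  0 <= Lip_weighted X alpha b p f t.
Proof.
by move=> t0; rewrite mule_ge0 ?modulus_ge0// lee_fin mulr_ge0// powR_ge0.
Qed.

(** The integral condition gives a pointwise one: between [t] and [2 t] the modulus is
    at least its value at [t], the weight is comparable to the one on the left-hand side,
    and [ds/s] has mass at least [1/2]. *)
Lemma Lip_norm_weighted_bound X d (alpha b p : R) (q : \bar R) : 0 < q -> (0 < alpha)%R ->
  (0 < b)%R ->
  exists2 C : R, (0 < C)%R & forall (f : Rd R d -> R) K, (0 < K)%R ->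
    Lip_norm X alpha b p q f <= K%:E -> forall t, (0 < t <= 1 / 2)%R ->
    ((2 * t) `^ (- alpha) * (1 - ln t) `^ (- b))%:E * modulus X alpha f t p <= (C * K)%:E.
Proof.
move=> q0 al0 b0.
have mono (f : Rd R d -> R) (t s : R) : (0 < t <= s)%R -> (s <= 2 * t)%R -> (s < 1)%R ->
    ((2 * t) `^ (- alpha) * (1 - ln t) `^ (- b))%:E * modulus X alpha f t p <=
    Lip_weighted X alpha b p f s.
  move=> /andP[t0 ts] st s1; have s0 : (0 < s)%R by exact: lt_le_trans ts.
  have lnt : (0 < 1 - ln t)%R by rewrite subr_gt0 (le_lt_trans _ ltr01)// ln_le0// ltW// (le_lt_trans ts).
  have lns : (0 < 1 - ln s)%R by rewrite subr_gt0 (le_lt_trans _ ltr01)// ln_le0// ltW.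
  rewrite /Lip_weighted; apply: lee_pmul.
  - by rewrite lee_fin mulr_ge0// powR_ge0.
  - by rewrite modulus_ge0// ltW.
  - rewrite lee_fin ler_pM ?powR_ge0//.
      rewrite !powRN lef_pV2 ?posrE ?powR_gt0 ?mulr_gt0//.
      by rewrite ge0_ler_powR ?nnegrE ?(ltW al0) ?(ltW s0)// mulr_ge0// ltW.
    rewrite !powRN lef_pV2 ?posrE ?powR_gt0//.
    rewrite ge0_ler_powR ?nnegrE ?(ltW b0) ?(ltW lns) ?(ltW lnt)// lerD2l lerN2.
    by rewrite ler_ln ?posrE.
  - exact: modulus_mono.
case: q q0 => [r|_|//].
  rewrite lte_fin => r0; exists (2 `^ r^-1)%R; first by rewrite powR_gt0.
  move=> f K K0; rewrite /Lip_norm => HK t /andP[t0 t12].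
  set c := (_ * modulus _ _ _ _ _).
  have c0 : 0 <= c by rewrite mule_ge0 ?modulus_ge0 ?(ltW t0)// lee_fin mulr_ge0// powR_ge0.
  have {}HK : \int[lebesgue_measure]_(t in `]0%R, 1%R[)
      (Lip_weighted X alpha b p f t `^ r * t^-1%:E) <= (K `^ r)%:E.
    rewrite -poweR_inv_leP ?(ltW K0)//.
      by apply: le_trans HK; rewrite leeDr// Lp_norm_ge0.
    apply: integral_ge0 => s /=; rewrite in_itv/= => /andP[s0 _].
    by rewrite mule_ge0 ?poweR_ge0// lee_fin invr_ge0 ltW.
  have : \int[lebesgue_measure]_(s in `]t, (2 * t)%R[) (c `^ r * ((2 * t)^-1)%:E) <= (K `^ r)%:E.
    apply: le_trans HK; rewrite integral_mkcond [leRHS]integral_mkcond.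
    apply: ge0_le_integral_nonmeasurable => s _; rewrite /patch.
      case: ifPn => // _; rewrite mule_ge0 ?poweR_ge0// lee_fin invr_ge0 mulr_ge0// ltW//.
    case: ifPn => [/[!inE]/=|_]; last first.
      case: ifPn => // /[!inE]/=; rewrite in_itv/= => /andP[s0 _].
      by rewrite mule_ge0 ?poweR_ge0// lee_fin invr_ge0 ltW.
    rewrite in_itv/= => /andP[ts s2t].
    have s0 : (0 < s)%R by exact: lt_trans ts.
    have s1 : (s < 1)%R by lra.
    rewrite ifT; last by rewrite inE /= in_itv/= s0.
    apply: lee_pmul; rewrite ?poweR_ge0//.
    - by rewrite lee_fin invr_ge0 mulr_ge0// ltW.
    - apply: gt0_ler_poweR; rewrite ?(ltW r0)// ?in_itv/= ?leey ?andbT ?Lip_weighted_ge0 ?(ltW s0)//.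
      by apply: mono => //; rewrite ?t0 ltW.
    - rewrite lee_fin lef_pV2 ?posrE//; [exact: ltW|by rewrite mulr_gt0].
  rewrite integral_cst; last exact: measurable_itv.
  rewrite /= lebesgue_measure_itv/= lte_fin ltr_pMl// ltr1n/= -EFinB -muleA -EFinM.
  rewrite (_ : ((2 * t)^-1 * (2 * t - t))%R = 2^-1%R); last by field; rewrite gt_eqF.
  rewrite lee_pdivrMr// => H.
  have -> : c = (c `^ r) `^ r^-1 by rewrite -poweRrM mulfV ?gt_eqF// poweRe1.
  rewrite poweR_inv_leP ?poweR_ge0//.
    rewrite powRM ?powR_ge0 ?(ltW K0)// -powRrM mulVf ?gt_eqF// powRr1//.
    by apply: le_trans H _; rewrite -EFinM lee_fin mulrC.
  by rewrite mulr_ge0 ?powR_ge0 ?(ltW K0).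
exists 1%R => // f K K0; rewrite /Lip_norm => HK t /andP[t0 t12].
rewrite mul1r; apply: le_trans HK.
apply: (@le_trans _ _ (ereal_sup [set Lip_weighted X alpha b p f t | t in `]0%R, 1%R[])); last first.
  by rewrite leeDr// Lp_norm_ge0.
apply: (@le_trans _ _ (Lip_weighted X alpha b p f t)).
  by apply: mono; rewrite ?t0 ?lexx//; lra.
by apply: ereal_sup_ubound; exists t => //=; rewrite in_itv/= t0; lra.
Qed.

(** Logarithms cost an arbitrarily small power. *)
Lemma one_subr_ln_le (t k : R) : (0 < k)%R -> (0 < t <= 1)%R ->
  (1 - ln t <= (1 + k^-1) * t `^ (- k))%R.
Proof.
move=> k0 /andP[t0 t1].
have u0 : (0 < t `^ (- k))%R by rewrite powR_gt0.
have u1 : (1 <= t `^ (- k))%R.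
  rewrite powRN invf_ge1 ?powR_gt0//; apply: (@le_trans _ _ (1 `^ k)%R).
    by apply: ge0_ler_powR; rewrite ?nnegrE ?(ltW k0) ?(ltW t0).
  by rewrite powR1.
have : (ln (t `^ (- k)) <= t `^ (- k))%R by exact/ltW/ln_sublinear.
rewrite ln_powR mulrDl mul1r => H; apply: lerD => //.
by rewrite -[leLHS](mulKf (lt0r_neq0 k0)) ler_wpM2l ?invr_ge0 ?(ltW k0)// mulrN -mulNr.
Qed.

(** Gives up the logarithm together with a bit of the smoothness. *)
Lemma Lip_modulus_bound X d (alpha beta b p : R) (q : \bar R) : 0 < q -> (0 < alpha)%R ->
  (beta < alpha)%R -> (0 < b)%R ->
  exists2 M : R, (0 < M)%R & forall (f : Rd R d -> R) K, (0 < K)%R ->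
    Lip_norm X alpha b p q f <= K%:E -> forall t, (0 < t <= 1 / 2)%R ->
    modulus X alpha f t p <= (M * K * t `^ beta)%:E.
Proof.
move=> q0 al0 ba b0; have [C C0 HC] := @Lip_norm_weighted_bound X d alpha b p q q0 al0 b0.
pose k := ((alpha - beta) / b)%R.
have k0 : (0 < k)%R by rewrite divr_gt0// subr_gt0.
pose M := (C * 2 `^ alpha * (1 + k^-1) `^ b)%R.
have k1 : (0 < 1 + k^-1)%R by rewrite addr_gt0// invr_gt0.
exists M; first by rewrite !mulr_gt0 ?powR_gt0.
move=> f K K0 HK t /andP[t0 t12].
have := HC f K K0 HK t; rewrite t0 t12 => /(_ isT).
have t1 : (0 < t <= 1)%R by rewrite t0 /=; lra.
have lnt : (0 < 1 - ln t)%R.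
  by rewrite subr_gt0 (le_lt_trans _ ltr01)// ln_le0//; case/andP: t1.
set w := (_ * _)%R.
have w0 : (0 < w)%R by rewrite mulr_gt0 ?powR_gt0 ?mulr_gt0.
rewrite -lee_pdivlMl// => H; apply: le_trans H _; rewrite -EFinM lee_fin.
rewrite /w !powRN -invfM invrK powRM ?(ltW t0)//.
have : ((1 - ln t) `^ b <= ((1 + k^-1) * t `^ (- k)) `^ b)%R.
  apply: ge0_ler_powR; rewrite ?nnegrE ?(ltW b0) ?(ltW lnt)//.
    by rewrite mulr_ge0 ?powR_ge0 ?(ltW k1).
  exact: one_subr_ln_le.
rewrite powRM ?powR_ge0 ?(ltW k1)// -powRrM.
have -> : (- k * b = beta - alpha)%R by rewrite /k; field; rewrite gt_eqF.
have tb : (t `^ beta = t `^ alpha * t `^ (beta - alpha))%R.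
  rewrite -powRD; first by rewrite addrC subrK.
  by rewrite (gt_eqF t0) implybT.
rewrite tb => H; rewrite /M.
set T := (t `^ alpha)%R; set U := (t `^ (beta - alpha))%R in H *.
have T0 : (0 <= T)%R by exact: powR_ge0.
have -> : (C * 2 `^ alpha * (1 + k^-1) `^ b * K * (T * U) =
   2 `^ alpha * T * ((1 + k^-1) `^ b * U) * (C * K))%R by ring.
by rewrite ler_wpM2r ?mulr_ge0 ?(ltW C0) ?(ltW K0)// ler_wpM2l// mulr_ge0 ?powR_ge0.
Qed.

End embedding.

(** * The embeddings that hold *)

Section embedding_theorems.
Context {R : realType}.
Local Open Scope ereal_scope.
Implicit Types (X : domain) (d : nat).

(** A homogeneous bound of the norms gives both the inclusion and its continuity, because it
    applies to differences of functions. *)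
Lemma embeds_of_bound X d (alpha b p r0 C : R) (q : \bar R) : (0 < C)%R -> (0 < r0)%R ->
  (forall (f : Rd R d -> R) K, measurable_fun setT f -> periodic_on X f -> (0 < K)%R ->
    Lip_norm X alpha b p q f <= K%:E -> power_integral X r0 f <= (C * K `^ r0)%:E) ->
  Lip_embeds (d := d) X alpha b p q r0.
Proof.
move=> C0 r00 H.
have H' (f : Rd R d -> R) K : measurable_fun setT f -> periodic_on X f -> (0 < K)%R ->
    Lip_norm X alpha b p q f <= K%:E -> Lp_norm X r0 f <= (C `^ r0^-1 * K)%:E.
  move=> mf pf K0 HK; rewrite Lp_norm_leP// ?mulr_ge0 ?powR_ge0 ?(ltW K0)//.
  rewrite powRM ?powR_ge0 ?(ltW K0)// -powRrM mulVf ?gt_eqF// powRr1 ?(ltW C0)//.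
  exact: H.
split=> [f [[pf mf _] Lf]|f [[pf mf _] Lf] e e0].
  split=> //.
  have [K K0 HK] : exists2 K : R, (0 < K)%R & Lip_norm X alpha b p q f <= K%:E.
    case: (Lip_norm X alpha b p q f) Lf => [x _|//|_].
      exists (`|x| + 1)%R; first by rewrite ltr_wpDl.
      by rewrite lee_fin (le_trans (ler_norm x))// lerDl.
    by exists 1%R => //; rewrite leNye.
  apply: le_lt_trans (H' f K mf _ K0 HK) _; last exact: ltey.
  by rewrite -fun_on_periodic.
pose c := (C `^ r0^-1)%R.
have c0 : (0 < c)%R by rewrite powR_gt0.
exists (e / (2 * c))%R; first by rewrite divr_gt0// mulr_gt0.
move=> g [[pg mg _] _] /ltW Hgf.
have mgf : measurable_fun setT (g \- f)%R by exact: measurable_funB.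
have pgf : periodic_on X (g \- f)%R.
  by case: (X) pf pg => //= pf pg k x; rewrite pf pg.
apply: le_lt_trans (H' _ _ mgf pgf _ Hgf) _; first by rewrite divr_gt0// mulr_gt0.
rewrite lte_fin -/c (_ : c * (e / (2 * c)) = e / 2)%R; last by field; rewrite gt_eqF.
by rewrite ltr_pdivrMr// ltr_pMr// ltr1n.
Qed.

Lemma Lip_norm_ge_Lp X d (alpha b p K : R) (q : \bar R) (f : Rd R d -> R) : (0 < p)%R ->
  (0 < K)%R -> 0 < q ->
  Lip_norm X alpha b p q f <= K%:E -> power_integral X p f <= (K `^ p)%:E.
Proof.
move=> p0 K0 q0 HK; rewrite -Lp_norm_leP ?(ltW K0)//.
apply: le_trans HK; rewrite /Lip_norm leeDl//.
case: q q0 => [r|_|//]; first by move=> _; exact: poweR_ge0.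
apply: (@le_trans _ _ (Lip_weighted X alpha b p f 2^-1)).
  by rewrite Lip_weighted_ge0.
apply: ereal_sup_ubound; exists 2^-1%R => //=.
by rewrite in_itv/= invr_gt0 ltr0n /= invf_lt1// ltr1n.
Qed.

(** [beta] is the midpoint between [alpha] and the least smoothness for which [r0] is not
    supercritical. *)
Lemma subcritical_embedding X d (alpha b p r0 : R) (q : \bar R) : (0 < d)%N ->
  (0 < alpha)%R -> (0 < b)%R -> 0 < q -> (1 <= p)%R -> (p <= r0)%R ->
  (alpha < d%:R / p)%R -> (d%:R / p - d%:R / r0 < alpha)%R ->
  Lip_embeds (d := d) X alpha b p q r0.
Proof.
move=> d0 al0 b0 q0 p1 pr0 alp alr.
have p0 : (0 < p)%R by exact: lt_le_trans p1.
have r00 : (0 < r0)%R by exact: lt_le_trans pr0.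
have dR0 : (0 < d%:R :> R)%R by rewrite ltr0n.
have dpr : (d%:R / r0 <= d%:R / p)%R by rewrite ler_pM2l// lef_pV2.
pose beta := ((d%:R / p - d%:R / r0 + alpha) / 2)%R.
have be0 : (0 < beta)%R by rewrite /beta; lra.
have bea : (beta < alpha)%R by rewrite /beta; lra.
have ber : (d%:R / p - d%:R / r0 < beta)%R by rewrite /beta; lra.
have [M M0 HM] := @Lip_modulus_bound R X d alpha beta b p q q0 al0 bea b0.
have th1 : (beta * p / d%:R < 1)%R.
  rewrite ltr_pdivrMr// mul1r -ltr_pdivlMr//; exact: lt_trans alp.
have crit : (0 < p - (1 - beta * p / d%:R) * r0)%R.
  have -> : (p - (1 - beta * p / d%:R) * r0 =
     (p * r0 / d%:R) * (beta - (d%:R / p - d%:R / r0)))%R.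
    by field; rewrite !gt_eqF.
  by rewrite mulr_gt0 ?divr_gt0 ?mulr_gt0 ?subr_gt0.
have [C C0 HC] := @gains_subcritical R X d alpha beta p M r0 d0 al0 be0 p1 M0 pr0 crit th1.
apply: (embeds_of_bound C0 r00) => f K mf pf K0 HK.
apply: HC; split => //; first exact: Lip_norm_ge_Lp HK.
by move=> t t01; exact: HM.
Qed.

(** The torus has measure 1, so the values below [K] contribute at most [K^r0]. *)
Lemma torus_lower_exponent_embedding d (alpha b p r0 : R) (q : \bar R) :
  0 < q -> (0 < r0)%R -> (r0 <= p)%R ->
  Lip_embeds (d := d) Torus alpha b p q r0.
Proof.
move=> q0 r00 r0p; have p0 : (0 < p)%R by exact: lt_le_trans r0p.
apply: (@embeds_of_bound Torus d alpha b p r0 2 q) => // f K mf pf K0 HK.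
have {}HK := Lip_norm_ge_Lp p0 K0 q0 HK.
have mD := @measurable_integration_domain R Torus d.
apply: (@le_trans _ _ (\int[lebesgue_Rd d]_(x in integration_domain Torus)
   ((K `^ r0)%:E + (K `^ (r0 - p))%:E * (`|f x| `^ p)%:E))).
  apply: ge0_le_integral_nonmeasurable => x _; first by rewrite lee_fin powR_ge0.
  rewrite -EFinM -EFinD lee_fin; have [fK|Kf] := leP `|f x|%R K.
    rewrite -[leLHS]addr0 lerD ?mulr_ge0 ?powR_ge0//.
    by rewrite ge0_ler_powR ?nnegrE ?(ltW r00) ?(ltW K0).
  have fx0 : (0 < `|f x|)%R by exact: lt_trans Kf.
  rewrite -[leLHS]add0r lerD ?powR_ge0//.
  have -> : (`|f x| `^ r0 = `|f x| `^ (r0 - p) * `|f x| `^ p)%R.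
    by rewrite -powRD ?subrK// (gt_eqF fx0) implybT.
  rewrite ler_wpM2r ?powR_ge0// -[(r0 - p)%R]opprB !powRN lef_pV2 ?posrE ?powR_gt0//.
  by rewrite ge0_ler_powR ?nnegrE ?subr_ge0 ?(ltW K0) ?(ltW Kf).
rewrite ge0_integralD//; last 3 first.
- by move=> x _; rewrite lee_fin powR_ge0.
- by move=> x _; rewrite -EFinM lee_fin mulr_ge0 ?powR_ge0.
- by apply: emeasurable_funM => //; apply: measurable_funTS; exact: measurable_power.
rewrite ge0_integralZl_EFin ?powR_ge0//; last first.
  by apply: measurable_funTS; exact: measurable_power.
rewrite {1}integration_domainE integral_cst_box// expr1n mulr1.
apply: (@le_trans _ _ ((K `^ r0)%:E + (K `^ (r0 - p))%:E * (K `^ p)%:E)).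
  by rewrite leeD2l// lee_wpmul2l// lee_fin powR_ge0.
rewrite -EFinM -EFinD lee_fin -powRD ?subrK; last by rewrite (gt_eqF K0) implybT.
by rewrite mulr_natl mulr2n.
Qed.

End embedding_theorems.

(** * Finite differences of a bump sampled along a line *)

Section discrete_differences.
Context {R : realType}.
Implicit Types (u v s : nat -> R) (A B delta : R) (i j k m n N : nat).

Definition seq_diff u : nat -> R := fun j => u j.+1 - u j.

(** [u] behaves up to order [n] like the samples at spacing [delta] of a function
    with derivatives bounded by [A]; the window [i + j <= n] keeps to the samples that the
    differences of order at most [n] at 0 depend on. *)
Definition diffs_bounded n A delta u : Prop :=
  forall i j, (i + j <= n)%N -> `|iter i seq_diff u j| <= A * delta ^+ i.

Lemma seq_diffD u v i j :
  iter i seq_diff (fun n => u n + v n) j = iter i seq_diff u j + iter i seq_diff v j.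
Proof.
elim: i u v j => [//|i IH] u v j; rewrite !iterSr -IH; congr (iter i seq_diff _ j).
by apply/funext => n; rewrite /seq_diff; ring.
Qed.

Lemma seq_diffZ c u i j : iter i seq_diff (fun n => c * u n) j = c * iter i seq_diff u j.
Proof.
elim: i u j => [//|i IH] u j; rewrite !iterSr -IH; congr (iter i seq_diff _ j).
by apply/funext => n; rewrite /seq_diff; ring.
Qed.

Lemma seq_diff_shift u i j n :
  iter i seq_diff (fun l => u (n + l)%N) j = iter i seq_diff u (n + j)%N.
Proof.
elim: i u j => [//|i IH] u j; rewrite !iterSr -IH; congr (iter i seq_diff _ j).
by apply/funext => l; rewrite /seq_diff addnS.
Qed.

Lemma eq_seq_diff u v i j : (forall n, (n <= i)%N -> u (j + n)%N = v (j + n)%N) ->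
  iter i seq_diff u j = iter i seq_diff v j.
Proof.
elim: i u v j => [|i IH] u v j uv; first by have := uv 0%N isT; rewrite addn0.
rewrite !iterSr; apply: IH => n ni; rewrite /seq_diff -addnS !uv//.
by rewrite (leq_trans ni).
Qed.

Lemma seq_diff_le u i j A : (forall n, (n <= i)%N -> `|u (j + n)%N| <= A) ->
  `|iter i seq_diff u j| <= 2 ^+ i * A.
Proof.
elim: i u j A => [|i IH] u j A uA.
  by have := uA 0%N isT; rewrite addn0 expr0 mul1r.
rewrite iterSr exprSr -mulrA; apply: IH => n ni; rewrite /seq_diff -addnS.
apply: le_trans (ler_normB _ _) _; rewrite mulr_natl mulr2n lerD//; apply: uA => //.
exact: (leq_trans ni).
Qed.

Lemma diffs_boundedD n A B delta u v : diffs_bounded n A delta u ->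
  diffs_bounded n B delta v -> diffs_bounded n (A + B) delta (fun l => u l + v l).
Proof.
move=> uA vB i j ij; rewrite seq_diffD mulrDl.
by apply: le_trans (ler_normD _ _) _; apply: lerD; [exact: uA|exact: vB].
Qed.

Lemma diffs_boundedZ n A delta c u : diffs_bounded n A delta u ->
  diffs_bounded n (`|c| * A) delta (fun l => c * u l).
Proof.
by move=> uA i j ij; rewrite seq_diffZ normrM -mulrA ler_wpM2l// uA.
Qed.

Lemma diffs_bounded_cst n delta : 0 <= delta -> diffs_bounded n 1 delta (fun=> 1).
Proof.
move=> d0 [|i] j _; first by rewrite /= normr1 expr0 mulr1.
have diff0 l : iter l seq_diff (fun=> 0) j = 0 :> R.
  by elim: l => // l IH; rewrite iterSr -[RHS]IH; congr (iter l seq_diff _ j);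
     apply/funext => ?; rewrite /seq_diff subrr.
rewrite iterSr (_ : seq_diff _ = fun=> 0) ?diff0 ?normr0 ?mul1r ?exprn_ge0//.
by apply/funext => l; rewrite /seq_diff subrr.
Qed.

Lemma diffs_bounded_sum (I : finType) n A delta (u : I -> nat -> R) : 0 <= delta -> 0 <= A ->
  (forall l, diffs_bounded n A delta (u l)) ->
  diffs_bounded n (#|I|%:R * A) delta (fun j => \sum_(l : I) u l j).
Proof.
move=> d0 A0 uA i j ij.
have -> : iter i seq_diff (fun j => \sum_(l : I) u l j) j = \sum_(l : I) iter i seq_diff (u l) j.
  clear ij uA; elim: i u j => [//|i IH] u j; rewrite iterSr.
  rewrite (_ : seq_diff _ = fun j => \sum_(l : I) seq_diff (u l) j).
    by rewrite IH; apply: eq_bigr => l _; rewrite iterSr.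
  by apply/funext => l; rewrite /seq_diff sumrB.
apply: le_trans (ler_norm_sum _ _ _) _.
apply: (@le_trans _ _ (\sum_(l : I) A * delta ^+ i)); first by apply: ler_sum => l _; exact: uA.
by rewrite sumr_const -[leLHS]mulr_natl mulrA.
Qed.

(** Discrete Leibniz rule, by induction on the order: each difference falls on one of the
    two factors. *)
Lemma seq_diffM i n j A B delta u v : (i + j <= n)%N -> 0 <= A -> 0 <= B -> 0 <= delta ->
  diffs_bounded n A delta u -> diffs_bounded n B delta v ->
  `|iter i seq_diff (fun l => u l * v l) j| <= 2 ^+ i * (A * B) * delta ^+ i.
Proof.
move=> + A0 B0 d0; elim: i n j A B A0 B0 u v => [|i IH] n j A B A0 B0 u v ij uA vB.
  rewrite /= normrM !expr0 mul1r mulr1 ler_pM//.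
    by have := uA 0%N j ij; rewrite expr0 mulr1.
  by have := vB 0%N j ij; rewrite expr0 mulr1.
case: n ij uA vB => // n ij uA vB.
have shiftb w C : diffs_bounded n.+1 C delta w -> diffs_bounded n (C * delta) delta (seq_diff w).
  by move=> wC a b ab; rewrite -iterSr -mulrA -exprS; apply: wC.
rewrite iterSr (_ : seq_diff _ = fun l => seq_diff u l * v l + u (1 + l)%N * seq_diff v l); last first.
  by apply/funext => l; rewrite /seq_diff add1n; ring.
rewrite seq_diffD; apply: le_trans (ler_normD _ _) _.
have -> : 2 ^+ i.+1 * (A * B) * delta ^+ i.+1 =
    2 ^+ i * (A * delta * B) * delta ^+ i + 2 ^+ i * (A * (B * delta)) * delta ^+ i.
  by rewrite !exprS; ring.
apply: lerD.
  apply: (IH n) => //; [by rewrite mulr_ge0|exact: shiftb|].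
  by move=> a b ab; apply: vB; exact: leqW.
apply: (IH n) => //; [by rewrite mulr_ge0| |exact: shiftb].
by move=> a b ab; rewrite seq_diff_shift; apply: uA; rewrite add1n addnS.
Qed.

Lemma diffs_boundedM n A B delta u v : 0 <= A -> 0 <= B -> 0 <= delta ->
  diffs_bounded n A delta u -> diffs_bounded n B delta v ->
  diffs_bounded n (2 ^+ n * (A * B)) delta (fun l => u l * v l).
Proof.
move=> A0 B0 d0 uA vB i j ij; apply: le_trans (seq_diffM ij A0 B0 d0 uA vB) _.
rewrite ler_wpM2r ?exprn_ge0// ler_wpM2r ?mulr_ge0//.
by rewrite ler_weXn2l ?ler1n// (leq_trans _ ij)// leq_addr.
Qed.

Lemma diffs_boundedX n m A delta u : 0 <= A -> 0 <= delta ->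
  diffs_bounded n A delta u ->
  diffs_bounded n ((2 ^+ n * A) ^+ m) delta (fun l => u l ^+ m).
Proof.
move=> A0 d0 uA; elim: m => [|m IH]; first exact: diffs_bounded_cst.
rewrite exprS -mulrA; under [fun l => _]eq_fun do rewrite exprS.
by apply: diffs_boundedM => //; rewrite exprn_ge0// mulr_ge0// exprn_ge0.
Qed.

(** A truncated polynomial: it vanishes to order [m] at the boundary of its support,
    which is the regularity that differences of order at most [m] see. *)
Definition bump_profile (I : finType) m (v : I -> R) : R :=
  Num.max 0 (1 - \sum_(l : I) v l ^+ 2) ^+ m.

Lemma bump_profile_eq0 (I : finType) m (v : I -> R) l :
  (0 < m)%N -> 1 < `|v l| -> bump_profile m v = 0.
Proof.
move=> m0 vl; rewrite /bump_profile (max_idPl _) ?expr0n ?gtn_eqF//.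
rewrite subr_le0 (bigD1 l)//= -[leLHS]addr0 lerD ?sumr_ge0//.
  by rewrite -real_normK ?num_real// exprn_ege1// ltW.
by move=> i _; rewrite sqr_ge0.
Qed.

Lemma seq_step_le u delta j n : (forall l, `|u l.+1 - u l| <= delta) ->
  `|u (j + n)%N - u j| <= n%:R * delta.
Proof.
move=> H; elim: n => [|n IH]; first by rewrite addn0 subrr normr0 mul0r.
rewrite addnS -(subrKA (u (j + n)%N)); apply: le_trans (ler_normD _ _) _.
by rewrite -natr1 mulrDl mul1r addrC lerD.
Qed.

(** If all nodes of the difference lie where the truncation is inactive, the profile is
    a power of a polynomial in the samples and the Leibniz rule applies. *)
Lemma bump_window_inside (I : finType) m i j delta (v : I -> nat -> R) :
  0 <= delta -> (i <= m)%N ->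
  (forall l a n, (0 < a)%N -> `|iter a seq_diff (v l) n| <= delta ^+ a) ->
  (forall n, (n <= i)%N -> 0 <= 1 - \sum_(l : I) v l (j + n)%N ^+ 2) ->
  `|iter i seq_diff (fun n => bump_profile m (v ^~ n)) j| <=
    (2 ^+ m * (1 + #|I|%:R * 2 ^+ m)) ^+ m * delta ^+ i.
Proof.
move=> d0 im vd inside.
pose w l n := v l (j + n)%N.
pose Q n := 1 - \sum_(l : I) w l n ^+ 2.
have -> : iter i seq_diff (fun n => bump_profile m (v ^~ n)) j =
    iter i seq_diff (fun n => Q n ^+ m) 0%N.
  rewrite -[in LHS](addn0 j) -seq_diff_shift; apply: eq_seq_diff => n ni.
  by rewrite /bump_profile (max_idPr _)// inside.
have wb l : diffs_bounded i 1 delta (w l).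
  move=> [|a] n an; last by rewrite mul1r /w seq_diff_shift vd.
  rewrite /= expr0 mulr1 -[leRHS]normr1 -ler_sqr ?nnegrE// !real_normK ?num_real//.
  have := inside n an; rewrite subr_ge0 expr1n; apply: le_trans.
  by rewrite (bigD1 l)//= lerDl sumr_ge0// => ? _; exact: sqr_ge0.
have w2 l : diffs_bounded i (2 ^+ i) delta (fun n => w l n ^+ 2).
  under [fun n => _]eq_fun do rewrite expr2.
  by have := diffs_boundedM ler01 ler01 d0 (wb l) (wb l); rewrite !mulr1.
have Qb : diffs_bounded i (1 + #|I|%:R * 2 ^+ i) delta Q.
  rewrite /Q; under [fun n => _]eq_fun do rewrite -mulN1r.
  apply: diffs_boundedD; first exact: diffs_bounded_cst.
  rewrite -[X in diffs_bounded i X]mul1r -[X in X * _]normrN1.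
  by apply: diffs_boundedZ; apply: diffs_bounded_sum => //; rewrite exprn_ge0.
have c0 n : 0 <= 1 + #|I|%:R * 2 ^+ n :> R by rewrite addr_ge0// mulr_ge0 ?exprn_ge0.
have := diffs_boundedX m (c0 i) d0 Qb; move=> /(_ i 0%N); rewrite addn0 => /(_ (leqnn _)) H.
apply: le_trans H _; rewrite ler_wpM2r ?exprn_ge0//.
have e2 : 2 ^+ i <= 2 ^+ m :> R by rewrite ler_weXn2l// ler1n.
rewrite lerXn2r ?nnegrE ?mulr_ge0 ?exprn_ge0//.
rewrite ler_pM ?exprn_ge0// lerD2l ler_wpM2l//.
Qed.

(** If the sample [n1] lies outside the support, the coordinates of all samples differ from its
    own by at most [m delta], so that the profile is at most a multiple of [delta^m] at each of
    them; the bound by the size of the values is then enough. *)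
Lemma bump_window_edge (I : finType) m i j n1 delta (v : I -> nat -> R) :
  0 <= delta <= 1 -> (i <= m)%N -> (n1 <= i)%N ->
  (forall l a n, (0 < a)%N -> `|iter a seq_diff (v l) n| <= delta ^+ a) ->
  1 - \sum_(l : I) v l (j + n1)%N ^+ 2 < 0 ->
  `|iter i seq_diff (fun n => bump_profile m (v ^~ n)) j| <=
    (2 * (#|I|%:R * (m%:R * (2 + m%:R)))) ^+ m * delta ^+ i.
Proof.
move=> /andP[d0 d1] im ni1 vd outside.
set C := #|I|%:R * (m%:R * (2 + m%:R)).
have C0 : 0 <= C by rewrite mulr_ge0// mulr_ge0// addr_ge0.
have step l n : `|v l n.+1 - v l n| <= delta by have := vd l 1%N n isT; rewrite expr1.
have dist l n : (n <= i)%N -> `|v l (j + n1)%N - v l (j + n)%N| <= m%:R * delta.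
  move=> ni; wlog nn1 : n n1 ni1 ni {outside} / (n <= n1)%N.
    by move=> H; have [|/ltnW] := leqP n n1; [exact: H|rewrite distrC; exact: H].
  rewrite -(subnKC nn1) addnA; apply: le_trans (seq_step_le _ _ (step l)) _.
  by rewrite ler_wpM2r// ler_nat (leq_trans (leq_subr _ _))// (leq_trans ni1).
have Psi n : (n <= i)%N -> `|bump_profile m (v ^~ (j + n)%N)| <= (C * delta) ^+ m.
  move=> ni; rewrite /bump_profile normrX.
  rewrite lerXn2r ?nnegrE ?mulr_ge0// ger0_norm ?le_max ?lexx//.
  rewrite ge_max mulr_ge0//=.
  have [Q0|Q0] := leP (1 - \sum_(l : I) v l (j + n)%N ^+ 2) 0.
    by rewrite (le_trans Q0)// mulr_ge0.
  apply: (@le_trans _ _ (\sum_(l : I) (v l (j + n1)%N ^+ 2 - v l (j + n)%N ^+ 2))).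
    by rewrite sumrB; lra.
  apply: (@le_trans _ _ (\sum_(l : I) (m%:R * (2 + m%:R)) * delta)); last first.
    by rewrite sumr_const -[leLHS]mulr_natl mulrA.
  apply: ler_sum => l _.
  have v1 : `|v l (j + n)%N| <= 1.
    rewrite -[leRHS]normr1 -ler_sqr ?nnegrE// !real_normK ?num_real//.
    move: Q0; rewrite subr_gt0 expr1n => /ltW; apply: le_trans.
    by rewrite (bigD1 l)//= lerDl sumr_ge0// => ? _; exact: sqr_ge0.
  rewrite subr_sqr; apply: le_trans (ler_norm _) _; rewrite normrM.
  have := dist l n ni; set a := v l _; set b := v l _ in v1 *.
  move=> ab; have : `|a + b| <= 2 + m%:R.
    have -> : a + b = (a - b) + (b + b) by ring.
    apply: le_trans (ler_normD _ _) _; rewrite addrC lerD//.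
      by apply: le_trans (ler_normD _ _) _; rewrite (_ : 2 = 1 + 1) ?lerD//.
    by apply: le_trans ab _; rewrite ler_piMr.
  move=> apb; rewrite [leRHS]mulrAC.
  by rewrite ler_pM.
clearbody C; apply: le_trans (seq_diff_le Psi) _.
rewrite !exprMn -!mulrA; apply: ler_pM.
- exact: exprn_ge0.
- by apply: mulr_ge0; exact: exprn_ge0.
- by apply: ler_weXn2l => //; rewrite ler1n.
- by apply: ler_wpM2l; [exact: exprn_ge0|exact: ler_wiXn2l].
Qed.

(** The number of nodes in the product set around the support is kept as a factor: integrated
    in the end, it localises the difference to a set as small as the support. *)
Lemma bump_diff_bound d m : (0 < m)%N -> exists2 M : R, 0 < M &
  forall (v : 'I_d -> nat -> R) delta i j, 0 <= delta <= 1 -> (i <= m)%N ->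
  (forall l a n, (0 < a)%N -> `|iter a seq_diff (v l) n| <= delta ^+ a) ->
  `|iter i seq_diff (fun n => bump_profile m (v ^~ n)) j| <=
    M * delta ^+ i * \sum_(n < i.+1) [forall l, `|v l (j + n)%N| <= 1]%:R.
Proof.
move=> m0.
pose M1 : R := (2 ^+ m * (1 + #|'I_d|%:R * 2 ^+ m)) ^+ m.
pose M2 : R := (2 * (#|'I_d|%:R * (m%:R * (2 + m%:R)))) ^+ m.
have M10 : 0 <= M1 by rewrite exprn_ge0// mulr_ge0 ?exprn_ge0// addr_ge0// mulr_ge0 ?exprn_ge0.
have M20 : 0 <= M2 by rewrite exprn_ge0// !mulr_ge0// addr_ge0.
exists (1 + M1 + M2); first by rewrite -addrA ltr_pwDl// addr_ge0.
move=> v delta i j /andP[d0 d1] im vd.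
have [/existsP[n0 sn0]|] := boolP [exists n : 'I_i.+1, [forall l, `|v l (j + n)%N| <= 1]]; last first.
  rewrite negb_exists => /forallP none.
  have -> : iter i seq_diff (fun n => bump_profile m (v ^~ n)) j = iter i seq_diff (fun=> 0) j.
    apply: eq_seq_diff => n ni; have := none (Ordinal (ni : (n < i.+1)%N)).
    rewrite negb_forall => /existsP[l]; rewrite -ltNge => vl.
    exact: (@bump_profile_eq0 _ _ _ l).
  have := @seq_diff_le (fun=> 0) i j 0; rewrite mulr0 normr0 => /(_ (fun _ _ => lexx _)).
  move=> /le_trans; apply; rewrite mulr_ge0 ?sumr_ge0// mulr_ge0 ?exprn_ge0//.
  by rewrite !addr_ge0.
have s1 : 1 <= \sum_(n < i.+1) [forall l, `|v l (j + n)%N| <= 1]%:R :> R.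
  by rewrite (bigD1 n0)//= sn0 lerDl sumr_ge0.
apply: (@le_trans _ _ ((1 + M1 + M2) * delta ^+ i)); last first.
  by rewrite ler_peMr// mulr_ge0 ?exprn_ge0// !addr_ge0.
have [/forallP inside|] := boolP [forall n : 'I_i.+1, 0 <= 1 - \sum_l v l (j + n)%N ^+ 2].
  apply: (@le_trans _ _ (M1 * delta ^+ i)).
    apply: bump_window_inside => // n ni.
    exact: (inside (Ordinal (ni : (n < i.+1)%N))).
  by rewrite ler_wpM2r ?exprn_ge0//; lra.
rewrite negb_forall => /existsP[n1]; rewrite -ltNge => out.
apply: (@le_trans _ _ (M2 * delta ^+ i)).
  by apply: (bump_window_edge _ im _ vd out); rewrite ?d0// -ltnS.
by rewrite ler_wpM2r ?exprn_ge0//; lra.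
Qed.

End discrete_differences.

(** * Summation by parts for fractional differences *)

Section fractional_difference_bound.
Context {R : realType}.
Implicit Types (X : domain) (d i j k n N : nat).

(** When [N] is comparable to [1/delta], the powers [N^-a] and [delta^a] are too, for either
    sign of [a]. *)
Lemma powR_scale_le (a delta : R) N : 0 < delta -> 1 <= delta * N.+1%:R <= 2 ->
  N.+1%:R `^ (- a) <= 2 `^ `|a| * delta `^ a.
Proof.
move=> d0 /andP[N1 N2]; have N0 : 0 < N.+1%:R :> R by rewrite ltr0n.
have dN0 : 0 < delta * N.+1%:R by rewrite mulr_gt0.
have -> : N.+1%:R `^ (- a) = (delta * N.+1%:R) `^ (- a) * delta `^ a.
  rewrite powRM ?(ltW d0) ?(ltW N0)// mulrAC -powRD ?addNr ?powRr0 ?mul1r//.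
  by rewrite (gt_eqF d0) implybT.
rewrite ler_wpM2r ?powR_ge0//; have [a0|a0] := leP 0 a.
  apply: (@le_trans _ _ 1).
    by rewrite -[leRHS](powRr0 (delta * N.+1%:R)) ler_powR// oppr_le0.
  by rewrite -[leLHS](powRr0 2) ler_powR// ler1n.
rewrite ltr0_norm//.
by apply: ge0_ler_powR; rewrite ?nnegrE ?oppr_ge0 ?(ltW a0) ?(ltW dN0).
Qed.

(** The head of the fractional difference, with [N ~ 1/delta] terms, is of size [delta^a]: the
    absolute values of the coefficients would only give a bounded sum.  Summation by
    parts lowers [a] by 1 and gains a factor [delta] from the differenced samples, until [a <= 0],
    where the coefficients are nonnegative and their sum is at most a multiple of [N^-a].
    The weights [L] record at which nodes the localising function [s] is evaluated. *)
Lemma abel_weights k (a : R) : a <= k%:R -> exists2 C : R, 0 < C &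
  forall N delta, 0 < delta -> 1 <= delta * N.+1%:R <= 2 ->
  exists L : seq (R * nat), [/\ all (fun w => 0 <= w.1) L,
    \sum_(w <- L) w.1 <= C * delta `^ a &
    forall (u s : nat -> R) Mu, 0 <= Mu -> (forall j, 0 <= s j) ->
      (forall i j, (i <= k)%N -> `|iter i seq_diff u j| <=
         Mu * delta ^+ i * \sum_(n < i.+1) s (j + n)%N) ->
      `|\sum_(0 <= j < N.+1) diff_coef a j * u j| <= Mu * \sum_(w <- L) w.1 * s w.2].
Proof.
elim: k a => [|k IH] a ak.
  have [C C0 HC] := diff_coef_bound (a - 1).
  exists (C * 2 `^ `|a|); first by rewrite mulr_gt0 ?powR_gt0.
  move=> N delta d0 dN; exists [seq (diff_coef a j, j) | j <- index_iota 0 N.+1]; split.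
  - by apply/allP => _ /mapP[j _ ->] /=; exact: diff_coef_ge0.
  - rewrite big_map /= sum_diff_coef; apply: le_trans (ler_norm _) _.
    apply: le_trans (HC N) _; rewrite -mulrA ler_wpM2l ?(ltW C0)// subrK.
    exact: powR_scale_le.
  - move=> u s Mu Mu0 s0 H; apply: le_trans (ler_norm_sum _ _ _) _.
    rewrite big_map mulr_sumr; apply: ler_sum => j _ /=.
    rewrite normrM ger0_norm ?diff_coef_ge0// mulrCA ler_wpM2l ?diff_coef_ge0//.
    by have := H 0%N j isT; rewrite /= expr0 mulr1 big_ord1 addn0.
have ak1 : a - 1 <= k%:R by rewrite lerBlDr natr1.
have [C C0 HC] := IH _ ak1.
have [D D0 HD] := diff_coef_bound (a - 1).
exists (D * 2 `^ `|a| + 2 * C); first by rewrite addr_gt0 ?mulr_gt0 ?powR_gt0.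
move=> N delta d0 dN; have [L [L0 LC HL]] := HC N delta d0 dN.
exists ((`|diff_coef (a - 1) N|, N.+1) ::
  ([seq (delta * w.1, w.2) | w <- L] ++ [seq (delta * w.1, w.2.+1) | w <- L])); split.
- rewrite /= normr_ge0 all_cat !all_map /=; apply/andP; split.
    by apply: sub_all L0 => w /= w0; rewrite mulr_ge0// ltW.
  by apply: sub_all L0 => w /= w0; rewrite mulr_ge0// ltW.
- rewrite big_cons big_cat /= !big_map /= -!mulr_sumr mulrDl; apply: lerD.
    apply: le_trans (HD N) _; rewrite -mulrA ler_wpM2l ?(ltW D0)// subrK.
    exact: powR_scale_le.
  rewrite -mulr2n -[leLHS]mulr_natl -!mulrA ler_wpM2l//.
  have -> : delta `^ a = delta * delta `^ (a - 1).
    rewrite -{2}[delta]powRr1 ?(ltW d0)// -powRD; first by rewrite addrC subrK.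
    by rewrite (gt_eqF d0) implybT.
  by rewrite mulrCA ler_wpM2l// ltW.
- move=> u s Mu Mu0 s0 H; rewrite diff_coef_abel [X in Mu * X]big_cons big_cat /= !big_map /=.
  apply: le_trans (ler_normB _ _) _; rewrite mulrDr; apply: lerD.
    rewrite normrM mulrCA ler_wpM2l//.
    by have := H 0%N N.+1 isT; rewrite /= expr0 mulr1 big_ord1 addn0.
  have := HL (seq_diff u) (fun j => s j + s j.+1) (Mu * delta).
  rewrite mulr_ge0 ?(ltW d0)// => /(_ isT) H1.
  apply: le_trans (H1 _ _) _.
  + by move=> j; rewrite addr_ge0.
  + move=> i j ik; rewrite -iterSr; apply: le_trans (H i.+1 j _) _ => //.
    rewrite exprS -!mulrA ler_wpM2l// ler_wpM2l ?(ltW d0)// ler_wpM2l ?exprn_ge0 ?(ltW d0)//.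
    rewrite big_split/= big_ord_recr/= addrC [leRHS]addrC lerD//.
      by rewrite [leRHS]big_ord_recr/= addnS lerDr sumr_ge0.
  + rewrite -mulrA ler_wpM2l// le_eqVlt; apply/orP; left; apply/eqP.
    rewrite mulr_sumr -big_split/=; apply: eq_bigr => w _; ring.
Qed.

Lemma norm_lim_le (a : nat -> R) n0 (B0 B : R) :
  (forall n, \sum_(0 <= j < n) `|a j| <= B0) ->
  (forall n, (n0 <= n)%N -> `|\sum_(0 <= j < n) a j| <= B) ->
  `|\big[+%R/0]_(0 <= j <oo) a j| <= B.
Proof.
move=> HB0 HB.
have ca : cvgn (series a).
  apply: normed_cvg; apply: nondecreasing_is_cvgn.
    by apply/nondecreasing_seqP => n /=; rewrite [leRHS]big_nat_recr//= lerDl.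
  exists B0 => _ [n _ <-]; exact: HB0.
have : `|series a n| @[n --> \oo] --> `|limn (series a)| by exact: cvg_norm.
move=> /[dup] /cvg_lim <- //; move=> cn; apply: limr_le; first by apply: cvgP cn.
by exists n0 => // n /HB.
Qed.

Local Open Scope ereal_scope.

Lemma integral_indic_translate X d (S : set (Rd R d)) c h : measurable S ->
  periodic_on X (\1_S : Rd R d -> R) ->
  \int[lebesgue_Rd d]_(x in integration_domain X) (\1_S (translate x c h))%:E =
  \int[lebesgue_Rd d]_(x in integration_domain X) (\1_S x)%:E.
Proof.
move=> mS pS; rewrite (@integral_translate R X d c h (fun x => (\1_S x)%:E))//.
- by apply/measurable_EFinP; exact: measurable_indic.
- exact: (@periodic_on_comp R X d _ _ EFin).
Qed.

(** If head and tail of the fractional difference are both dominated by sums of translates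
    of an indicator with total weight at most [W], then so is the whole difference, and its
    [L_p] norm is at most [Mu W] times that of the indicator.  The exponent [p] is reduced to 1
    by [Y^p <= W^(p-1) Y]. *)
Lemma fdiff_power_bound X d (alpha p Mu W V A : R) (f : Rd R d -> R) (h : Rd R d)
    (S : set (Rd R d)) n0 (L : seq (R * nat)) :
  (1 <= p)%R -> (0 <= Mu)%R -> (0 <= W)%R -> measurable S ->
  periodic_on X (\1_S : Rd R d -> R) ->
  \int[lebesgue_Rd d]_(x in integration_domain X) (\1_S x)%:E <= V%:E ->
  (forall n, \sum_(0 <= j < n) `|diff_coef alpha j| <= A)%R ->
  all (fun w => 0 <= w.1)%R L ->
  (forall n, \sum_(w <- L) w.1 + \sum_(0 <= j < n) `|diff_coef alpha (n0 + j)| <= W)%R ->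
  (forall x, `|f x| <= Mu * \1_S x)%R ->
  (forall x, `|\sum_(0 <= j < n0) diff_coef alpha j * f (translate x (alpha - j%:R) h)| <=
     Mu * \sum_(w <- L) w.1 * \1_S (translate x (alpha - w.2%:R) h))%R ->
  power_integral X p (fdiff alpha h f) <= ((Mu * W) `^ p * V)%:E.
Proof.
move=> p1 Mu0 W0 mS pS SV HA L0 LW fS head.
have p0 : (0 < p)%R by exact: lt_le_trans p1.
pose s j x : R := \1_S (translate x (alpha - j%:R) h).
have s01 j x : (0 <= s j x <= 1)%R.
  by rewrite /s indicE; case: (_ \in _); rewrite ?lexx ler01.
have LW0 : (0 <= \sum_(w <- L) w.1)%R.
  by rewrite big_seq sumr_ge0// => w /(allP L0).
pose Y x : \bar R := (\sum_(w <- L) w.1 * s w.2 x)%:E +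
  \sum_(0 <= j <oo) (`|diff_coef alpha (n0 + j)| * s (n0 + j)%N x)%:E.
have t0 j x : (0 <= `|diff_coef alpha (n0 + j)| * s (n0 + j)%N x)%R.
  by rewrite mulr_ge0//; case/andP: (s01 (n0 + j)%N x).
have Yhead0 x : (0 <= \sum_(w <- L) w.1 * s w.2 x)%R.
  rewrite big_seq sumr_ge0// => w wL; rewrite mulr_ge0 ?(allP L0 w)//.
have tail0 x : 0 <= \sum_(0 <= j <oo) (`|diff_coef alpha (n0 + j)| * s (n0 + j)%N x)%:E.
  by apply: nneseries_ge0 => j _ _; rewrite lee_fin.
have YW x : Y x <= W%:E.
  have tailW : \sum_(0 <= j <oo) (`|diff_coef alpha (n0 + j)| * s (n0 + j)%N x)%:E <=
      (W - \sum_(w <- L) w.1)%:E.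
    apply: nneseries_le => // n; rewrite lerBrDl; apply: le_trans (LW n); rewrite lerD2l.
    apply: ler_sum => j _; rewrite ler_piMr//.
    by case/andP: (s01 (n0 + j)%N x).
  apply: (@le_trans _ _ ((\sum_(w <- L) w.1)%:E + (W - \sum_(w <- L) w.1)%:E)); last first.
    by rewrite -EFinD lee_fin addrC subrK.
  apply: leeD => //; rewrite lee_fin big_seq [leRHS]big_seq; apply: ler_sum => w wL.
  by rewrite ler_piMr ?(allP L0 w)//; case/andP: (s01 w.2 x).
have Y0 x : 0 <= Y x by rewrite adde_ge0// lee_fin.
have Yfin x : Y x \is a fin_num by rewrite ge0_fin_numE// (le_lt_trans (YW x))// ltey.
have tailfin x : \sum_(0 <= j <oo) (`|diff_coef alpha (n0 + j)| * s (n0 + j)%N x)%:E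
    \is a fin_num.
  rewrite ge0_fin_numE//; apply: le_lt_trans (le_lt_trans (YW x) (ltry W)).
  by rewrite /Y leeDr// lee_fin.
have fdY x : (`|fdiff alpha h f x| <= Mu * fine (Y x))%R.
  apply: (@norm_lim_le _ n0 (A * Mu)%R) => n.
    apply: (@le_trans _ _ (\sum_(0 <= j < n) `|diff_coef alpha j| * Mu)%R).
      apply: ler_sum => j _; rewrite normrM; apply: ler_wpM2l => //.
      apply: le_trans (fS _) _; rewrite ler_piMr//.
    by rewrite -mulr_suml ler_wpM2r.
  move=> n0n; rewrite (big_cat_nat (n := n0))//=.
  apply: le_trans (ler_normD _ _) _.
  rewrite /Y fineD// mulrDr; apply: lerD; first exact: head.
  rewrite -lee_fin EFinM fineK//.
  apply: (@le_trans _ _ (Mu%:E * (\sum_(0 <= j < n - n0)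
      `|diff_coef alpha (n0 + j)| * s (n0 + j)%N x)%:E)); last first.
    rewrite lee_wpmul2l//; rewrite -sumEFin.
    by apply: nneseries_lim_ge => j _; rewrite lee_fin.
  rewrite -EFinM lee_fin; apply: le_trans (ler_norm_sum _ _ _) _.
  rewrite -{1}[n0]add0n big_addn mulr_sumr; apply: ler_sum => j _.
  rewrite (addnC j) -/(diff_coef alpha (n0 + j)) normrM mulrCA.
  apply: ler_wpM2l => //; exact: fS.
have m1S : measurable_fun setT (\1_S : Rd R d -> R) by exact: measurable_indic.
have ms j : measurable_fun setT (fun x : Rd R d => s j x).
  exact: (measurableT_comp m1S (measurable_translate1 (alpha - j%:R) h)).
have mtail : measurable_fun setT
    (fun x : Rd R d => \sum_(0 <= j <oo) (`|diff_coef alpha (n0 + j)| * s (n0 + j)%N x)%:E).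
  apply: ge0_emeasurable_sum => [j x _ _|j _]; first by rewrite lee_fin.
  by apply/measurable_EFinP; exact: measurable_funM.
have mhead : measurable_fun setT (fun x : Rd R d => (\sum_(w <- L) w.1 * s w.2 x)%:E).
  by apply/measurable_EFinP; apply: measurable_sum => w; exact: measurable_funM.
have mY : measurable_fun setT Y by exact: emeasurable_funD.
have mD := @measurable_integration_domain R X d.
have intS j : \int[lebesgue_Rd d]_(x in integration_domain X) (s j x)%:E <= V%:E.
  by rewrite integral_indic_translate.
have V0 : (0 <= V)%R.
  rewrite -lee_fin; apply: le_trans SV; apply: integral_ge0 => x _.
  by rewrite lee_fin.
have scaleS (c : R) j : (0 <= c)%R ->
    \int[lebesgue_Rd d]_(x in integration_domain X) (c * s j x)%:E <= (c * V)%:E.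
  move=> c0; under eq_integral do rewrite EFinM.
  rewrite ge0_integralZl_EFin//.
  - by rewrite EFinM lee_wpmul2l.
  - by move=> x _; rewrite lee_fin.
  - by apply: measurable_funTS; apply/measurable_EFinP.
have iY : \int[lebesgue_Rd d]_(x in integration_domain X) Y x <= (W * V)%:E.
  rewrite /Y ge0_integralD//; last 3 first.
  - by move=> x _; rewrite lee_fin.
  - exact: measurable_funTS.
  - exact: measurable_funTS.
  have h1 : \int[lebesgue_Rd d]_(x in integration_domain X) (\sum_(w <- L) w.1 * s w.2 x)%:E <=
      ((\sum_(w <- L) w.1) * V)%:E.
    have absL (F : nat -> R) : (\sum_(w <- L) w.1 * F w.2 = \sum_(w <- L) `|w.1| * F w.2)%R.
      by rewrite big_seq [RHS]big_seq; apply: eq_bigr => w /(allP L0) ?; rewrite ger0_norm.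
    under eq_integral => x _ do rewrite (absL (s ^~ x)) -sumEFin.
    rewrite ge0_integral_sum//; last 2 first.
    - by move=> w; apply/measurable_EFinP; apply: measurable_funM => //; exact: measurable_funTS.
    - by move=> w x _; rewrite lee_fin mulr_ge0//.
    apply: (@le_trans _ _ (\sum_(w <- L) (`|w.1| * V)%:E)).
      by apply: lee_sum => w _; exact: scaleS.
    by rewrite sumEFin lee_fin -(absL (fun=> V)) mulr_suml.
  have h2 : \int[lebesgue_Rd d]_(x in integration_domain X)
       (\sum_(0 <= j <oo) (`|diff_coef alpha (n0 + j)| * s (n0 + j)%N x)%:E) <=
      ((W - \sum_(w <- L) w.1) * V)%:E.
    rewrite integral_nneseries//; last 2 first.
    - by move=> j; apply/measurable_EFinP; apply: measurable_funM => //; exact: measurable_funTS.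
    - by move=> j x _; rewrite lee_fin.
    apply: (@le_trans _ _ (\sum_(0 <= j <oo) (`|diff_coef alpha (n0 + j)| * V)%:E)).
      apply: lee_nneseries => j _.
        by move=> _; apply: integral_ge0 => x _; rewrite lee_fin.
      exact: scaleS.
    apply: nneseries_le => [j|n]; first by rewrite mulr_ge0.
    rewrite -mulr_suml ler_wpM2r// lerBrDl; exact: LW.
  apply: le_trans (leeD h1 h2) _.
  by rewrite -EFinD lee_fin -mulrDl addrC subrK.
pose c := (Mu `^ p * W `^ (p - 1))%R.
have c0 : (0 <= c)%R by rewrite mulr_ge0 ?powR_ge0.
apply: (@le_trans _ _ (\int[lebesgue_Rd d]_(x in integration_domain X) (c%:E * Y x))).
  apply: ge0_le_integral_nonmeasurable => x _; first by rewrite lee_fin powR_ge0.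
  rewrite -[Y x]fineK// -EFinM lee_fin /c.
  have y0 : (0 <= fine (Y x))%R by exact: fine_ge0.
  have yW : (fine (Y x) <= W)%R by rewrite -lee_fin fineK.
  apply: (@le_trans _ _ ((Mu * fine (Y x)) `^ p)%R).
    by apply: ge0_ler_powR; rewrite ?nnegrE ?(ltW p0)// mulr_ge0.
  rewrite powRM// -mulrA ler_wpM2l ?powR_ge0//.
  rewrite -(mulr_powRB1 y0 p0) mulrC ler_wpM2r//.
  by apply: ge0_ler_powR; rewrite ?nnegrE ?subr_ge0.
rewrite ge0_integralZl_EFin//; last exact: measurable_funTS.
apply: le_trans (lee_wpmul2l _ iY) _; first by rewrite lee_fin.
rewrite -EFinM lee_fin /c powRM// -(mulr_powRB1 W0 p0).
by rewrite le_eqVlt; apply/orP; left; apply/eqP; ring.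
Qed.

End fractional_difference_bound.

(** * Scaled bumps on R^d and on the torus *)

Section bump_functions.
Context {R : realType}.
Implicit Types (X : domain) (d i j k m n : nat) (eps lambda : R).

Lemma sin_mean_value (y : R) : 0 <= y -> exists2 c, 0 <= c <= y & sin y = cos c * y.
Proof.
move=> y0; have [|c cy] := @MVT_segment R sin cos 0 y y0 (fun x _ => is_derive_sin x).
  by apply: continuous_subspaceT; exact: continuous_sin.
by rewrite sin0 !subr0 => ->; exists c => //; move: cy; rewrite in_itv.
Qed.

Lemma abs_sin_le (y : R) : `|sin y| <= `|y|.
Proof.
wlog y0 : y / 0 <= y.
  by move=> H; have [|/ltW y0] := leP 0 y; [exact: H|rewrite -normrN -sinN -[leRHS]normrN H ?oppr_ge0].
have [c _ ->] := sin_mean_value y0.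
by rewrite normrM ler_piMl// cos_max.
Qed.

Lemma pi_lt4 : pi < 4 :> R.
Proof. by have := @pihalf_lt2 R; lra. Qed.

(** Concavity of the sine would give the sharp constant 2.  Here the mean value theorem handles
    the range where the cosine is at least [1/2], and elsewhere the sine is large anyway. *)
Lemma sin_pi_lower_bound (s : R) : 0 <= s <= 1 / 2 -> s <= sin (pi * s).
Proof.
move=> /andP[s0 s1]; have p2 := @pi_ge2 R; have p0 := @pi_gt0 R.
have y0 : 0 <= pi * s by rewrite mulr_ge0// ltW.
have ypi : pi * s <= pi / 2 by rewrite ler_wpM2l ?(ltW p0)//; lra.
have [cy|cy] := leP (1 / 2) (cos (pi * s)).
  have [c /andP[c0 cys] ->] := sin_mean_value y0.
  have cc : cos (pi * s) <= cos c.
    rewrite leNgt ltr_cos ?in_itv/= -?leNgt//; apply/andP; split => //; lra.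
  apply: (@le_trans _ _ (1 / 2 * (pi * s))); last by rewrite ler_wpM2r// (le_trans cy).
  nra.
have c0 : 0 <= cos (pi * s) by apply: cos_ge0_pihalf; apply/andP; split; lra.
have s00 : 0 <= sin (pi * s) by apply: sin_ge0_pi; apply/andP; split => //; lra.
have := sin2cos2 (pi * s); nra.
Qed.

(** On the torus [sin (pi s)] replaces the coordinate: its square has period 1, it vanishes only
    at the integers, and all its differences along a line are explicit. *)
Definition profile_coord X (s : R) : R := if X is Torus then sin (pi * s) else s.

Definition bump_fun X d m eps lambda (x : Rd R d) : R :=
  lambda * bump_profile m (fun l : 'I_d => profile_coord X (tnth x l) / eps).

Definition bump_interval X eps : set (measurableTypeR R) :=
  [set s | `|profile_coord X s / eps| <= 1].

(** A product set that contains the support of the bump: one cube in the Euclidean case, a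
    neighbourhood of [Z^d] on the torus. *)
Definition bump_support X d eps : set (Rd R d) := box d (bump_interval X eps).
Arguments bump_support : clear implicits.

Lemma measurable_profile_coord X :
  measurable_fun setT (profile_coord X : measurableTypeR R -> R).
Proof.
case: X; first exact: measurable_id.
have ms : measurable_fun setT (@sin R).
  by apply: continuous_measurable_fun; exact: continuous_sin.
have mp : measurable_fun setT (fun s : measurableTypeR R => pi * s : R).
  exact: measurable_funM.
exact: (measurableT_comp ms mp).
Qed.

Lemma measurable_bump_interval X eps : measurable (bump_interval X eps).
Proof.
have mf : measurable_fun setT (fun s : measurableTypeR R => `|profile_coord X s / eps|).
  apply: measurableT_comp => //; apply: measurable_funM => //.
  exact: measurable_profile_coord.
rewrite -[bump_interval _ _]setTI.
have m1 : measurable_fun setT (fun s : measurableTypeR R => 1 : R) by exact: measurable_cst.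
exact: (measurable_fun_ler mf m1 measurableT (Y := [set true])).
Qed.

Lemma measurable_bump_support X d eps : measurable (bump_support X d eps).
Proof. by apply: measurable_box; exact: measurable_bump_interval. Qed.

Lemma measurable_bump X d m eps lambda : measurable_fun setT (@bump_fun X d m eps lambda).
Proof.
apply: measurable_funM => //; apply: measurable_funX; apply: measurable_maxr => //.
apply: measurable_funB => //; apply: measurable_sum => l; apply: measurable_funX.
apply: measurable_funM => //.
by apply: (measurableT_comp (@measurable_profile_coord X)); exact: measurable_tnth.
Qed.

Lemma sin_pi_shift (s : R) (k : int) :
  sin (pi * (s + k%:~R)) = sin (pi * s) \/ sin (pi * (s + k%:~R)) = - sin (pi * s).
Proof.
have nat_shift (n : nat) (t : R) : sin (pi * (t + n%:R)) = sin (pi * t) \/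
    sin (pi * (t + n%:R)) = - sin (pi * t).
  elim: n => [|n IH]; first by left; rewrite addr0.
  have -> : pi * (t + n.+1%:R) = pi * (t + n%:R) + pi by rewrite -natr1; ring.
  by rewrite sinDpi; case: IH => ->; [right|left; rewrite opprK].
case: k => n; first exact: nat_shift.
have := nat_shift n.+1 (s + (Negz n)%:~R).
rewrite NegzE mulrNz -addrA addNr addr0 => -[] ->; first by left.
by right; rewrite opprK.
Qed.

Lemma profile_coord_sqr_periodic (s : R) (k : int) eps :
  (profile_coord Torus (s + k%:~R) / eps) ^+ 2 = (profile_coord Torus s / eps) ^+ 2.
Proof. by rewrite /=; case: (sin_pi_shift s k) => ->; rewrite ?mulNr ?sqrrN. Qed.

Lemma periodic_on_bump X d m eps lambda : periodic_on X (@bump_fun X d m eps lambda).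
Proof.
case: X => //= k x; rewrite /bump_fun /bump_profile; congr (_ * Num.max _ (_ - _) ^+ _).
by apply: eq_bigr => l _; rewrite tnth_mktuple profile_coord_sqr_periodic.
Qed.

Lemma periodic_on_bump_support X d eps : periodic_on X (\1_(bump_support X d eps) : Rd R d -> R).
Proof.
case: X => //= k x; rewrite !indicE; congr (_%:R); congr nat_of_bool.
have e l : `|profile_coord Torus (tnth x l + (k l)%:~R) / eps| =
    `|profile_coord Torus (tnth x l) / eps|.
  by apply/eqP; rewrite -(@eqrXn2 _ 2)// !real_normK ?num_real// profile_coord_sqr_periodic.
by apply/idP/idP; rewrite !inE => H l; have := H l; rewrite /bump_interval /= tnth_mktuple e.
Qed.

Lemma bump_profile_ge0 (I : finType) m (v : I -> R) : 0 <= bump_profile m v.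
Proof. by rewrite exprn_ge0// le_max lexx. Qed.

Lemma bump_profile_le1 (I : finType) m (v : I -> R) : bump_profile m v <= 1.
Proof.
rewrite exprn_ile1 ?le_max ?lexx// ge_max ler01/= lerBlDr lerDl sumr_ge0// => l _.
exact: sqr_ge0.
Qed.

Lemma bump_support_forall X d eps (x : Rd R d) :
  (\1_(bump_support X d eps) x : R) = [forall l, `|profile_coord X (tnth x l) / eps| <= 1]%:R.
Proof.
rewrite indicE; congr (_%:R); congr nat_of_bool; apply/idP/forallP; rewrite inE.
  by move=> H l; exact: H.
by move=> H l; exact: H.
Qed.

Lemma bump_le X d m eps lambda (x : Rd R d) : (0 < m)%N -> 0 <= lambda ->
  `|@bump_fun X d m eps lambda x| <= lambda * \1_(bump_support X d eps) x.
Proof.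
move=> m0 l0; rewrite /bump_fun normrM ger0_norm// ler_wpM2l//.
rewrite (ger0_norm (bump_profile_ge0 _ _)) bump_support_forall.
case: forallP => [_|/existsNP[l /negP]]; first exact: bump_profile_le1.
by rewrite -ltNge => vl; rewrite (bump_profile_eq0 m0 vl).
Qed.

(** Each difference multiplies by [2 sin (eta/2)] and advances the phase by
    [(eta + pi)/2]. *)
Lemma sin_diff (th eta : R) a j :
  iter a seq_diff (fun j => sin (th + j%:R * eta)) j =
  (2 * sin (eta / 2)) ^+ a * sin (th + j%:R * eta + a%:R * (eta / 2 + pi / 2)).
Proof.
elim: a th j => [|a IH] th j; first by rewrite expr0 mul1r mul0r addr0.
rewrite iterSr (_ : seq_diff _ = fun j => (2 * sin (eta / 2)) *
    sin ((th + eta / 2 + pi / 2) + j%:R * eta)).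
  rewrite seq_diffZ IH mulrA -exprS; congr (_ * sin _).
  by rewrite -natr1; ring.
apply/funext => n; rewrite /seq_diff.
pose u := th + n%:R * eta + eta / 2.
have -> : th + n.+1%:R * eta = u + eta / 2 by rewrite /u -natr1; field.
have -> : th + n%:R * eta = u - eta / 2 by rewrite /u; field.
have -> : th + eta / 2 + pi / 2 + n%:R * eta = u + pi / 2 by rewrite /u; ring.
by rewrite sinDpihalf sinD sinB; ring.
Qed.

Lemma affine_diff (b c : R) a j : (1 < a)%N ->
  iter a seq_diff (fun j => b + j%:R * c) j = 0.
Proof.
case: a => [//|[//|a]] _; rewrite iterSr (_ : seq_diff _ = fun=> c); last first.
  by apply/funext => n; rewrite /seq_diff -natr1; ring.
rewrite iterSr (_ : seq_diff _ = fun=> 0); last first.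
  by apply/funext => n; rewrite /seq_diff subrr.
have := @seq_diff_le R (fun=> 0) a j 0; rewrite mulr0 normr0 => /(_ (fun _ _ => lexx _)).
by rewrite normr_le0 => /eqP.
Qed.

(** Along a line the normalised coordinates behave like samples with spacing [4 t / eps]. *)
Lemma profile_diff X eps (b c t : R) a j : 0 < eps -> (X = Torus -> eps <= 1) ->
  `|c| <= t -> (0 < a)%N ->
  `|iter a seq_diff (fun j => profile_coord X (b + j%:R * c) / eps) j| <= (4 * t / eps) ^+ a.
Proof.
move=> e0 Xe ct a0; have t0 : 0 <= t by exact: le_trans ct.
have -> : (fun j => profile_coord X (b + j%:R * c) / eps) =
   (fun j => eps^-1 * profile_coord X (b + j%:R * c)) by apply/funext => n; rewrite mulrC.
rewrite seq_diffZ normrM (gtr0_norm (_ : 0 < eps^-1)) ?invr_gt0//.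
case: X Xe => [_|/(_ erefl) e1].
  case: a a0 => [//|[_|a _]].
    rewrite /= /seq_diff expr1 -natr1.
    have -> : b + (j%:R + 1) * c - (b + j%:R * c) = c by ring.
    by rewrite mulrC ler_wpM2r ?invr_ge0 ?(ltW e0)//; lra.
  rewrite affine_diff// normr0 mulr0 exprn_ge0// divr_ge0 ?(ltW e0)//.
  by rewrite mulr_ge0.
have -> : (fun j => profile_coord Torus (b + j%:R * c)) =
   (fun j => sin (pi * b + j%:R * (pi * c))).
  by apply/funext => n /=; congr sin; ring.
rewrite sin_diff normrM normrX.
have s1 : `|2 * sin (pi * c / 2)| <= 4 * t.
  rewrite normrM ger0_norm//.
  apply: (@le_trans _ _ (2 * `|pi * c / 2|)); first by rewrite ler_wpM2l// abs_sin_le.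
  rewrite !normrM (ger0_norm (@pi_ge0 R)) (ger0_norm (_ : 0 <= 2^-1)) ?invr_ge0//.
  have -> : 2 * (pi * `|c| / 2) = pi * `|c| by field.
  by rewrite ler_pM ?pi_ge0 ?(ltW pi_lt4).
rewrite exprMn mulrC; apply: ler_pM.
- by rewrite mulr_ge0 ?exprn_ge0.
- by rewrite invr_ge0 ltW.
- apply: (@le_trans _ _ (`|2 * sin (pi * c / 2)| ^+ a)).
    by rewrite ler_piMr ?exprn_ge0// sin_max.
  by rewrite lerXn2r ?nnegrE ?mulr_ge0.
- rewrite exprVn lef_pV2 ?posrE ?exprn_gt0//.
  by case: (a) a0 => // n _; rewrite exprS ler_piMr ?(ltW e0)// exprn_ile1// ltW.
Qed.

End bump_functions.

Arguments bump_support {R} X d eps.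

(** * Norms and moduli of smoothness of bumps *)

Section bump_norms.
Context {R : realType}.
Local Open Scope ereal_scope.
Local Notation leb := (@lebesgue_measure R).
Implicit Types (X : domain) (d i j k m n : nat) (eps lambda : R).

Lemma integral_box_indic X d (B : set (measurableTypeR R)) : measurable B ->
  \int[lebesgue_Rd d]_(x in integration_domain X) (\1_(box d B) x)%:E =
  leb (B `&` domain1 X) ^+ d.
Proof.
move=> mB; rewrite integral_indic; last 2 first.
- exact: measurable_integration_domain.
- exact: measurable_box.
rewrite integration_domainE -lebesgue_Rd_box; last first.
  by apply: measurableI => //; exact: measurable_domain1.
by congr (lebesgue_Rd d _); apply/seteqP; split => x;
  [move=> [H1 H2] i; split; [exact: H1|exact: H2]|move=> H; split=> i; have [] := H i].
Qed.

Lemma bump_interval_measure X eps : (0 < eps)%R ->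
  leb (bump_interval X eps `&` domain1 X) <= (2 * eps)%:E.
Proof.
move=> e0; have m1 := measurable_domain1 (R := R) X.
have mI := measurableI _ _ (measurable_bump_interval X eps) m1.
have lebc (a b : R) : (a <= b)%R -> leb `[a, b] = (b - a)%:E.
  move=> ab; rewrite lebesgue_measure_itv/= lte_fin; case: ltP => [//|ba].
  by rewrite (@le_anti _ _ a b) ?ab// subrr.
have absE s : bump_interval X eps s -> (`|profile_coord X s| <= eps)%R.
  by rewrite /bump_interval /= normrM normfV (gtr0_norm e0) ler_pdivrMr// mul1r.
case: X m1 mI absE => /= m1 mI absE.
  apply: (@le_trans _ _ (leb `[(- eps)%R, eps])).
    apply: le_measure; rewrite ?inE//.
    by move=> s [/absE + _]; rewrite /= ler_norml in_itv.
  by rewrite lebc ?lee_fin; lra.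
apply: (@le_trans _ _ (leb (`[0%R, eps] `|` `[(1 - eps)%R, 1%R]))).
  apply: le_measure; rewrite ?inE//; first by apply: measurableU; exact: measurable_itv.
  move=> s [/absE se]; rewrite /= in_itv/= => /andP[s0 s1].
  have [s2|s2] := leP s (1 / 2)%R; [left|right]; rewrite /= in_itv/=; apply/andP; split => //.
  - apply: le_trans se; apply: le_trans (ler_norm _); apply: sin_pi_lower_bound.
    by rewrite s0.
  - have : (1 - s <= sin (pi * (1 - s)))%R.
      by apply: sin_pi_lower_bound; apply/andP; split; lra.
    have -> : (pi * (1 - s) = pi - pi * s)%R by ring.
    rewrite sinB sinpi cospi mul0r sub0r mulN1r opprK => /le_trans H.
    by have := H _ (le_trans (ler_norm _) se); lra.
  - exact: ltW.
apply: (@le_trans _ _ (leb `[0%R, eps] + leb `[(1 - eps)%R, 1%R])).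
  by apply: measureU2; exact: measurable_itv.
by rewrite !lebc ?(ltW e0) ?gerBl ?(ltW e0)// -EFinD lee_fin; lra.
Qed.

Lemma expe_le (x : \bar R) (y : R) n : 0 <= x -> x <= y%:E -> x ^+ n <= (y ^+ n)%:E.
Proof.
move=> x0 xy; elim: n => [|n IH]; first by rewrite expr0.
rewrite expeS exprS EFinM; apply: lee_pmul => //.
by rewrite expe_ge0.
Qed.

Lemma bump_support_measure X d eps : (0 < eps)%R ->
  \int[lebesgue_Rd d]_(x in integration_domain X) (\1_(bump_support X d eps) x)%:E <=
  ((2 * eps) ^+ d)%:E.
Proof.
move=> e0; rewrite integral_box_indic; last exact: measurable_bump_interval.
by apply: expe_le => //; exact: bump_interval_measure.
Qed.

(** On the small cube of side [eps/(8d)] the sum of squares is at most [1/2], so that the profile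
    is at least [2^-m]. *)
Lemma bump_power_lower X d m eps lambda (r : R) : (0 < d)%N -> (0 < eps)%R ->
  (X = Torus -> eps <= 1)%R -> (0 <= lambda)%R -> (0 < r)%R ->
  ((lambda / 2 ^+ m) `^ r * (eps / (8 * d%:R)) ^+ d)%:E <=
  power_integral X r (@bump_fun R X d m eps lambda).
Proof.
move=> d0 e0 Xe l0 r0.
have dR1 : (1 <= d%:R :> R)%R by rewrite ler1n.
have dR0 : (0 < d%:R :> R)%R by rewrite ltr0n.
set tau := (eps / (8 * d%:R))%R.
have tau0 : (0 < tau)%R by rewrite divr_gt0// mulr_gt0.
have taue : (tau * (8 * d%:R) = eps)%R by rewrite /tau divfK// gt_eqF// mulr_gt0.
rewrite -integral_cst_box// /power_integral integral_mkcond [leRHS]integral_mkcond.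
apply: ge0_le_integral_nonmeasurable => x _; rewrite /patch.
  by case: ifPn => // _; rewrite lee_fin powR_ge0.
case: ifPn => [/[!inE] Qx|_]; last first.
  by case: ifPn => // _; rewrite lee_fin powR_ge0.
have Qi (i : 'I_d) : (0 <= tnth x i < tau)%R by have := Qx i; rewrite /= in_itv.
rewrite ifT; last first.
  rewrite inE; case: (X) Xe => // /(_ erefl) e1 i /=; have /andP[-> /= it] := Qi i.
  by apply: lt_le_trans it _; nra.
rewrite lee_fin; apply: ge0_ler_powR; rewrite ?nnegrE ?(ltW r0)//.
  by rewrite divr_ge0 ?exprn_ge0.
rewrite /bump_fun normrM (ger0_norm l0) ler_wpM2l// ger0_norm ?bump_profile_ge0//.
rewrite -exprVn /bump_profile lerXn2r ?nnegrE ?invr_ge0 ?le_max ?lexx//; apply/orP; right.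
have coord (i : 'I_d) : ((profile_coord X (tnth x i) / eps) ^+ 2 <= (d%:R * 2)^-1)%R.
  have /andP[x0 xt] := Qi i.
  have pc : (`|profile_coord X (tnth x i)| <= 4 * tau)%R.
    case: (X) => /=; first by rewrite ger0_norm//; lra.
    apply: le_trans (abs_sin_le _) _; rewrite normrM (ger0_norm (@pi_ge0 R)) ger0_norm//.
    by rewrite ler_pM ?pi_ge0 ?(ltW pi_lt4) ?(ltW xt).
  have : (`|profile_coord X (tnth x i) / eps| <= (2 * d%:R)^-1)%R.
    rewrite normrM normfV (gtr0_norm e0) ler_pdivrMr//; apply: le_trans pc _.
    by rewrite -taue le_eqVlt; apply/orP; left; apply/eqP; field; rewrite gt_eqF.
  move=> H; rewrite -real_normK ?num_real//.
  apply: (@le_trans _ _ ((2 * d%:R)^-1 ^+ 2)%R).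
    by rewrite lerXn2r ?nnegrE ?invr_ge0 ?mulr_ge0.
  rewrite exprVn lef_pV2 ?posrE ?exprn_gt0 ?mulr_gt0//; nra.
have : (\sum_(l < d) (profile_coord X (tnth x l) / eps) ^+ 2 <=
    \sum_(l < d) (d%:R * 2)^-1)%R by apply: ler_sum => l _; exact: coord.
rewrite sumr_const card_ord -[X in (_ <= X)%R -> _]mulr_natl invfM mulrA divff ?gt_eqF// mul1r.
by lra.
Qed.

(** For steps that are short against [eps], the head of the fractional difference is bounded by
    summation by parts and the tail by the decay of the coefficients, with the cut at
    [N ~ 1/delta]; for long steps the boundedness of the difference operator suffices.  Both cases
    lose only the factor [2 eps] to the power [d/p] from the size of the support. *)
Lemma bump_modulus X d (alpha p : R) : (0 < d)%N -> (0 < alpha)%R -> (1 <= p)%R ->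
  exists m, (0 < m)%N /\ exists2 C : R, (0 < C)%R & forall eps lambda t, (0 < eps)%R ->
  (X = Torus -> eps <= 1)%R -> (0 <= lambda)%R -> (0 < t)%R ->
  modulus X alpha (@bump_fun R X d m eps lambda) t p <=
  (lambda * (C * eps `^ (d%:R / p) * Num.min 1 (t / eps) `^ alpha))%:E.
Proof.
move=> d0 al0 p1; have p0 : (0 < p)%R by exact: lt_le_trans p1.
pose m := (Num.truncn alpha).+1.
have alm : (alpha <= m%:R)%R by exact/ltW/truncnS_gt.
have m0 : (0 < m)%N by [].
have [M M0 HM] := @bump_diff_bound R d m m0.
have [C1 C10 HC1] := abel_weights alm.
have [D D0 HD] := sum_abs_diff_coef_tail al0.
have [A A0 HA] := sum_abs_diff_coef al0.
pose B := (C1 + D * 2 `^ `|alpha| + A)%R.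
have D20 : (0 < D * 2 `^ `|alpha|)%R by rewrite mulr_gt0 ?powR_gt0.
have B0 : (0 < B)%R by rewrite !addr_gt0.
pose C := ((M + 1) * B * 4 `^ alpha * 2 `^ (d%:R / p))%R.
have C0 : (0 < C)%R by rewrite !mulr_gt0 ?powR_gt0 ?addr_gt0.
exists m; split => //; exists C => // eps lambda t e0 Xe l0 t0.
apply: ge_ereal_sup => _ [h /= ht <-].
pose delta := (4 * t / eps)%R.
have delta0 : (0 < delta)%R by rewrite divr_gt0// mulr_gt0.
have mu0 : (0 <= lambda * (M + 1))%R by rewrite mulr_ge0// addr_ge0// ltW.
pose f := @bump_fun R X d m eps lambda.
pose S := bump_support X d eps.
have fS x : (`|f x| <= lambda * (M + 1) * \1_S x)%R.
  apply: le_trans (bump_le _ _ _ m0 l0) _; rewrite -mulrA ler_wpM2l//.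
  by rewrite ler_peMl// lerDr ltW.
suff [W W0 HW] : exists2 W : R, (0 <= W <= B * 4 `^ alpha * Num.min 1 (t / eps) `^ alpha)%R &
    power_integral X p (fdiff alpha h f) <= ((lambda * (M + 1) * W) `^ p * (2 * eps) ^+ d)%:E.
  case/andP: W0 => W0 WB.
  have rhs0 : (0 <= lambda * (C * eps `^ (d%:R / p) * Num.min 1 (t / eps) `^ alpha))%R.
    apply: mulr_ge0 => //; apply: mulr_ge0; last exact: powR_ge0.
    by apply: mulr_ge0; [exact: ltW|exact: powR_ge0].
  rewrite Lp_norm_leP//; apply: le_trans HW _; rewrite lee_fin.
  have -> : ((2 * eps) ^+ d = (2 `^ (d%:R / p) * eps `^ (d%:R / p)) `^ p)%R.
    rewrite -powRM ?(ltW e0)// -powRrM divfK ?gt_eqF// powR_mulrn// mulr_ge0// ltW//.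
  have lW0 : (0 <= lambda * (M + 1) * W)%R by exact: mulr_ge0.
  have e20 : (0 <= 2 `^ (d%:R / p) * eps `^ (d%:R / p))%R.
    by apply: mulr_ge0; exact: powR_ge0.
  rewrite -(powRM _ lW0 e20).
  apply: ge0_ler_powR; rewrite ?nnegrE ?(ltW p0)//.
    by rewrite !mulr_ge0 ?powR_ge0// addr_ge0// ltW.
  rewrite -!mulrA ler_wpM2l//.
  apply: (@le_trans _ _ ((M + 1) * ((B * 4 `^ alpha * Num.min 1 (t / eps) `^ alpha) *
      (2 `^ (d%:R / p) * eps `^ (d%:R / p))))%R).
    rewrite ler_wpM2l ?addr_ge0 ?(ltW M0)// ler_wpM2r ?mulr_ge0 ?powR_ge0//.
  by rewrite le_eqVlt; apply/orP; left; apply/eqP; rewrite /C; ring.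
have mS : measurable S by exact: measurable_bump_support.
have pS := @periodic_on_bump_support R X d eps.
have VS := bump_support_measure X d e0.
have [d1|d1] := leP delta 1%R.
  pose N := Num.truncn delta^-1.
  have N1 : (1 <= delta * N.+1%:R)%R.
    by rewrite mulrC -ler_pdivrMr// div1r ltW// truncnS_gt.
  have N2 : (delta * N.+1%:R <= 2)%R.
    have : (delta * N%:R <= 1)%R.
      by rewrite mulrC -ler_pdivlMr// div1r truncn_le// invr_ge0 ltW.
    rewrite -natr1 mulrDr mulr1; lra.
  have N12 : (1 <= delta * N.+1%:R <= 2)%R by rewrite N1.
  have [L [L0 LC HL]] := HC1 N delta delta0 N12.
  exists ((C1 + D * 2 `^ `|alpha|) * delta `^ alpha)%R.
    apply/andP; split; first by rewrite mulr_ge0 ?powR_ge0// addr_ge0 ?(ltW C10) ?(ltW D20).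
    have te : (t / eps <= 1)%R by apply: le_trans d1; rewrite /delta -mulrA ler_peMl ?ler1n// divr_ge0 ?ltW.
    rewrite (min_idPr te) /delta -(mulrA 4%R) powRM ?divr_ge0 ?(ltW t0) ?(ltW e0)// mulrA.
    by rewrite ler_wpM2r ?powR_ge0// ler_wpM2r ?powR_ge0// lerDl ltW.
  apply: (@fdiff_power_bound R X d alpha p (lambda * (M + 1)) _ _ A f h S N.+1 L) => //.
  - by rewrite mulr_ge0 ?powR_ge0// addr_ge0 ?(ltW C10) ?(ltW D20).
  - move=> n; rewrite mulrDl; apply: lerD => //.
    apply: (@le_trans _ _ (D * N.+1%:R `^ (- alpha))%R); last first.
      by rewrite -mulrA ler_wpM2l ?(ltW D0)// powR_scale_le.
    apply: le_trans (HD N (n + N.+1)%N); rewrite -{2}[N.+1]add0n big_addn addnK.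
    by apply: ler_sum => j _; rewrite addnC.
  move=> x; pose u j := f (translate x (alpha - j%:R) h).
  apply: (HL u (fun j => \1_S (translate x (alpha - j%:R) h))) => // i j im.
  pose v (l : 'I_d) n := (profile_coord X (tnth (translate x (alpha - n%:R) h) l) / eps)%R.
  have -> : iter i seq_diff u j =
      (lambda * iter i seq_diff (fun n => bump_profile m (v ^~ n)) j)%R.
    by rewrite -seq_diffZ.
  rewrite normrM (ger0_norm l0) -!mulrA ler_wpM2l//.
  have vd l a n : (0 < a)%N -> (`|iter a seq_diff (v l) n| <= delta ^+ a)%R.
    move=> a0.
    have -> : v l = fun n => (profile_coord X ((tnth x l + alpha * tnth h l) +
        n%:R * - tnth h l) / eps)%R.
      by apply/funext => n'; rewrite /v tnth_mktuple; congr (profile_coord _ _ / _)%R; ring.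
    apply: profile_diff => //; rewrite normrN; apply: le_trans ht.
    rewrite /euclidean_norm -sqrtr_sqr ler_sqrt ?sumr_ge0// => [|? _]; last exact: sqr_ge0.
    by rewrite (bigD1 l)//= lerDl sumr_ge0// => ? _; exact: sqr_ge0.
  have := HM v delta i j; rewrite (ltW delta0) d1 => /(_ isT im vd) H.
  apply: le_trans H _; rewrite -mulrA; apply: ler_pM.
  - exact: ltW.
  - by rewrite mulr_ge0 ?exprn_ge0 ?(ltW delta0)// sumr_ge0.
  - by rewrite lerDl.
  - rewrite ler_wpM2l ?exprn_ge0 ?(ltW delta0)//; apply: ler_sum => n _.
    by rewrite bump_support_forall.
exists A.
  rewrite (ltW A0) /=; apply: (@le_trans _ _ (B * 1)%R).
    by rewrite mulr1 /B lerDr addr_ge0 ?(ltW C10) ?(ltW D20).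
  rewrite -mulrA ler_wpM2l ?(ltW B0)// -powRM//; last first.
    by rewrite le_min ler01 divr_ge0 ?ltW.
  apply: (@le_trans _ _ (1 `^ alpha)%R); first by rewrite powR1.
  have b1 : (1 <= 4 * Num.min 1 (t / eps))%R.
    have d1' : (1 <= 4 * (t / eps))%R by rewrite mulrA; exact: ltW.
    by have [u1|u1] := leP 1%R (t / eps)%R; [rewrite mulr1 ler1n|exact: d1'].
  by apply: ge0_ler_powR; rewrite ?nnegrE ?(ltW al0)// (le_trans ler01).
apply: (@fdiff_power_bound R X d alpha p (lambda * (M + 1)) A _ A f h S 0%N [::]) => //.
- exact: ltW.
- by move=> n; rewrite big_nil add0r.
- by move=> x; rewrite big_geq// big_nil normr0 mulr0.
Qed.

End bump_norms.

(** * Integrals of the logarithmic weight *)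

Section logarithmic_weight.
Context {R : realType}.
Local Open Scope ereal_scope.
Local Notation leb := (@lebesgue_measure R).
Implicit Types (j k n : nat) (g x t : R).

Lemma measurable_inv_pos (D : set (measurableTypeR R)) : measurable D -> D `<=` `]0%R, +oo[ ->
  measurable_fun D (fun t : measurableTypeR R => t^-1 : R)%R.
Proof.
move=> mD D0; apply: (eq_measurable_fun (fun t : measurableTypeR R => t `^ (-1) : R)%R).
  move=> t /[!inE] /D0 /=; rewrite in_itv/= andbT => t0.
  by rewrite powR_inv1// ltW.
by apply: measurable_funTS; exact: measurable_powR.
Qed.

(** Each of [n] intervals with endpoint ratio [exp 1] contributes at most its length divided by
    its left endpoint; the sharp contribution is 1, but a constant is immaterial. *)
Lemma integral_inv_le x n : (0 < x)%R ->
  \int[leb]_(t in `[(x * expR (- n%:R))%R, x[) (t^-1)%:E <= (n%:R * (expR 1 - 1))%:E.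
Proof.
move=> x0; elim: n => [|n IH]; first by rewrite oppr0 expR0 mulr1 set_itvco0 integral_set0 mul0r.
pose y := (x * expR (- n%:R))%R; pose z := (x * expR (- n.+1%:R))%R.
have y0 : (0 < y)%R by rewrite mulr_gt0 ?expR_gt0.
have z0 : (0 < z)%R by rewrite mulr_gt0 ?expR_gt0.
have yz : (y = z * expR 1)%R.
  by rewrite /y /z -mulrA -expRD -natr1; congr (_ * expR _)%R; ring.
have zy : (z <= y)%R by rewrite yz ler_peMr ?(ltW z0)// -[leLHS]expR0 ler_expR.
have yx : (y <= x)%R by rewrite /y ler_piMr ?(ltW x0)// expR_le1 oppr_le0.
have minv (a c : R) : (0 < a)%R -> measurable_fun `[a, c[ (fun t : measurableTypeR R => (t^-1)%:E).
  move=> a0; apply/measurable_EFinP; apply: measurable_inv_pos => // t /=.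
  by rewrite !in_itv/= andbT => /andP[at_ _]; exact: lt_le_trans at_.
rewrite -/z (_ : [set` `[z, x[] = `[z, y[ `|` `[y, x[); last first.
  by rewrite -itv_bndbnd_setU//= bnd_simp.
have zyx : `[z, y[ `|` `[y, x[ = `[z, x[%classic.
  by rewrite -itv_bndbnd_setU//= bnd_simp.
rewrite ge0_integral_setU//=; last 3 first.
- by rewrite zyx; exact: minv.
- move=> t; rewrite !in_itv/= => tzyx.
  have zt : (z <= t)%R by case: tzyx => /andP[+ _] => //; exact: le_trans.
  by rewrite lee_fin invr_ge0 (le_trans (ltW z0)).
- rewrite disj_set_sym; apply/disj_setPLR => t /=; rewrite !in_itv/= => /andP[yt _].
  by rewrite ltNge yt andbF.
rewrite -natr1 mulrDl mul1r EFinD addeC; apply: leeD => //.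
apply: (@le_trans _ _ (\int[leb]_(t in `[z, y[) (z^-1)%:E)).
  apply: ge0_le_integral_nonmeasurable => t /=; rewrite in_itv/= => /andP[zt _].
    by rewrite lee_fin invr_ge0 (le_trans (ltW z0)).
  by rewrite lee_fin lef_pV2 ?posrE// (lt_le_trans z0).
rewrite integral_cst//= lebesgue_measure_itv/= lte_fin.
case: ifPn => [_|_]; last by rewrite mule0 lee_fin subr_ge0 -[leLHS]expR0 ler_expR.
by rewrite -EFinB -EFinM lee_fin yz le_eqVlt; apply/orP; left; apply/eqP; field; rewrite gt_eqF.
Qed.

Definition log_weight g t : R := ((1 - ln t) `^ (- g) * t^-1)%R.

Lemma log_weight_ge0 g t : (0 < t)%R -> (0 <= log_weight g t)%R.
Proof. by move=> t0; rewrite mulr_ge0 ?powR_ge0// invr_ge0 ltW. Qed.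

Lemma measurable_log_weight g (D : set (measurableTypeR R)) :
  measurable D -> D `<=` `]0%R, +oo[ ->
  measurable_fun D (fun t : measurableTypeR R => log_weight g t : R).
Proof.
move=> mD D0; apply: measurable_funM; last exact: measurable_inv_pos.
apply: measurable_funTS.
have ml : measurable_fun setT (fun t : measurableTypeR R => 1 - ln t : R)%R.
  by apply: measurable_funB => //; exact: measurable_ln.
exact: (measurableT_comp (measurable_powR (- g)) ml).
Qed.

(** Points at which [1 - ln t] runs through the powers of 2. *)
Definition log_node k : R := expR (1 - 2 ^+ k).

Lemma log_node_gt0 k : (0 < log_node k)%R. Proof. exact: expR_gt0. Qed.

(** In the variable [u = 1 - ln t] the integrand is [u^-g], and dyadic intervals of [u] contribute
    a geometric series.  The decay in [k] is the logarithmic gain near [t = 0]. *)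
Lemma integral_log_weight g : (1 < g)%R ->
  exists C rho : R, [/\ (0 < C)%R, (0 < rho < 1)%R & forall k,
    \int[leb]_(t in `]0%R, log_node k[) (log_weight g t)%:E <= (C * rho ^+ k)%:E].
Proof.
move=> g1; pose rho := (2 `^ (1 - g) : R)%R.
have rho0 : (0 < rho)%R by rewrite powR_gt0.
have rho1 : (rho < 1)%R.
  rewrite /rho /powR pnatr_eq0 /= expR_lt1 nmulr_rlt0 ?subr_lt0//.
  by rewrite ln_gt0// ltr1n.
have e1 : (0 < expR 1 - 1 :> R)%R by rewrite subr_gt0 expR_gt1.
exists ((expR 1 - 1) / (1 - rho))%R, rho; split; first by rewrite divr_gt0// subr_gt0.
  by rewrite rho0.
move=> k.
pose I j := `[log_node (k + j).+1, log_node (k + j)[%classic.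
have mI j : measurable (I j : set (measurableTypeR R)) by exact: measurable_itv.
pose c j := ((2 ^+ (k + j)) `^ (- g) : R)%R.
have c0 j : (0 <= c j)%R by exact: powR_ge0.
have mterm j : measurable_fun setT
    ((fun t : measurableTypeR R => ((t^-1)%:E : \bar R)) \_ (I j)).
  have mj : measurable_fun (I j) (fun t : measurableTypeR R => (t^-1)%:E).
    apply/measurable_EFinP; apply: measurable_inv_pos => // t.
    rewrite /I /= !in_itv/= andbT => /andP[+ _].
    exact: lt_le_trans (log_node_gt0 _).
  exact: ((measurable_restrictT _ (mI j)).1 mj).
have term0 j t : 0 <= ((fun t : measurableTypeR R => ((t^-1)%:E : \bar R)) \_ (I j)) t.
  rewrite /patch; case: ifPn => // /[!inE]; rewrite /I /= in_itv/= => /andP[+ _].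
  by move=> /(lt_le_trans (log_node_gt0 _)) t0; rewrite lee_fin invr_ge0 ltW.
apply: (@le_trans _ _ (\int[leb]_t (\sum_(0 <= j <oo)
    (c j)%:E * ((fun t : measurableTypeR R => (t^-1)%:E) \_ (I j)) t))).
  rewrite integral_mkcond; apply: ge0_le_integral_nonmeasurable => t _.
    rewrite /patch; case: ifPn => // /[!inE] /=; rewrite in_itv/= => /andP[t0 _].
    by rewrite lee_fin log_weight_ge0.
  have ser0 j : 0 <= (c j)%:E * ((fun t : measurableTypeR R => (t^-1)%:E) \_ (I j)) t.
    by apply: mule_ge0; [rewrite lee_fin|exact: term0].
  rewrite [X in X <= _]/patch; case: ifPn => [|_]; last first.
    by apply: nneseries_ge0 => j _ _.
  rewrite inE /= in_itv/= => /andP[t0 tk].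
  have ylt : (2 ^+ k < 1 - ln t)%R.
    have : (ln t < ln (log_node k))%R by rewrite ltr_ln ?posrE ?log_node_gt0.
    by rewrite /log_node expRK; lra.
  have k20 : (0 < 2 ^+ k :> R)%R by rewrite exprn_gt0.
  have [j] := dyadic_level k20 ylt.
  rewrite -!exprD addSn !(addnC j) => /andP[jy yj].
  have y0 : (0 < 1 - ln t)%R by exact: lt_trans ylt.
  have tI : t \in I j.
    rewrite inE /I /= in_itv/=; apply/andP; split.
      by rewrite -[leRHS]lnK ?posrE// /log_node ler_expR; lra.
    by rewrite -[ltLHS]lnK ?posrE// /log_node ltr_expR; lra.
  apply: (@le_trans _ _ ((c j)%:E * ((fun t : measurableTypeR R => (t^-1)%:E) \_ (I j)) t)).
    rewrite /patch tI -EFinM lee_fin /log_weight ler_wpM2r ?invr_ge0 ?(ltW t0)//.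
    rewrite /c !powRN lef_pV2 ?posrE ?powR_gt0 ?exprn_gt0//.
    by rewrite ge0_ler_powR ?nnegrE ?exprn_ge0 ?(ltW y0) ?(ltW jy)// ltW// (lt_trans ltr01).
  apply: (@le_trans _ _ (\sum_(0 <= i < j.+1)
     (c i)%:E * ((fun t : measurableTypeR R => (t^-1)%:E) \_ (I i)) t)); last first.
    by apply: nneseries_lim_ge => i _.
  rewrite big_nat_recr//= -[leLHS]add0e leeD//.
  by apply: sume_ge0 => i _.
rewrite integral_nneseries//; last 2 first.
- by move=> j; apply: emeasurable_funM; [exact: measurable_cst|exact: mterm].
- by move=> j t _; apply: mule_ge0; [rewrite lee_fin|exact: term0].
apply: (@le_trans _ _ (\sum_(0 <= j <oo) ((expR 1 - 1) * rho ^+ k * rho ^+ j)%:E)).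
  apply: lee_nneseries => j _; first move=> _.
    by apply: integral_ge0 => t _; apply: mule_ge0; [rewrite lee_fin|exact: term0].
  rewrite ge0_integralZl_EFin//; last exact: mterm.
  rewrite -integral_mkcond.
  have lnE : (log_node (k + j).+1 = log_node (k + j) * expR (- (2 ^ (k + j))%:R))%R.
    by rewrite /log_node -expRD; congr expR; rewrite natrX exprS; ring.
  rewrite /I lnE.
  apply: (@le_trans _ _ ((c j)%:E * ((2 ^ (k + j))%:R * (expR 1 - 1))%:E)).
    by apply: lee_wpmul2l; [rewrite lee_fin|apply: integral_inv_le; exact: log_node_gt0].
  rewrite -EFinM lee_fin le_eqVlt; apply/orP; left; apply/eqP.
  rewrite -mulrA -exprD mulrA mulrC; congr (_ * _)%R.
  rewrite /c natrX /rho -[RHS]powR_mulrn ?powR_ge0// powRAC powR_mulrn//.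
  rewrite powRD; last by rewrite (gt_eqF (exprn_gt0 _ _)) ?implybT.
  by rewrite powRr1 ?exprn_ge0// mulrC.
apply: nneseries_le => [j|n].
  by rewrite !mulr_ge0 ?exprn_ge0 ?(ltW e1) ?(ltW rho0).
rewrite -mulr_sumr [leRHS]mulrAC ler_wpM2l//.
  by rewrite !mulr_ge0 ?exprn_ge0 ?(ltW e1) ?(ltW rho0).
by rewrite geometric_sum_le// rho1 ltW.
Qed.

End logarithmic_weight.

(** * The logarithmic gain for bumps *)

Section weighted_norms.
Context {R : realType}.
Local Open Scope ereal_scope.
Implicit Types (alpha b c eps eta t : R) (q : \bar R).

(** The seminorm of [Lip_norm] as a functional of the weighted modulus. *)
Definition weighted_norm q (F : R -> \bar R) : \bar R :=
  if q is r%:E then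
    (\int[lebesgue_measure]_(t in `]0%R, 1%R[) (F t `^ r * t^-1%:E)) `^ r^-1
  else ereal_sup [set F t | t in `]0%R, 1%R[].

Lemma Lip_normE X d alpha b p q (f : Rd R d -> R) :
  Lip_norm X alpha b p q f =
  Lp_norm X p f + weighted_norm q (Lip_weighted X alpha b p f).
Proof. by []. Qed.

(** The weighted modulus of a bump of width [eps] is at most a multiple of [eps^(d/p - alpha)] times
    this function. *)
Definition bump_weight alpha b eps t : R :=
  ((1 - ln t) `^ (- b) * Num.min 1 (eps / t) `^ alpha)%R.

Lemma bump_weight_ge0 alpha b eps t : (0 <= bump_weight alpha b eps t)%R.
Proof. by rewrite mulr_ge0 ?powR_ge0. Qed.

Lemma unit_interval_pos : `]0%R, 1%R[ `<=` (`]0%R, +oo[ : set R).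
Proof. by move=> t /=; rewrite !in_itv/= andbT => /andP[]. Qed.

Lemma measurable_bump_weight alpha b eps (r : R) :
  measurable_fun (`]0%R, 1%R[ : set (measurableTypeR R))
    (fun t : measurableTypeR R => bump_weight alpha b eps t `^ r * t^-1 : R)%R.
Proof.
have mI : measurable (`]0%R, 1%R[ : set (measurableTypeR R)) by exact: measurable_itv.
have minv := measurable_inv_pos mI (@unit_interval_pos).
apply: measurable_funM => //.
apply: (measurableT_comp (measurable_powR r)); apply: measurable_funM.
  apply: measurable_funTS.
  have ml : measurable_fun setT (fun t : measurableTypeR R => 1 - ln t : R)%R.
    by apply: measurable_funB => //; exact: measurable_ln.
  exact: (measurableT_comp (measurable_powR (- b)) ml).
apply: (measurableT_comp (measurable_powR alpha)); apply: measurable_minr => //.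
exact: measurable_funM.
Qed.

Lemma weighted_integrand_ge0 (r : R) (F : R -> \bar R) t : `]0%R, 1%R[%classic t ->
  0 <= F t `^ r * t^-1%:E.
Proof.
rewrite /= in_itv/= => /andP[t0 _].
by apply: mule_ge0; [exact: poweR_ge0|rewrite lee_fin invr_ge0 ltW].
Qed.

Lemma weighted_integral_ge0 (r : R) (F : R -> \bar R) :
  0 <= \int[lebesgue_measure]_(t in `]0%R, 1%R[) (F t `^ r * t^-1%:E).
Proof. by apply: integral_ge0 => t; exact: weighted_integrand_ge0. Qed.

Lemma weighted_norm_le q (F : R -> \bar R) (w : R -> R) c G : 0 < q ->
  (0 <= c)%R -> (0 <= G)%R -> (forall t, (0 <= w t)%R) ->
  (forall r, measurable_fun (`]0%R, 1%R[ : set (measurableTypeR R))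
    (fun t : measurableTypeR R => w t `^ r * t^-1 : R)%R) ->
  (forall t, (0 < t < 1)%R -> 0 <= F t <= (c * w t)%:E) ->
  weighted_norm q (EFin \o w) <= G%:E -> weighted_norm q F <= (c * G)%:E.
Proof.
move=> q0 c0 G0 w0 mw Fw; case: q q0 => [r|_|//]; last first.
  move=> HG; apply: ge_ereal_sup => _ [t /= + <-]; rewrite in_itv/= => t01.
  have /andP[_ Ft] := Fw t t01; apply: le_trans Ft _; rewrite EFinM EFinM lee_wpmul2l//.
  by apply: le_trans HG; apply: ereal_sup_ubound; exists t => //=; rewrite in_itv.
rewrite lte_fin => r0; rewrite /weighted_norm poweR_inv_leP//; last exact: weighted_integral_ge0.
move=> HG; rewrite poweR_inv_leP ?mulr_ge0//; last exact: weighted_integral_ge0.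
apply: (@le_trans _ _ (\int[lebesgue_measure]_(t in `]0%R, 1%R[)
    ((c `^ r)%:E * (w t `^ r * t^-1)%:E))).
  apply: ge0_le_integral_nonmeasurable => t t01; first exact: weighted_integrand_ge0.
  have t01' : (0 < t < 1)%R by move: t01; rewrite /= in_itv.
  have /andP[F0 Fc] := Fw t t01'; have /andP[t0 _] := t01'.
  rewrite EFinM muleA; apply: lee_wpmul2r; first by rewrite lee_fin invr_ge0 ltW.
  rewrite -EFinM -powRM// -poweR_EFin.
  by apply: gt0_ler_poweR; rewrite ?(ltW r0)// ?in_itv/= ?leey ?andbT// lee_fin mulr_ge0.
rewrite ge0_integralZl_EFin ?powR_ge0//; last 2 first.
- move=> t /=; rewrite in_itv/= => /andP[t0 _].
  by rewrite lee_fin mulr_ge0 ?powR_ge0// invr_ge0 ltW.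
- by apply/measurable_EFinP; exact: mw.
by rewrite powRM// EFinM lee_wpmul2l// lee_fin powR_ge0.
Qed.

Lemma bump_weight_le_log alpha b eps t : (0 < alpha)%R -> (0 < eps)%R -> (0 < t)%R ->
  (bump_weight alpha b eps t <= (1 - ln t) `^ (- b))%R.
Proof.
move=> al0 e0 t0; rewrite /bump_weight ler_piMr ?powR_ge0//.
apply: (@le_trans _ _ (1 `^ alpha)%R); last by rewrite powR1.
apply: ge0_ler_powR; rewrite ?nnegrE ?(ltW al0)// ?ge_min ?lexx//.
by rewrite le_min ler01 divr_ge0// ltW.
Qed.

(** For [t < s] the logarithmic weight alone is small in the mean; for [t >= s] a width [eps] that
    is small against [s] makes the other factor small. *)
Lemma bump_weight_powR_le alpha b eps (r s t : R) : (0 < alpha)%R -> (0 < eps)%R -> (0 < r)%R ->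
  (0 < s)%R -> (0 < t)%R ->
  (bump_weight alpha b eps t `^ r * t^-1 <=
   (if t < s then log_weight (b * r) t else 0) +
   (eps / s) `^ (alpha * r) * log_weight (b * r) t)%R.
Proof.
move=> al0 e0 r0 s0 t0.
have lw0 := log_weight_ge0 (b * r) t0.
have -> : (bump_weight alpha b eps t `^ r * t^-1 =
    Num.min 1 (eps / t) `^ (alpha * r) * log_weight (b * r) t)%R.
  by rewrite /bump_weight /log_weight powRM ?powR_ge0// -!powRrM mulNr; ring.
have m0 : (0 <= Num.min 1 (eps / t))%R by rewrite le_min ler01 divr_ge0// ltW.
have ar0 : (0 <= alpha * r)%R by rewrite mulr_ge0// ltW.
have [ts|st] := ltP t s.
  rewrite -[leLHS]addr0; apply: lerD; last by rewrite mulr_ge0 ?powR_ge0.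
  rewrite ler_piMl//; apply: (@le_trans _ _ (1 `^ (alpha * r))%R); last by rewrite powR1.
  by apply: ge0_ler_powR; rewrite ?nnegrE// ge_min lexx.
rewrite add0r ler_wpM2r//; apply: ge0_ler_powR; rewrite ?nnegrE ?divr_ge0 ?(ltW e0) ?(ltW s0)//.
by rewrite ge_min; apply/orP; right; rewrite ler_wpM2l ?(ltW e0)// lef_pV2 ?posrE.
Qed.

Lemma inve_lt_fin (r b : R) : (0 < r)%R -> ((r%:E)^-1 < b%:E)%E = (1 < b * r)%R.
Proof. by move=> r0; rewrite inver gt_eqF// lte_fin -ltr_pdivrMr// div1r. Qed.

Lemma integral_bump_weight alpha b eps (r : R) (s Cs C1 : R) :
  (0 < alpha)%R -> (0 < eps)%R -> (0 < r)%R -> (0 < s)%R ->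
  \int[lebesgue_measure]_(t in `]0%R, s[) (log_weight (b * r) t)%:E <= Cs%:E ->
  \int[lebesgue_measure]_(t in `]0%R, 1%R[) (log_weight (b * r) t)%:E <= C1%:E ->
  \int[lebesgue_measure]_(t in `]0%R, 1%R[) ((EFin \o bump_weight alpha b eps) t `^ r * t^-1%:E)
    <= (Cs + (eps / s) `^ (alpha * r) * C1)%:E.
Proof.
move=> al0 e0 r0 s0 HCs HC1.
have mI c : measurable (`]0%R, c[ : set (measurableTypeR R)) by exact: measurable_itv.
have mlog : measurable_fun (`]0%R, 1%R[ : set (measurableTypeR R))
    (fun t : measurableTypeR R => (log_weight (b * r) t)%:E).
  by apply/measurable_EFinP; apply: measurable_log_weight => //; exact: unit_interval_pos.
pose A (t : measurableTypeR R) : \bar R := ((fun t => (log_weight (b * r) t)%:E) \_ `]0%R, s[) t.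
have mlogs : measurable_fun (`]0%R, s[ : set (measurableTypeR R))
    (fun t : measurableTypeR R => (log_weight (b * r) t)%:E).
  apply/measurable_EFinP; apply: measurable_log_weight => // t /=.
  by rewrite !in_itv/= andbT => /andP[].
have mA : measurable_fun setT A by exact: ((measurable_restrictT _ (mI s)).1 mlogs).
have A0 t : 0 <= A t.
  rewrite /A /patch; case: ifPn => // /[!inE] /=; rewrite in_itv/= => /andP[t0 _].
  by rewrite lee_fin log_weight_ge0.
apply: (@le_trans _ _ (\int[lebesgue_measure]_(t in `]0%R, 1%R[)
   (A t + ((eps / s) `^ (alpha * r))%:E * (log_weight (b * r) t)%:E))).
  apply: ge0_le_integral_nonmeasurable => t t01; first exact: weighted_integrand_ge0.
  have /andP[t0 t1] : (0 < t < 1)%R by move: t01; rewrite /= in_itv.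
  rewrite poweR_EFin -EFinM.
  have := bump_weight_powR_le b al0 e0 r0 s0 t0; rewrite -lee_fin => /le_trans; apply.
  rewrite EFinD EFinM leeD2r// /A /patch.
  by case: ifPn => ts; [rewrite ifT// inE /= in_itv/= t0|exact: A0].
rewrite ge0_integralD//; last 3 first.
- exact: measurable_funTS.
- move=> t /=; rewrite in_itv/= => /andP[t0 _].
  by rewrite -EFinM lee_fin mulr_ge0 ?powR_ge0// log_weight_ge0.
- by apply: emeasurable_funM => //; exact: measurable_cst.
rewrite EFinD; apply: leeD.
  apply: le_trans HCs; rewrite [leRHS]integral_mkcond.
  rewrite integral_mkcond; apply: ge0_le_integral_nonmeasurable => t _.
    by rewrite /patch; case: ifPn.
  by rewrite [leLHS]/patch; case: ifPn => // _; exact: A0.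
rewrite ge0_integralZl_EFin ?powR_ge0//; last first.
  move=> t /=; rewrite in_itv/= => /andP[t0 _]; by rewrite lee_fin log_weight_ge0.
by rewrite EFinM lee_wpmul2l// lee_fin powR_ge0.
Qed.

Lemma weighted_norm_bounded alpha b q : (0 < alpha)%R -> 0 < q -> q^-1 < b%:E ->
  exists2 G : R, (0 <= G)%R & forall eps, (0 < eps)%R ->
    weighted_norm q (EFin \o bump_weight alpha b eps) <= G%:E.
Proof.
move=> al0; case: q => [r|_|//]; last first.
  rewrite invey lte_fin => b0; exists 1%R => // eps e0.
  apply: ge_ereal_sup => _ [t /= + <-]; rewrite in_itv/= => /andP[t0 t1] /=.
  rewrite lee_fin; apply: le_trans (bump_weight_le_log b al0 e0 t0) _.
  rewrite -[leRHS](powRr0 (1 - ln t)) ler_powR ?oppr_le0 ?(ltW b0)//.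
  by rewrite lerBrDr gerDl ln_le0// ltW.
rewrite lte_fin => r0; rewrite inve_lt_fin// => br1.
have [C [rho [C0 /andP[rho0 rho1] HC]]] := integral_log_weight br1.
have := HC 0%N; rewrite expr0 mulr1 /log_node expr0 subrr expR0 => HC1.
exists ((C + C) `^ r^-1)%R; first exact: powR_ge0.
move=> eps e0; rewrite poweR_inv_leP ?powR_ge0//; last exact: weighted_integral_ge0.
rewrite -powRrM mulVf ?gt_eqF// powRr1 ?addr_ge0 ?(ltW C0)//.
apply: (@le_trans _ _ C%:E); last by rewrite lee_fin lerDl ltW.
apply: le_trans HC1; apply: ge0_le_integral_nonmeasurable => t t01.
  exact: weighted_integrand_ge0.
have /andP[t0 _] : (0 < t < 1)%R by move: t01; rewrite /= in_itv.
rewrite poweR_EFin -EFinM lee_fin /log_weight ler_wpM2r ?invr_ge0 ?(ltW t0)//.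
rewrite -mulNr powRrM; apply: ge0_ler_powR; rewrite ?nnegrE ?(ltW r0) ?powR_ge0 ?bump_weight_ge0//.
exact: bump_weight_le_log.
Qed.

Lemma exprn_small (rho x : R) : (0 < rho < 1)%R -> (0 < x)%R -> exists k, (rho ^+ k <= x)%R.
Proof.
move=> /andP[rho0 rho1] x0.
have /cvgr0Pnorm_lt /(_ x x0) [k _ /(_ k (leqnn k))] :
    (rho ^+ n @[n --> \oo] --> (0 : R))%R by apply: cvg_expr; rewrite ger0_norm ?ltW.
by rewrite /= ger0_norm ?exprn_ge0 ?(ltW rho0)// => /ltW; exists k.
Qed.

(** First the cut [s] is chosen so that the logarithmic weight has little mass on [(0, s)], which
    is where [b > 1/q] enters; then the width [eps] is chosen small against [s]. *)
Lemma weighted_norm_small alpha b q : (0 < alpha)%R -> 0 < q -> q^-1 < b%:E ->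
  forall eta eps1, (0 < eta)%R -> (0 < eps1)%R -> exists2 eps, (0 < eps <= eps1)%R &
    weighted_norm q (EFin \o bump_weight alpha b eps) <= eta%:E.
Proof.
move=> al0; case: q => [r|_|//]; last first.
  rewrite invey lte_fin => b0 eta eps1 eta0 e10.
  pose y := (1 + eta `^ (- b^-1))%R.
  have y1 : (0 < y)%R by rewrite addr_gt0 ?powR_gt0.
  have yeta : (y `^ (- b) <= eta)%R.
    rewrite powRN invf_ple ?posrE ?powR_gt0//.
    have -> : (eta^-1 = (eta `^ (- b^-1)) `^ b)%R.
      by rewrite -powRrM mulNr mulVf ?gt_eqF// powR_inv1 ?(ltW eta0).
    by apply: ge0_ler_powR; rewrite ?nnegrE ?(ltW b0) ?powR_ge0 ?(ltW y1)// lerDr.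
  pose s := expR (1 - y).
  have s0 : (0 < s)%R by exact: expR_gt0.
  pose eps := Num.min eps1 (s * eta `^ (alpha^-1))%R.
  have e0 : (0 < eps)%R by rewrite lt_min e10 mulr_gt0 ?powR_gt0.
  have es : (eps / s <= eta `^ (alpha^-1))%R by rewrite ler_pdivrMr// mulrC ge_min lexx orbT.
  exists eps; first by rewrite e0 ge_min lexx.
  apply: ge_ereal_sup => _ [t /= + <-]; rewrite in_itv/= => /andP[t0 t1] /=.
  have l1 : (1 <= 1 - ln t)%R by rewrite lerBrDr gerDl ln_le0// ltW.
  rewrite lee_fin; have [ts|st] := leP t s.
    apply: le_trans (bump_weight_le_log b al0 e0 t0) _; apply: le_trans yeta.
    rewrite !powRN lef_pV2 ?posrE ?powR_gt0// ?(lt_le_trans ltr01)//.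
    apply: ge0_ler_powR; rewrite ?nnegrE ?(ltW b0) ?(ltW y1)// ?(le_trans ler01)//.
    have : (ln t <= ln s)%R by rewrite ler_ln ?posrE.
    by rewrite /s expRK; lra.
  rewrite /bump_weight -[leRHS]mul1r; apply: ler_pM; rewrite ?powR_ge0//.
    by rewrite -[leRHS](powRr0 (1 - ln t)) ler_powR ?oppr_le0 ?(ltW b0).
  have -> : (eta = (eta `^ alpha^-1) `^ alpha)%R.
    by rewrite -powRrM mulVf ?gt_eqF// powRr1 ?(ltW eta0).
  apply: ge0_ler_powR; rewrite ?nnegrE ?(ltW al0) ?powR_ge0//.
    by rewrite le_min ler01 divr_ge0// ltW.
  apply: le_trans es; rewrite ge_min; apply/orP; right.
  by rewrite ler_wpM2l ?(ltW e0)// lef_pV2 ?posrE// ltW.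
rewrite lte_fin => r0; rewrite inve_lt_fin// => br1 eta eps1 eta0 e10.
have [C [rho [C0 rho01 HC]]] := integral_log_weight br1.
have := HC 0%N; rewrite expr0 mulr1 {1}/log_node expr0 subrr expR0 => HC1.
pose z := (eta `^ r / (2 * C))%R.
have z0 : (0 < z)%R by rewrite divr_gt0 ?powR_gt0 ?mulr_gt0.
have [k kz] := exprn_small rho01 z0.
pose s := log_node k : R.
have s0 : (0 < s)%R by exact: log_node_gt0.
have ar0 : (0 < alpha * r)%R by rewrite mulr_gt0.
pose eps := Num.min eps1 (s * z `^ ((alpha * r)^-1))%R.
have e0 : (0 < eps)%R by rewrite lt_min e10 mulr_gt0 ?powR_gt0.
have es : (eps / s <= z `^ ((alpha * r)^-1))%R.
  by rewrite ler_pdivrMr// mulrC ge_min lexx orbT.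
exists eps; first by rewrite e0 ge_min lexx.
rewrite poweR_inv_leP ?(ltW eta0)//; last exact: weighted_integral_ge0.
apply: le_trans (integral_bump_weight al0 e0 r0 s0 (HC k) HC1) _; rewrite lee_fin.
have -> : (eta `^ r = C * z + z * C)%R by rewrite /z; field; rewrite gt_eqF.
apply: lerD; first by rewrite ler_wpM2l// ltW.
rewrite ler_wpM2r ?(ltW C0)//.
have -> : (z = (z `^ (alpha * r)^-1) `^ (alpha * r))%R.
  by rewrite -powRrM mulVf ?gt_eqF// powRr1 ?(ltW z0).
by apply: ge0_ler_powR; rewrite ?nnegrE ?(ltW ar0) ?powR_ge0// divr_ge0// ltW.
Qed.

End weighted_norms.

(** * The embeddings that fail *)

Section nonembedding.
Context {R : realType}.
Local Open Scope ereal_scope.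
Implicit Types (X : domain) (d m : nat) (alpha b eps lambda : R) (q : \bar R).

Lemma Lip_norm_bump X d alpha b (p : R) q : (0 < d)%N -> (0 < alpha)%R -> (1 <= p)%R ->
  0 < q ->
  exists m, (0 < m)%N /\ exists2 C : R, (0 < C)%R & forall eps lambda G, (0 < eps)%R ->
  (X = Torus -> eps <= 1)%R -> (0 <= lambda)%R -> (0 <= G)%R ->
  weighted_norm q (EFin \o bump_weight alpha b eps) <= G%:E ->
  power_integral X p (@bump_fun R X d m eps lambda) <=
    ((lambda * (C * eps `^ (d%:R / p))) `^ p)%:E /\
  Lip_norm X alpha b p q (@bump_fun R X d m eps lambda) <=
  (lambda * (C * (eps `^ (d%:R / p) + eps `^ (d%:R / p - alpha) * G)))%:E.
Proof.
move=> d0 al0 p1 q0; have p0 : (0 < p)%R by exact: lt_le_trans p1.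
have [m [m0 [C C0 HC]]] := bump_modulus X d0 al0 p1.
exists m; split => //.
pose D := (2 `^ (d%:R / p) + C : R)%R.
have D20 : (0 < 2 `^ (d%:R / p) :> R)%R by rewrite powR_gt0.
have D0 : (0 < D)%R by rewrite addr_gt0.
exists D => // eps lambda G e0 Xe l0 G0 HG.
pose f := @bump_fun R X d m eps lambda.
pose S := bump_support X d eps.
have pint : power_integral X p f <= ((lambda * (2 `^ (d%:R / p) * eps `^ (d%:R / p))) `^ p)%:E.
  apply: (@le_trans _ _ (\int[lebesgue_Rd d]_(x in integration_domain X)
      ((lambda `^ p)%:E * (\1_S x)%:E))).
    apply: ge0_le_integral_nonmeasurable => x _; first by rewrite lee_fin powR_ge0.
    rewrite -EFinM lee_fin.
    have fx := bump_le X eps x m0 l0.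
    apply: (@le_trans _ _ ((lambda * \1_S x) `^ p)%R).
      by apply: ge0_ler_powR; rewrite ?nnegrE ?(ltW p0)// mulr_ge0.
    rewrite powRM// indicE; case: (x \in S) => /=; first by rewrite powR1.
    by rewrite powR0 ?gt_eqF.
  rewrite ge0_integralZl_EFin ?powR_ge0//; last 2 first.
  - exact: measurable_integration_domain.
  - apply: measurable_funTS; apply/measurable_EFinP; apply: measurable_indic.
    exact: measurable_bump_support.
  apply: (@le_trans _ _ ((lambda `^ p)%:E * ((2 * eps) ^+ d)%:E)).
    by rewrite lee_wpmul2l ?lee_fin ?powR_ge0//; exact: bump_support_measure.
  have -> : ((2 * eps) ^+ d = (2 `^ (d%:R / p) * eps `^ (d%:R / p)) `^ p)%R.
    rewrite -powRM ?(ltW e0)// -powRrM divfK ?gt_eqF// powR_mulrn// mulr_ge0// ltW//.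
  rewrite -EFinM lee_fin -[X in (X <= _)%R]powRM//.
  by apply: mulr_ge0; rewrite powR_ge0.
have e1 : (0 < eps `^ (d%:R / p))%R by rewrite powR_gt0.
split.
  apply: le_trans pint _; rewrite lee_fin; apply: ge0_ler_powR; rewrite ?nnegrE ?(ltW p0)//.
  - by rewrite mulr_ge0// mulr_ge0// ltW.
  - by apply: mulr_ge0 => //; apply: mulr_ge0; exact: ltW.
  - by apply: ler_wpM2l => //; apply: ler_wpM2r; [exact: ltW|rewrite lerDl ltW].
rewrite Lip_normE mulrDr mulrDr EFinD; apply: leeD.
  rewrite Lp_norm_leP//.
    apply: le_trans pint _; rewrite lee_fin; apply: ge0_ler_powR; rewrite ?nnegrE ?(ltW p0)//.
    - by rewrite mulr_ge0// mulr_ge0// ltW.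
    - by apply: mulr_ge0 => //; apply: mulr_ge0; exact: ltW.
    - by apply: ler_wpM2l => //; apply: ler_wpM2r; [exact: ltW|rewrite lerDl ltW].
  by apply: mulr_ge0 => //; apply: mulr_ge0; exact: ltW.
pose c := (lambda * (C * eps `^ (d%:R / p - alpha)))%R.
have c0 : (0 <= c)%R by rewrite mulr_ge0// mulr_ge0 ?powR_ge0// ltW.
apply: (@le_trans _ _ (c * G)%:E); last first.
  rewrite lee_fin /c -!mulrA ler_wpM2l// ler_wpM2r ?mulr_ge0 ?powR_ge0//.
  by rewrite lerDr ltW.
apply: (weighted_norm_le q0 c0 G0 (@bump_weight_ge0 R alpha b eps) _ _ HG).
  by move=> r; exact: measurable_bump_weight.
move=> t /andP[t0 t1]; rewrite Lip_weighted_ge0 ?(ltW t0)//=.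
rewrite /Lip_weighted.
apply: (@le_trans _ _ ((t `^ (- alpha) * (1 - ln t) `^ (- b))%:E *
   (lambda * (C * eps `^ (d%:R / p) * Num.min 1 (t / eps) `^ alpha))%:E)).
  by rewrite lee_wpmul2l ?lee_fin ?mulr_ge0 ?powR_ge0//; exact: HC.
rewrite -EFinM lee_fin /c /bump_weight.
have key : (t `^ (- alpha) * (eps `^ (d%:R / p) * Num.min 1 (t / eps) `^ alpha) =
    eps `^ (d%:R / p - alpha) * Num.min 1 (eps / t) `^ alpha)%R.
  have te0 : (0 < t / eps)%R by rewrite divr_gt0.
  have -> : (eps `^ (d%:R / p - alpha) = eps `^ (d%:R / p) * eps `^ (- alpha))%R.
    by rewrite powRD// (gt_eqF e0) implybT.
  rewrite mulrCA -mulrA; congr (_ * _)%R.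
  have -> : (Num.min 1 (eps / t) = eps / t * Num.min 1 (t / eps))%R.
    rewrite minr_pMr ?divr_ge0 ?(ltW e0) ?(ltW t0)// mulr1 minC; congr Num.min.
    by field; rewrite !gt_eqF.
  rewrite powRM ?divr_ge0 ?(ltW e0) ?(ltW t0)//; last by rewrite le_min ler01 ltW.
  rewrite mulrA; congr (_ * _)%R.
  rewrite powRM ?invr_ge0 ?(ltW e0) ?(ltW t0)// mulrA -powRD; last by rewrite (gt_eqF e0) implybT.
  rewrite addNr powRr0 mul1r.
  by rewrite powRN -[in RHS]powR_inv1 ?(ltW t0)// powRAC powR_inv1 ?powR_ge0.
rewrite le_eqVlt; apply/orP; left; apply/eqP.
transitivity (lambda * C * (1 - ln t) `^ (- b) *
  (t `^ (- alpha) * (eps `^ (d%:R / p) * Num.min 1 (t / eps) `^ alpha)))%R; first by ring.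
by rewrite key; ring.
Qed.

(** Bumps of height [lambda ~ eps^(-d/r0)] have [L_r0] norm at least 1; if their Lipschitz norm
    can be made arbitrarily small, continuity fails at the origin.  Continuity at the
    zero function is available because a bump of height 0 is in the space. *)
Lemma not_embeds X d alpha b (p r0 : R) q : (0 < d)%N -> (0 < alpha)%R -> (1 <= p)%R ->
  0 < q -> (0 < r0)%R ->
  (forall K delta : R, (0 < K)%R -> (0 < delta)%R ->
    exists eps G, [/\ (0 < eps)%R, (X = Torus -> eps <= 1)%R, (0 <= G)%R,
      weighted_norm q (EFin \o bump_weight alpha b eps) <= G%:E &
      (K * (eps `^ (- (d%:R / r0)) *
        (eps `^ (d%:R / p) + eps `^ (d%:R / p - alpha) * G)) < delta)%R]) ->
  ~ Lip_embeds (d := d) X alpha b p q r0.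
Proof.
move=> d0 al0 p1 q0 r00 small [_ cont].
have p0 : (0 < p)%R by exact: lt_le_trans p1.
have dR0 : (0 < d%:R :> R)%R by rewrite ltr0n.
have [m [m0 [C C0 HC]]] := Lip_norm_bump X b d0 al0 p1 q0.
have inLip eps lambda G : (0 < eps)%R -> (X = Torus -> eps <= 1)%R -> (0 <= lambda)%R ->
    (0 <= G)%R -> weighted_norm q (EFin \o bump_weight alpha b eps) <= G%:E ->
    Lip X alpha b p q (@bump_fun R X d m eps lambda).
  move=> e0 Xe l0 G0 HG; have [pint HL] := HC eps lambda G e0 Xe l0 G0 HG.
  split; last exact: le_lt_trans HL (ltry _).
  split; first by rewrite fun_on_periodic; exact: periodic_on_bump.
    exact: measurable_bump.
  rewrite Lp_normE ?gt_eqF//; apply: poweR_lty; exact: le_lt_trans pint (ltry _).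
have [eps0 [G0 [e00 Xe0 G00 HG0 _]]] := small 1%R 1%R ltr01 ltr01.
have f0L := inLip eps0 0%R G0 e00 Xe0 (lexx _) G00 HG0.
have [delta dl0 Hd] := cont _ f0L 1%R ltr01.
pose K := (2 ^+ m * (8 * d%:R) `^ (d%:R / r0) * C : R)%R.
have K0 : (0 < K)%R by rewrite mulr_gt0// mulr_gt0 ?exprn_gt0 ?powR_gt0 ?mulr_gt0.
have [eps [G [e0 Xe G1 HG lt_delta]]] := small K delta K0 dl0.
pose lambda := (2 ^+ m * (8 * d%:R) `^ (d%:R / r0) * eps `^ (- (d%:R / r0)) : R)%R.
have l0 : (0 < lambda)%R.
  by rewrite mulr_gt0 ?powR_gt0// mulr_gt0 ?exprn_gt0 ?powR_gt0 ?mulr_gt0.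
have gL := inLip eps lambda G e0 Xe (ltW l0) G1 HG.
have gE : (@bump_fun R X d m eps lambda \- @bump_fun R X d m eps0 0)%R =
    @bump_fun R X d m eps lambda.
  by apply/funext => x; rewrite /= /bump_fun mul0r subr0.
have := Hd _ gL; rewrite gE => {}Hd.
have : Lp_norm X r0 (@bump_fun R X d m eps lambda) < 1%:E.
  apply: Hd; have [_ HL] := HC eps lambda G e0 Xe (ltW l0) G1 HG.
  apply: le_lt_trans HL _; rewrite lte_fin; apply: le_lt_trans lt_delta.
  by rewrite /lambda /K le_eqVlt; apply/orP; left; apply/eqP; ring.
apply/negP; rewrite -leNgt Lp_normE ?gt_eqF//.
have low := @bump_power_lower R X d m eps lambda r0 d0 e0 Xe (ltW l0) r00.
have one : ((lambda / 2 ^+ m) `^ r0 * (eps / (8 * d%:R)) ^+ d = 1)%R.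
  rewrite (_ : lambda / 2 ^+ m = (8 * d%:R) `^ (d%:R / r0) * eps `^ (- (d%:R / r0)))%R; last first.
    by rewrite /lambda; field; rewrite expf_neq0.
  have d8 : (0 < 8 * d%:R :> R)%R by rewrite mulr_gt0.
  rewrite powRM ?powR_ge0// -!powRrM mulNr divfK ?gt_eqF// powRN !powR_mulrn ?(ltW e0) ?(ltW d8)//.
  by rewrite expr_div_n; field; rewrite !expf_neq0 ?gt_eqF.
rewrite one in low.
have -> : 1%:E = 1%:E `^ r0^-1 :> \bar R by rewrite poweR_EFin powR1.
apply: gt0_ler_poweR => //; first by rewrite invr_ge0 ltW.
  by rewrite in_itv/= leey andbT lee_fin.
by rewrite in_itv/= leey andbT power_integral_ge0.
Qed.

(** Wide bumps: with [r0 < p] both [eps^(d/p - d/r0)] and [eps^(d/p - alpha - d/r0)] tend to 0 as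
    [eps] tends to infinity, which only the Euclidean space allows. *)
Lemma not_embeds_low_exponent d alpha b (p r0 : R) q : (0 < d)%N -> (0 < alpha)%R ->
  (1 <= p)%R -> 0 < q -> q^-1 < b%:E -> (0 < r0)%R -> (r0 < p)%R ->
  ~ Lip_embeds (d := d) Euclidean alpha b p q r0.
Proof.
move=> d0 al0 p1 q0 bq r00 r0p; apply: not_embeds => // K delta K0 dl0.
have p0 : (0 < p)%R by exact: lt_le_trans p1.
have dR0 : (0 < d%:R :> R)%R by rewrite ltr0n.
have [G G0 HG] := weighted_norm_bounded al0 q0 bq.
pose a := (d%:R / r0 - d%:R / p)%R.
have a0 : (0 < a)%R by rewrite subr_gt0 ltr_pM2l// ltf_pV2 ?posrE.
pose y := (1 + 2 * (K * (1 + G)) / delta)%R.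
have KG0 : (0 < K * (1 + G))%R by rewrite mulr_gt0// ltr_pwDl.
have y1 : (1 <= y)%R by rewrite lerDl divr_ge0 ?(ltW dl0)// mulr_ge0// ltW.
pose eps := (y `^ a^-1)%R.
have e1 : (1 <= eps)%R.
  by rewrite -[leLHS](powRr0 y) ler_powR// invr_ge0 ltW.
have e0 : (0 < eps)%R by exact: lt_le_trans e1.
exists eps, G; split => //; first exact: HG.
have yN : (eps `^ (- a) = y^-1)%R.
  rewrite /eps -powRrM mulrN mulVf ?gt_eqF// powR_inv1// (le_trans ler01)//.
have s1 : (eps `^ (- (d%:R / r0)) * eps `^ (d%:R / p) = y^-1)%R.
  rewrite -powRD; last by rewrite (gt_eqF e0) implybT.
  by rewrite -yN; congr (_ `^ _)%R; rewrite /a; ring.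
have s2 : (eps `^ (- (d%:R / r0)) * eps `^ (d%:R / p - alpha) <= y^-1)%R.
  rewrite -powRD; last by rewrite (gt_eqF e0) implybT.
  rewrite -yN; apply: ler_powR => //; rewrite /a; lra.
apply: (@le_lt_trans _ _ (K * (y^-1 * (1 + G)))%R).
  rewrite ler_wpM2l ?(ltW K0)// mulrDr s1 mulrDr mulr1 lerD2l mulrA ler_wpM2r//.
have y0 : (0 < y)%R by exact: lt_le_trans y1.
rewrite (_ : K * (y^-1 * (1 + G)) = K * (1 + G) / y)%R; last by ring.
have -> : (K * (1 + G) = (y - 1) * delta / 2)%R.
  by rewrite /y; field; rewrite gt_eqF.
rewrite ltr_pdivrMr//; nra.
Qed.

(** Narrow bumps: at the critical exponent the powers of [eps] cancel exactly, and only the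
    logarithmic gain makes the Lipschitz norm small. *)
Lemma not_embeds_high_exponent X d alpha b (p r0 : R) q : (0 < d)%N -> (0 < alpha)%R ->
  (1 <= p)%R -> 0 < q -> q^-1 < b%:E -> (0 < r0)%R -> (d%:R / r0 <= d%:R / p - alpha)%R ->
  ~ Lip_embeds (d := d) X alpha b p q r0.
Proof.
move=> d0 al0 p1 q0 bq r00 crit; apply: not_embeds => // K delta K0 dl0.
have p0 : (0 < p)%R by exact: lt_le_trans p1.
pose eta := (delta / (4 * K))%R.
have eta0 : (0 < eta)%R by rewrite divr_gt0// mulr_gt0.
pose eps1 := Num.min 1%R (eta `^ alpha^-1)%R.
have e10 : (0 < eps1)%R by rewrite lt_min ltr01 powR_gt0.
have [eps /andP[e0 ee1] HG] := weighted_norm_small al0 q0 bq eta0 e10.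
have e1 : (eps <= 1)%R by rewrite (le_trans ee1)// ge_min lexx.
have ea : (eps `^ alpha <= eta)%R.
  have -> : (eta = (eta `^ alpha^-1) `^ alpha)%R.
    by rewrite -powRrM mulVf ?gt_eqF// powRr1 ?(ltW eta0).
  apply: ge0_ler_powR; rewrite ?nnegrE ?(ltW al0) ?(ltW e0) ?powR_ge0//.
  by rewrite (le_trans ee1)// ge_min lexx orbT.
exists eps, eta; split => //; first exact: ltW.
have e01 : (0 < eps <= 1)%R by rewrite e0.
have s1 : (eps `^ (- (d%:R / r0)) * eps `^ (d%:R / p) <= eta)%R.
  apply: le_trans ea; rewrite -powRD; last by rewrite (gt_eqF e0) implybT.
  by apply: ger_powR => //; lra.
have s2 : (eps `^ (- (d%:R / r0)) * eps `^ (d%:R / p - alpha) <= 1)%R.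
  rewrite -powRD; last by rewrite (gt_eqF e0) implybT.
  by rewrite -[leRHS](powRr0 eps); apply: ger_powR => //; lra.
apply: (@le_lt_trans _ _ (K * (eta + eta))%R).
  rewrite ler_wpM2l ?(ltW K0)// mulrDr; apply: lerD => //.
  by rewrite mulrA -[leRHS]mul1r ler_wpM2r// ltW.
rewrite (_ : K * (eta + eta) = delta / 2)%R; last by rewrite /eta; field; rewrite gt_eqF.
by rewrite ltr_pdivrMr// ltr_pMr// ltr1n.
Qed.

End nonembedding.

(** * The characterisation of the embeddings *)

Theorem theorem10p4 (R : realType) (d : nat) (p r0 alpha r b : R) (q : \bar R)
  (d_gt0 : (0 < d)%N)
  (p_gt : 2 * d%:R / (d%:R + 1) < p)
  (r0_gt : 2 * d%:R / (d%:R + 1) < r0)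
  (alpha_gt0 : 0 < alpha) (alpha_lt : alpha < d%:R / p)
  (r_def : alpha - d%:R / p = - (d%:R / r))
  (q_gt0 : (0 < q)%E) (b_gt : (q^-1 < b%:E)%E) :
  (Lip_embeds (d := d) Euclidean alpha b p q r0 <-> p <= r0 < r) /\
  (p <= r0 -> (Lip_embeds (d := d) Torus alpha b p q r0 <-> p <= r0 < r)) /\
  (r0 < p -> Lip_embeds (d := d) Torus alpha b p q r0).
Proof.
have d1 : 1 <= d%:R :> R by rewrite ler1n.
have dR0 : 0 < d%:R :> R by exact: lt_le_trans d1.
(* Both exponents are in the Banach range because [2 d / (d + 1) >= 1]. *)
have c1 : 1 <= 2 * d%:R / (d%:R + 1) :> R by rewrite ler_pdivlMr; lra.
have p1 : 1 <= p by apply: le_trans c1 (ltW p_gt).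
have r01 : 1 <= r0 by apply: le_trans c1 (ltW r0_gt).
have p0 : 0 < p by exact: lt_le_trans p1.
have r00 : 0 < r0 by exact: lt_le_trans r01.
have b0 : 0 < b.
  rewrite -lte_fin; apply: le_lt_trans b_gt; rewrite inve_ge0; exact: ltW.
have dr : d%:R / r = d%:R / p - alpha by lra.
have rgt0 : 0 < r by rewrite -invr_gt0 -(pmulr_rgt0 _ dR0) dr subr_gt0.
have subcritical X : p <= r0 < r -> Lip_embeds (d := d) X alpha b p q r0.
  move=> /andP[pr0 r0r]; apply: subcritical_embedding => //.
  have : d%:R / r < d%:R / r0 by rewrite ltr_pM2l// ltf_pV2 ?posrE.
  by rewrite dr; lra.
have supercritical X : r <= r0 -> ~ Lip_embeds (d := d) X alpha b p q r0.
  move=> rr0; apply: not_embeds_high_exponent => //.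
  by rewrite -dr ler_pM2l// lef_pV2 ?posrE.
split; last split.
- split; last exact: subcritical.
  move=> emb; apply/andP; split; rewrite leNgt || rewrite ltNge; apply/negP => H.
    exact: (not_embeds_low_exponent d_gt0 alpha_gt0 p1 q_gt0 b_gt r00 H emb).
  exact: (supercritical Euclidean H emb).
- move=> pr0; split; last exact: subcritical.
  move=> emb; rewrite pr0 ltNge; apply/negP => H; exact: (supercritical Torus H emb).
- by move=> /ltW r0p; exact: torus_lower_exponent_embedding.
Qed.
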